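(* Let $N\ge 2$ be an integer, let $\tilde\pi=(H,U,\pi)$ be a normal wavelet representation of scale $N$, and let $\varphi\in H$. Then $\varphi$ is an orthogonal scaling vector for $\tilde\pi$ if and only if the following three conditions are satisfied: (i) [Orthogonality] the correlation function of $\varphi$ is $h_\varphi=1$ a.e. on $\mathbb{T}$; (ii) [Scaling equation] there exists a non-degenerate $m_0\in L^\infty(\mathbb{T})$ such that $U\varphi=\pi(m_0)\varphi$; (iii) [Cyclicity] there is no orthogonal projection $p\neq 1$ in the commutant $\tilde\pi'$ such that $p\varphi=\varphi$.
   Context: $\mathbb{T}=\{z\in\mathbb{C}: |z|=1\}$, with normalized Haar measure $\mu$. A wavelet representation (of scale $N$) is a triple $\tilde\pi=(H,U,\pi)$ where $H$ is a Hilbert space, $U$ is a unitary on $H$ and $\pi$ is a representation (unital $*$-homomorphism) of $L^\infty(\mathbb{T})$ on $H$ such that $U\pi(f)U^{-1}=\pi(f(z^N))$ for all $f\in L^\infty(\mathbb{T})$, where $f(z^N)$ denotes the map $z\mapsto f(z^N)$. Put $T:=\pi(z)$, where $z$ is the identity function on $\mathbb{T}$. It is normal if whenever $(f_n)$ is a sequence in $L^\infty(\mathbb{T})$ converging pointwise a.e. to $f\in L^\infty(\mathbb{T})$ with $\|f_n\|_\infty\le M$ for all $n$ and some $M>0$, then $\pi(f_n)\to\pi(f)$ in the strong operator topology. The commutant $\tilde\pi'$ is the set of bounded operators on $H$ commuting with $U$ and with all $\pi(f)$, $f\in L^\infty(\mathbb{T})$. A multiresolution analysis (MRA) is a sequence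 $(V_n)_{n\in\mathbb{Z}}$ of closed subspaces of $H$ such that $V_n\subset V_{n+1}$; $\overline{\bigcup_n V_n}=H$; $\bigcap_n V_n=\{0\}$; $U(V_n)=V_{n-1}$; and there is $\varphi\in V_0$ such that $\{T^k\varphi: k\in\mathbb{Z}\}$ is an orthonormal basis of $V_0$. A vector $\varphi\in H$ is an orthogonal scaling vector if there exists an MRA for which $\varphi\in V_0$ has this last property. For a normal wavelet representation and $v\in H$, the correlation function $h_v\in L^1(\mathbb{T})$ is the function determined by $\langle \pi(f)v\,|\,v\rangle=\int_{\mathbb{T}} f\,h_v\,d\mu$ for all $f\in L^\infty(\mathbb{T})$. A function $m_0\in L^\infty(\mathbb{T})$ is degenerate if $|m_0(z)|=1$ for a.e. $z\in\mathbb{T}$ and there exist a measurable $\xi:\mathbb{T}\to\mathbb{T}$ and $\lambda\in\mathbb{T}$ such that $m_0(z)\xi(z^N)=\lambda\xi(z)$ for a.e. $z\in\mathbb{T}$; otherwise it is non-degenerate. *)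

(* Defs.v *)
From HB Require Import structures.
From mathcomp Require Import all_boot all_order all_algebra.
From mathcomp Require Import complex.
From mathcomp Require Import all_classical all_reals all_analysis.
From mathcomp Require Import measurable_realfun ess_sup_inf.

Set Implicit Arguments.
Unset Strict Implicit.
Unset Printing Implicit Defensive.

Import Order.TTheory GRing.Theory Num.Theory.
Import numFieldNormedType.Exports.

Local Open Scope classical_set_scope.
Local Open Scope ring_scope.
Local Open Scope complex_scope.

Section Circle.
Variable R : realType.

Record circle_point := CirclePoint {
  circle_val :> R[i];
  circle_valP : `|circle_val| == 1 }.

HB.instance Definition _ := [isSub for circle_val].
HB.instance Definition _ := [Choice of circle_point by <:].

Definition circle_one : circle_point := CirclePoint (introT eqP (normr1 R[i])).

HB.instance Definition _ := isPointed.Build circle_point circle_one.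

Definition circle_coord (z : circle_point) : R * R :=
  (complex.Re (z : R[i]), complex.Im (z : R[i])).

(* The Borel sets of the circle are the traces of the Borel sets of the plane. *)
Definition circle : Type := g_sigma_algebra_preimageType circle_coord.

HB.instance Definition _ := Measurable.on circle.

Lemma circle_exp_subproof (z : circle) (n : nat) : `|(z : R[i]) ^+ n| == 1.
Proof. by rewrite normrX (eqP (circle_valP z)) expr1n. Qed.

Definition circle_pow (n : nat) (z : circle) : circle :=
  CirclePoint (circle_exp_subproof z n).

Lemma cis_subproof (t : R) : `|cos (2 * pi * t) +i* sin (2 * pi * t)| == 1.
Proof. by rewrite normc_def /= cos2Dsin2 sqrtr1. Qed.

Definition cis (t : measurableTypeR R) : circle := CirclePoint (cis_subproof t).

Lemma measurable_cis : measurable_fun [set: measurableTypeR R] cis.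
Proof.
have m2 : measurable_fun [set: R] (fun t : R => 2 * pi * t).
  exact: measurable_funM.
have mc : measurable_fun [set: R] (circle_coord \o cis).
  apply/measurable_fun_pairP; split.
    exact: (measurableT_comp
      (continuous_measurable_fun (@continuous_cos R)) m2).
  exact: (measurableT_comp
    (continuous_measurable_fun (@continuous_sin R)) m2).
move=> _ _ [B mB <-].
by rewrite (setTI (circle_coord @^-1` B)) -comp_preimage; exact: mc.
Qed.

HB.instance Definition _ := isMeasurableFun.Build _ _ _ _ cis measurable_cis.

(* Normalized Haar measure, as the law of exp (2 i pi t) for t uniform on
   [0, 1]. *)
Definition haar : probability circle R :=
  distribution
    (uniform_prob (@ltr01 R) : probability (measurableTypeR R) R) cis.

Implicit Types f g : circle -> R[i].

Definition cmeasurable f :=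
  measurable_fun [set: circle] (fun z => complex.Re (f z)) /\
  measurable_fun [set: circle] (fun z => complex.Im (f z)).

Definition Linf_norm f : \bar R := Lnorm haar +oo%E (fun z => (complex.Re `|f z|)%:E).

Definition Linf f := cmeasurable f /\ (Linf_norm f < +oo)%E.

Definition ae_equal f g := {ae haar, forall z, f z = g z}.

Definition Lone f :=
  haar.-integrable [set: circle] (fun z => (complex.Re (f z))%:E) /\
  haar.-integrable [set: circle] (fun z => (complex.Im (f z))%:E).

Definition cintegral f : R[i] :=
  (\int[haar]_z complex.Re (f z))%R +i* (\int[haar]_z complex.Im (f z))%R.

Definition degenerate (N : nat) (m0 : circle -> R[i]) :=
  {ae haar, forall z, `|m0 z| = 1} /\
  exists xi : circle -> circle, measurable_fun [set: circle] xi /\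
  exists lambda : circle,
    {ae haar, forall z,
      m0 z * (xi (circle_pow N z) : R[i]) = (lambda : R[i]) * (xi z : R[i])}.

End Circle.

(* Inner products are linear in the first variable. *)
Record hilbert (R : realType) := Hilbert {
  hilbert_carrier :> completeNormedModType R[i];
  inner : {dot hilbert_carrier for @Num.conj R[i]};
  inner_norm : forall x, inner x x = `|x| ^+ 2 }.

Arguments inner {R h}.

Section Operators.
Variables (R : realType) (H : hilbert R).

Definition bounded_operator (A : {linear H -> H}) :=
  exists M : R, forall x, `|A x| <= M%:C * `|x|.

Record unitary := Unitary {
  unitary_fun :> {linear H -> H};
  unitary_inv : H -> H;
  unitary_inner : forall x y, inner (unitary_fun x) (unitary_fun y) = inner x y;
  unitaryK : cancel unitary_fun unitary_inv;
  unitary_invK : cancel unitary_inv unitary_fun }.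

Definition unitary_exp (W : unitary) (k : int) : H -> H :=
  match k with
  | Posz n => iter n W
  | Negz n => iter n.+1 (unitary_inv W)
  end.

Definition orthogonal_projection (p : {linear H -> H}) :=
  [/\ bounded_operator p, (forall x, p (p x) = p x) &
      forall x y, inner (p x) y = inner x (p y)].

Definition closed_subspace (V : set H) :=
  [/\ closed V, V 0 & forall (a : R[i]) x y, V x -> V y -> V (a *: x + y)].

Definition lin_span (I : eqType) (e : I -> H) : set H :=
  [set x | exists (s : seq I) (c : I -> R[i]), x = \sum_(i <- s) c i *: e i].

Definition orthonormal_basis (I : eqType) (e : I -> H) (V : set H) :=
  (forall i j, inner (e i) (e j) = (i == j)%:R) /\ closure (lin_span e) = V.

End Operators.

(* An element of L^infty is represented by a function satisfying Linf, so that
   pi is a function on representatives which factors through a.e. equality; its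
   values outside Linf are irrelevant. *)
Record wavelet_rep (R : realType) (N : nat) := WaveletRep {
  wspace :> hilbert R;
  wU : unitary wspace;
  wpi : (circle R -> R[i]) -> {linear wspace -> wspace};
  wpi_bounded : forall f, Linf f -> bounded_operator (wpi f);
  wpi_ae : forall f g, Linf f -> Linf g -> ae_equal f g ->
    forall x, wpi f x = wpi g x;
  wpi_linear : forall (a : R[i]) f g, Linf f -> Linf g ->
    forall x, wpi (fun z => a * f z + g z) x = a *: wpi f x + wpi g x;
  wpi_mul : forall f g, Linf f -> Linf g ->
    forall x, wpi (fun z => f z * g z) x = wpi f (wpi g x);
  wpi_one : forall x, wpi (fun=> 1) x = x;
  wpi_star : forall f, Linf f ->
    forall x y, inner (wpi f x) y = inner x (wpi (fun z => Num.conj (f z)) y);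
  wpi_intertwine : forall f, Linf f ->
    forall x, wU (wpi f (unitary_inv wU x)) = wpi (fun z => f (circle_pow N z)) x }.

Section IdentityFunction.
Variable R : realType.

Lemma measurable_circle_coord : measurable_fun [set: circle R] (@circle_coord R).
Proof. by move=> _ B mB; exists B. Qed.

Lemma cmeasurable_id : cmeasurable (fun z : circle R => (z : R[i])).
Proof.
by have /measurable_fun_pairP[] := measurable_circle_coord.
Qed.

Lemma cmeasurable_conj (f : circle R -> R[i]) :
  cmeasurable f -> cmeasurable (fun z => Num.conj (f z)).
Proof.
move=> [mr mi]; split.
  rewrite (_ : (fun _ => _) = fun z => complex.Re (f z)) //.
  by apply/funext => z; case: (f z).
rewrite (_ : (fun _ => _) = fun z => - complex.Im (f z)).
  exact: measurableT_comp.
by apply/funext => z; case: (f z).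
Qed.

Lemma Linf_unimodular (f : circle R -> R[i]) :
  cmeasurable f -> (forall z, `|f z| = 1) -> Linf f.
Proof.
move=> mf f1; split => //; rewrite /Linf_norm unlock.
case: ifPn => _; last exact: ltry.
apply: (@le_lt_trans _ _ 1%E); last exact: ltry.
by apply/ess_supP/nearW => z; rewrite /comp f1 /= normr1.
Qed.

Lemma Linf_id : Linf (fun z : circle R => (z : R[i])).
Proof.
apply: Linf_unimodular; first exact: cmeasurable_id.
by move=> z; apply/eqP; exact: circle_valP.
Qed.

Lemma Linf_conj_id : Linf (fun z : circle R => Num.conj (z : R[i])).
Proof.
apply: Linf_unimodular; first exact/cmeasurable_conj/cmeasurable_id.
by move=> z; rewrite norm_conjC; apply/eqP; exact: circle_valP.
Qed.

Lemma circle_mul_conj (z : circle R) : (z : R[i]) * Num.conj (z : R[i]) = 1.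
Proof. by rewrite -normCK (eqP (circle_valP z)) expr1n. Qed.

Lemma circle_conj_mul (z : circle R) : Num.conj (z : R[i]) * (z : R[i]) = 1.
Proof. by rewrite mulrC circle_mul_conj. Qed.

End IdentityFunction.

Section WaveletRepresentation.
Variables (R : realType) (N : nat) (W : wavelet_rep R N).
Implicit Types (v phi : wspace W) (f g h : circle R -> R[i]).

Definition wT_fun : {linear wspace W -> wspace W} :=
  wpi W (fun z => (z : R[i])).

(* The inverse of T, that is pi (z^-1). *)
Definition wT_inv : wspace W -> wspace W :=
  wpi W (fun z => Num.conj (z : R[i])).

Lemma wT_funK : cancel wT_fun wT_inv.
Proof.
move=> x; rewrite /wT_inv /wT_fun -wpi_mul; [|exact: Linf_conj_id|exact: Linf_id].
by under eq_fun do rewrite circle_conj_mul; exact: wpi_one.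
Qed.

Lemma wT_invK : cancel wT_inv wT_fun.
Proof.
move=> x; rewrite /wT_inv /wT_fun -wpi_mul; [|exact: Linf_id|exact: Linf_conj_id].
by under eq_fun do rewrite circle_mul_conj; exact: wpi_one.
Qed.

Lemma wT_inner x y : inner (wT_fun x) (wT_fun y) = inner x y.
Proof.
by rewrite {1}/wT_fun wpi_star; [rewrite -/wT_inv wT_funK|exact: Linf_id].
Qed.

Definition wT : unitary (wspace W) := Unitary wT_inner wT_funK wT_invK.

Definition normal_rep :=
  forall (f_ : nat -> circle R -> R[i]) f,
    (forall n, Linf (f_ n)) -> Linf f ->
    {ae haar R, forall z, (fun n => f_ n z : R[i]^o) @ \oo --> (f z : R[i]^o)} ->
    (exists2 M : R, 0 < M & forall n, (Linf_norm (f_ n) <= M%:E)%E) ->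
    forall v, (fun n => wpi W (f_ n) v) @ \oo --> wpi W f v.

Definition in_commutant (A : {linear wspace W -> wspace W}) :=
  [/\ bounded_operator A,
      forall v, A (wU W v) = wU W (A v) &
      forall f, Linf f -> forall v, A (wpi W f v) = wpi W f (A v)].

Definition correlation_function v h :=
  Lone h /\
  forall f, Linf f -> inner (wpi W f v) v = cintegral (fun z => f z * h z).

Definition T_orbit v (k : int) : wspace W := unitary_exp wT k v.

Definition MRA (V : int -> set (wspace W)) :=
  [/\ (forall n, closed_subspace (V n)) /\ (forall n, V n `<=` V (n + 1)),
      closure (\bigcup_n V n) = [set: wspace W],
      \bigcap_n V n = [set 0],
      forall n, wU W @` V n = V (n - 1) &
      exists2 phi, V 0 phi & orthonormal_basis (T_orbit phi) (V 0)].

Definition orthogonal_scaling_vector phi :=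
  exists V, [/\ MRA V, V 0 phi & orthonormal_basis (T_orbit phi) (V 0)].

End WaveletRepresentation.

(* Main.v *)
(* A vector phi whose correlation function is 1 identifies the closed span V0 of
   its T-orbit with L^2 of the circle, phi being the constant 1; a Radon-Nikodym
   density realises v in V0 as a function g with v = pi(g) phi.

   For a scaling vector, U phi lies in V0, and its density m0 is bounded since the
   mean of |m0|^2 over N-th roots is 1. If m0 xi(z^N) = lambda xi, then pi(xi) phi
   is an eigenvector of U, hence lies in every V_n, which is impossible.

   Conversely put V_n = U^-n V0. The projection onto the closure of the union lies
   in the commutant and fixes phi, so cyclicity gives density. Let K be the
   intersection of the V_n. The map sigma(z) = z^N being mixing,
   <pi(f) a, b> - <a, b> <pi(f) U^m phi, U^m phi> tends to 0 for a, b in K, so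
   orthogonal unit vectors of K would have equal moduli and disjoint supports as
   functions. Thus dim K <= 1. If a spans K then U a = lambda a, and mixing makes
   |a|^2 dmu, which is sigma-invariant, equal to mu; so a is unimodular and
   m0 a(z^N) = lambda a, that is, m0 is degenerate. *)

From HB Require Import structures.
Require Import Defs.
From mathcomp Require Import all_boot all_order all_algebra.
From mathcomp Require Import complex.
From mathcomp Require Import all_classical all_reals all_analysis.
From mathcomp Require Import measurable_realfun ess_sup_inf ring lra zify.

Set Implicit Arguments.
Unset Strict Implicit.
Unset Printing Implicit Defensive.

Import Order.TTheory GRing.Theory Num.Theory.
Import numFieldNormedType.Exports.
Import HBNNSimple.

Local Open Scope classical_set_scope.
Local Open Scope ring_scope.
Local Open Scope complex_scope.

(** * Real-valued norms *)

Section RealNorm.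
Variable R : realType.

(** No L^2 space is built: a vector is seen only through the numbers <pi(f) v, phi>. Identities
    between such numbers are checked on characters or indicators and then extended, because
    normality on one side and dominated convergence on the other both respect bounded pointwise
    limits. Mixing is usable because a vector of K can be pulled back arbitrarily far. With U^-m a
    and U^-m b in V0, the form <pi(f) a, b> is governed by the compression of U^-m pi(f) U^m to V0,
    which is multiplication by a function F. So f is traded for F(z^(N^m)), and such a function is
    exactly uncorrelated with every nonzero low Fourier mode. Since F changes with m, the mixing
    estimate has to be uniform over all F with a common bound; this is why the norm of pi(f) must
    first be controlled by the sup norm of f. Symbols of vectors come out only as integrable
    functions. They are made bounded either by an a priori estimate <pi(1_A) v, phi> = O(mu A) or by
    a positive bounded multiplier. *)

Definition nrm (V : normedZmodType R[i]) (x : V) : R := complex.Re `|x|.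

Lemma nrmE (V : normedZmodType R[i]) (x : V) : `|x| = (nrm x)%:C.
Proof. by rewrite /nrm RRe_real ?normr_real. Qed.

Lemma nrm_ge0 (V : normedZmodType R[i]) (x : V) : 0 <= nrm x.
Proof. by rewrite -lecR -nrmE; exact: normr_ge0. Qed.

Lemma nrm0 (V : normedZmodType R[i]) : nrm (0 : V) = 0.
Proof. by rewrite /nrm normr0. Qed.

Lemma nrm_eq0 (V : normedZmodType R[i]) (x : V) : (nrm x == 0) = (x == 0).
Proof. by rewrite -[x == 0]normr_eq0 nrmE (inj_eq (@complexI R)). Qed.

Lemma nrmD (V : normedZmodType R[i]) (x y : V) : nrm (x + y) <= nrm x + nrm y.
Proof. by have := ler_normD x y; rewrite !nrmE -rmorphD lecR. Qed.

Lemma nrmN (V : normedZmodType R[i]) (x : V) : nrm (- x) = nrm x.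
Proof. by rewrite /nrm normrN. Qed.

Lemma nrmB (V : normedZmodType R[i]) (x y : V) : nrm (x - y) <= nrm x + nrm y.
Proof. by rewrite -(nrmN y) nrmD. Qed.

Lemma nrm_distC (V : normedZmodType R[i]) (x y : V) : nrm (x - y) = nrm (y - x).
Proof. by rewrite -nrmN opprB. Qed.

Lemma nrmZ (V : normedModType R[i]) (a : R[i]) (x : V) :
  nrm (a *: x) = nrm a * nrm x.
Proof. by have := normrZ a x; rewrite !nrmE -rmorphM => /complexI. Qed.

Lemma nrmM (a b : R[i]) : nrm (a * b) = nrm a * nrm b.
Proof. by have := normrM a b; rewrite !nrmE -rmorphM => /complexI. Qed.

Lemma nrm1 : nrm (1 : R[i]) = 1.
Proof. by rewrite /nrm normr1. Qed.

Lemma nrm_conj (a : R[i]) : nrm (Num.conj a) = nrm a.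
Proof. by rewrite /nrm norm_conjC. Qed.

Lemma nrmC (r : R) : nrm (r%:C : R[i]) = `|r|.
Proof. by rewrite /nrm normc_def /= expr0n addr0 sqrtr_sqr. Qed.

Lemma nrm_sqr (a : R[i]) : nrm a ^+ 2 = complex.Re a ^+ 2 + complex.Im a ^+ 2.
Proof. by rewrite /nrm normc_def /= sqr_sqrtr // addr_ge0 ?sqr_ge0. Qed.

Lemma conj_re (a : R[i]) : complex.Re (Num.conj a) = complex.Re a.
Proof. by case: a. Qed.

Lemma conj_im (a : R[i]) : complex.Im (Num.conj a) = - complex.Im a.
Proof. by case: a. Qed.

Lemma mulcJ (a : R[i]) : a * Num.conj a = (nrm a ^+ 2)%:C.
Proof. by rewrite -normCK nrmE rmorphXn. Qed.

Lemma re_mul (a b : R[i]) :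
  complex.Re (a * b) = complex.Re a * complex.Re b - complex.Im a * complex.Im b.
Proof. by case: a; case: b. Qed.

Lemma im_mul (a b : R[i]) :
  complex.Im (a * b) = complex.Re a * complex.Im b + complex.Im a * complex.Re b.
Proof. by case: a => a a'; case: b => b b' /=; rewrite [LHS]addrC addrC. Qed.

Lemma re_add (a b : R[i]) : complex.Re (a + b) = complex.Re a + complex.Re b.
Proof. by case: a; case: b. Qed.

Lemma im_add (a b : R[i]) : complex.Im (a + b) = complex.Im a + complex.Im b.
Proof. by case: a; case: b. Qed.

Lemma le_re_nrm (a : R[i]) : `|complex.Re a| <= nrm a.
Proof.
rewrite -(@ler_pXn2r _ 2) ?nnegrE ?nrm_ge0 // nrm_sqr real_normK ?num_real //.
by rewrite lerDl sqr_ge0.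
Qed.

Lemma le_im_nrm (a : R[i]) : `|complex.Im a| <= nrm a.
Proof.
rewrite -(@ler_pXn2r _ 2) ?nnegrE ?nrm_ge0 // nrm_sqr real_normK ?num_real //.
by rewrite lerDr sqr_ge0.
Qed.

Lemma nrm_le_reim (a : R[i]) : nrm a <= `|complex.Re a| + `|complex.Im a|.
Proof.
rewrite -(@ler_pXn2r _ 2) ?nnegrE ?nrm_ge0 ?addr_ge0 // nrm_sqr sqrrD.
rewrite !real_normK ?num_real //.
have : 0 <= `|complex.Re a| * `|complex.Im a| by rewrite mulr_ge0.
lra.
Qed.

(* The norms of Defs take values in R[i]; nrm and tends bring them back to R. *)
Definition tends (V : normedZmodType R[i]) (x_ : nat -> V) (x : V) :=
  forall e : R, 0 < e -> exists n0, forall n, (n0 <= n)%N -> nrm (x - x_ n) < e.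

Lemma tends_unique (V : normedZmodType R[i]) (x_ : nat -> V) (x y : V) :
  tends x_ x -> tends x_ y -> x = y.
Proof.
move=> xx xy; apply/eqP; rewrite -subr_eq0 -nrm_eq0.
apply/eqP/le_anti; rewrite nrm_ge0 andbT; apply/ler_addgt0Pr => e e0; rewrite add0r.
have e20 : 0 < e / 2 by lra.
have [n Hn] := xx _ e20; have [m Hm] := xy _ e20.
have := Hn (maxn n m) (leq_maxl _ _); have := Hm (maxn n m) (leq_maxr _ _).
have -> : x - y = (x - x_ (maxn n m)) - (y - x_ (maxn n m)).
  by rewrite opprB addrA subrK.
have := nrmB (x - x_ (maxn n m)) (y - x_ (maxn n m)); lra.
Qed.

Lemma tends_cst (V : normedZmodType R[i]) (x : V) : tends (fun=> x) x.
Proof. by move=> e e0; exists 0%N => n _; rewrite subrr nrm0. Qed.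

Lemma tendsP (V : normedModType R[i]) (x_ : nat -> V) (x : V) :
  tends x_ x <-> (x_ @ \oo --> x).
Proof.
split=> [t|/cvgrPdist_lt t].
  apply/cvgrPdist_lt => e e0; have eR : e = (complex.Re e)%:C.
    by rewrite RRe_real // gtr0_real.
  have e0' : 0 < complex.Re e by rewrite -ltcR -eR.
  have [n Hn] := t _ e0'; exists n => // m /= nm.
  by rewrite nrmE eR ltcR Hn.
move=> e e0; have := t e%:C; rewrite ltcR => /(_ e0)[n _ Hn].
by exists n => m nm; have := Hn _ nm; rewrite /= nrmE ltcR.
Qed.

Lemma tends_lip (V V' : normedZmodType R[i]) (F : V -> V') (C : R) x_ x :
  (forall n, nrm (F x - F (x_ n)) <= C * nrm (x - x_ n)) -> tends x_ x ->
  tends (fun n => F (x_ n)) (F x).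
Proof.
move=> HF t e e0; have e1 : 0 < e / (`|C| + 1) by rewrite divr_gt0 ?ltr_pwDr.
have [n Hn] := t _ e1; exists n => m nm; apply: le_lt_trans (HF m) _.
have := Hn _ nm; rewrite ltr_pdivlMr ?ltr_pwDr // mulrDr mulr1 mulrC => H.
have := ler_wpM2r (nrm_ge0 (x - x_ m)) (ler_norm C).
have := nrm_ge0 (x - x_ m); lra.
Qed.

Lemma tendsD (V : normedZmodType R[i]) (x_ y_ : nat -> V) x y :
  tends x_ x -> tends y_ y -> tends (fun n => x_ n + y_ n) (x + y).
Proof.
move=> xx yy e e0; have e20 : 0 < e / 2 by lra.
have [n Hn] := xx _ e20; have [m Hm] := yy _ e20.
exists (maxn n m) => k; rewrite geq_max => /andP[/Hn nk /Hm mk].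
rewrite opprD addrACA; apply: le_lt_trans (nrmD _ _) _; lra.
Qed.

Lemma tends_mull (a : R[i]) (x_ : nat -> R[i]) x :
  tends x_ x -> tends (fun n => a * x_ n) (a * x).
Proof.
by apply: (@tends_lip _ _ (fun x => a * x) (nrm a)) => n; rewrite -mulrBr nrmM.
Qed.

Lemma tends_mulr (a : R[i]) (x_ : nat -> R[i]) x :
  tends x_ x -> tends (fun n => x_ n * a) (x * a).
Proof. by move=> t; under eq_fun do rewrite mulrC; rewrite mulrC; exact: tends_mull. Qed.

Lemma tends_reim (x_ : nat -> R[i]) x : tends x_ x <->
  ((fun n => complex.Re (x_ n)) @ \oo --> complex.Re x) /\
  ((fun n => complex.Im (x_ n)) @ \oo --> complex.Im x).
Proof.
split=> [t|[/cvgrPdist_lt tr /cvgrPdist_lt ti]].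
  split; apply/cvgrPdist_lt => e e0; have [n Hn] := t _ e0; exists n => // m nm.
    by apply: le_lt_trans (Hn _ nm); have := le_re_nrm (x - x_ m); case: (x); case: (x_ m).
  by apply: le_lt_trans (Hn _ nm); have := le_im_nrm (x - x_ m); case: (x); case: (x_ m).
move=> e e0; have e20 : 0 < e / 2 by lra.
have [n _ Hn] := tr _ e20; have [m _ Hm] := ti _ e20.
exists (maxn n m) => k; rewrite geq_max => /andP[/Hn /= nk /Hm /= mk].
apply: le_lt_trans (nrm_le_reim _) _.
move: nk mk; case: (x) => a b; case: (x_ k) => c d /=; lra.
Qed.

End RealNorm.

(** * Inner products, the Cauchy-Schwarz inequality and adherent points *)

Section HilbertTheory.
Variables (R : realType) (H : hilbert R).
Implicit Types (x y u v : H) (a b : R[i]).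

Lemma innerC x y : inner x y = Num.conj (inner y x).
Proof. by rewrite hermC expr0 mul1r. Qed.

Lemma innerDl x y z : inner (x + y) z = inner x z + inner y z.
Proof. exact: linearDl. Qed.

Lemma innerZl a x z : inner (a *: x) z = a * inner x z.
Proof. exact: linearZl_LR. Qed.

Lemma innerBl x y z : inner (x - y) z = inner x z - inner y z.
Proof. exact: linearBl. Qed.

Lemma innerDr x y z : inner z (x + y) = inner z x + inner z y.
Proof. exact: linearDr. Qed.

Lemma innerNr x z : inner z (- x) = - inner z x.
Proof. exact: linearNr. Qed.

Lemma innerBr x y z : inner z (x - y) = inner z x - inner z y.
Proof. exact: linearBr. Qed.

Lemma innerZr a x z : inner z (a *: x) = Num.conj a * inner z x.
Proof. by rewrite innerC innerZl rmorphM /= -innerC. Qed.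

Lemma inner0l z : inner (0 : H) z = 0.
Proof. exact: linear0l. Qed.

Lemma inner0r z : inner z (0 : H) = 0.
Proof. exact: linear0r. Qed.

Lemma innerxx x : inner x x = (nrm x ^+ 2)%:C.
Proof. by rewrite inner_norm nrmE rmorphXn. Qed.

Lemma inner_eq0 x : inner x x = 0 -> x = 0.
Proof.
rewrite innerxx => /complexI/eqP; rewrite sqrf_eq0 nrm_eq0; exact: eqP.
Qed.

Lemma nrm_sqrD x y :
  nrm (x + y) ^+ 2 = nrm x ^+ 2 + nrm y ^+ 2 + 2 * complex.Re (inner x y).
Proof.
apply: (@complexI R); rewrite -innerxx innerDl !innerDr !innerxx (innerC y x).
apply/eqP; rewrite eq_complex; case: (inner x y) => a b /=.
by apply/andP; split; apply/eqP; ring.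
Qed.

Lemma nrm_sqrB x y :
  nrm (x - y) ^+ 2 = nrm x ^+ 2 + nrm y ^+ 2 - 2 * complex.Re (inner x y).
Proof. by rewrite nrm_sqrD innerNr nrmN; case: (inner x y) => a b /=; ring. Qed.

Lemma cauchy_schwarz x y : nrm (inner x y) <= nrm x * nrm y.
Proof.
have [->|y0] := eqVneq y 0; first by rewrite inner0r !nrm0 mulr0.
have ny : 0 < nrm y by rewrite lt_def nrm_eq0 y0 nrm_ge0.
pose t := (nrm y ^+ 2)^-1; pose c := inner x y * t%:C.
have t0 : 0 <= t by rewrite invr_ge0 sqr_ge0.
have := sqr_ge0 (nrm (x - c *: y)); rewrite nrm_sqrB innerZr nrmZ exprMn.
have -> : Num.conj c * inner x y = (nrm (inner x y) ^+ 2 * t)%:C.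
  rewrite mulrC /c [Num.conj _]rmorphM mulrA mulcJ [in RHS]rmorphM.
  by congr (_ * _); apply: conjc_real.
have -> : nrm c = nrm (inner x y) * t by rewrite nrmM nrmC ger0_norm.
rewrite /= => h.
rewrite -(@ler_pXn2r _ 2) ?nnegrE ?nrm_ge0 ?mulr_ge0 ?nrm_ge0 //.
have E : (nrm (inner x y) * t) ^+ 2 * nrm y ^+ 2 = nrm (inner x y) ^+ 2 * t.
  by rewrite /t; field; rewrite gt_eqF.
move: h; rewrite E => h.
have : nrm (inner x y) ^+ 2 * t <= nrm x ^+ 2 by lra.
by rewrite ler_pdivrMr ?exprn_gt0 // exprMn.
Qed.

Lemma tends_innerl (x_ : nat -> H) x y : tends x_ x -> tends (fun n => inner (x_ n) y) (inner x y).
Proof.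
apply: (@tends_lip _ _ _ (fun x => inner x y) (nrm y)) => n.
by rewrite -innerBl mulrC cauchy_schwarz.
Qed.

(** Adherence with real radii; the balls of [H] have radii in [R[i]], and [closureP] crosses between
    the two. *)
Definition near_set (V : set H) x := forall e : R, 0 < e -> exists2 v, V v & nrm (x - v) < e.

Lemma closureP (V : set H) x : closure V x <-> near_set V x.
Proof.
split=> [cx e e0|nx B /nbhs_ballP[e /= e0 eB]].
  have [|v [Vv xv]] := cx (ball x e%:C); first by apply: nbhsx_ballx; rewrite ltcR.
  by exists v => //; move: xv; rewrite -ball_normE /= nrmE ltcR.
have eR : e = (complex.Re e)%:C by rewrite RRe_real // gtr0_real.
have e0' : 0 < complex.Re e by rewrite -ltcR -eR.
have [v Vv xv] := nx _ e0'; exists v; split => //; apply: eB.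
by rewrite -ball_normE /= nrmE eR ltcR.
Qed.

Lemma closed_nearP (V : set H) : closed V <-> (forall x, near_set V x -> V x).
Proof.
by split=> [cV x /closureP/cV|cV x /closureP/cV].
Qed.

End HilbertTheory.
(** * Bounded functions on the circle *)

Section CircleFunctions.
Variable R : realType.
Implicit Types f g h : circle R -> R[i].

Lemma cmeasurableD f g :
  cmeasurable f -> cmeasurable g -> cmeasurable (fun z => f z + g z).
Proof.
move=> [fr fi] [gr gi]; split.
  by under eq_fun do rewrite re_add; exact: measurable_funD.
by under eq_fun do rewrite im_add; exact: measurable_funD.
Qed.

Lemma cmeasurableM f g :
  cmeasurable f -> cmeasurable g -> cmeasurable (fun z => f z * g z).
Proof.
move=> [fr fi] [gr gi]; split.
  by under eq_fun do rewrite re_mul; apply: measurable_funB; exact: measurable_funM.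
by under eq_fun do rewrite im_mul; apply: measurable_funD; exact: measurable_funM.
Qed.

Lemma cmeasurable_real (r : circle R -> R) :
  measurable_fun setT r -> cmeasurable (fun z => (r z)%:C).
Proof. by move=> mr; split => //=; exact: measurable_cst. Qed.

Lemma cmeasurable_cst (c : R[i]) : cmeasurable (fun _ : circle R => c).
Proof. by split; exact: measurable_cst. Qed.

Lemma measurable_fun_sqrt : measurable_fun setT (@Num.sqrt R).
Proof. exact: (continuous_measurable_fun (@sqrt_continuous R)). Qed.

Lemma measurable_fun_nrm f : cmeasurable f -> measurable_fun setT (fun z => nrm (f z)).
Proof.
move=> [fr fi]; rewrite (_ : (fun _ => _) = Num.sqrt \o
    (fun z => complex.Re (f z) ^+ 2 + complex.Im (f z) ^+ 2)); last first.
  by apply/funext => z; rewrite /= -nrm_sqr sqrtr_sqr ger0_norm ?nrm_ge0.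
apply: measurableT_comp; first exact: measurable_fun_sqrt.
by apply: measurable_funD; exact: measurable_funX.
Qed.

(* Bounded everywhere, not only almost everywhere: composition with measurable
   maps and pointwise limits then need no control of null sets. *)
Definition BM f := cmeasurable f /\ exists M, forall z, nrm (f z) <= M.

Lemma BM_cmeasurable f : BM f -> cmeasurable f. Proof. by case. Qed.

Lemma BM_cst (c : R[i]) : BM (fun _ => c).
Proof. by split; [exact: cmeasurable_cst|exists (nrm c)]. Qed.

Lemma BMD f g : BM f -> BM g -> BM (fun z => f z + g z).
Proof.
move=> [mf [M fM]] [mg [M' gM]]; split; first exact: cmeasurableD.
by exists (M + M') => z; apply: le_trans (nrmD _ _) _; apply: lerD.
Qed.

Lemma BMM f g : BM f -> BM g -> BM (fun z => f z * g z).
Proof.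
move=> [mf [M fM]] [mg [M' gM]]; split; first exact: cmeasurableM.
by exists (M * M') => z; rewrite nrmM ler_pM ?nrm_ge0.
Qed.

Lemma BMZ (c : R[i]) f : BM f -> BM (fun z => c * f z).
Proof. by move=> ?; apply: BMM => //; exact: BM_cst. Qed.

Lemma BM_lin (c : R[i]) f g : BM f -> BM g -> BM (fun z => c * f z + g z).
Proof. by move=> ? ?; apply: BMD => //; exact: BMZ. Qed.

Lemma BMB f g : BM f -> BM g -> BM (fun z => f z - g z).
Proof.
move=> bf bg; under eq_fun do rewrite -mulN1r.
by apply: BMD => //; exact: BMZ.
Qed.

Lemma BM_conj f : BM f -> BM (fun z => Num.conj (f z)).
Proof.
move=> [mf [M fM]]; split; first exact: cmeasurable_conj.
by exists M => z; rewrite nrm_conj.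
Qed.

Lemma BM_real (r : circle R -> R) M : measurable_fun setT r ->
  (forall z, `|r z| <= M) -> BM (fun z => (r z)%:C).
Proof.
by move=> mr rM; split; [exact: cmeasurable_real|exists M => z; rewrite nrmC].
Qed.

Lemma BM_re f : BM f -> BM (fun z => (complex.Re (f z))%:C).
Proof.
move=> [[mr _] [M fM]]; apply: (@BM_real _ M) => // z.
exact: le_trans (le_re_nrm _) _.
Qed.

Lemma BM_im f : BM f -> BM (fun z => (complex.Im (f z))%:C).
Proof.
move=> [[_ mi] [M fM]]; apply: (@BM_real _ M) => // z.
exact: le_trans (le_im_nrm _) _.
Qed.

Definition cind (A : set (circle R)) : circle R -> R[i] := fun z => (\1_A z)%:C.

Lemma cindE A z : cind A z = if z \in A then 1 else 0.
Proof. by rewrite /cind indicE; case: (z \in A). Qed.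

Lemma BM_cind A : measurable A -> BM (cind A).
Proof.
move=> mA; apply: (@BM_real _ 1); first exact: measurable_indic.
by move=> z; rewrite indicE; case: (_ \in _); rewrite ?normr1 ?normr0.
Qed.

Lemma cindM A z : cind A z * cind A z = cind A z.
Proof. by rewrite cindE; case: ifP; rewrite ?mulr1 ?mulr0. Qed.

Lemma cind_conj A z : Num.conj (cind A z) = cind A z.
Proof. by rewrite cindE; case: ifP; rewrite ?rmorph1 ?rmorph0. Qed.

Lemma haarT : haar R setT = 1%E. Proof. exact: probability_setT. Qed.

Lemma abse_nrm f z :
  (abse \o (fun z => (complex.Re `|f z|)%:E)) z = (nrm (f z))%:E.
Proof. by congr (_%:E); apply: ger0_norm; exact: (nrm_ge0 (f z)). Qed.

Lemma LinfP f : Linf f <->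
  cmeasurable f /\ exists M, {ae haar R, forall z, nrm (f z) <= M}.
Proof.
have h0 : (0 < haar R setT)%E by rewrite haarT.
rewrite /Linf /Linf_norm unlock; case: ifPn => [_|/negP/(_ h0)[]].
split=> -[mf hf]; split => //.
  move: hf; set N := ess_sup _ _ => hf.
  have /ess_supP hN : (N <= N)%E by [].
  exists (fine N); apply: filterS hN => z; rewrite abse_nrm => hz.
  by rewrite -lee_fin fineK // fin_numElt hf andbT (lt_le_trans _ hz) ?ltNyr.
case: hf => M hM; apply: (@le_lt_trans _ _ M%:E); last exact: ltry.
apply/ess_supP; apply: filterS hM => z.
by rewrite abse_nrm lee_fin.
Qed.

Lemma Linf_norm_le f M : (forall z, nrm (f z) <= M) -> (Linf_norm f <= M%:E)%E.
Proof.
move=> fM; have h0 : (0 < haar R setT)%E by rewrite haarT.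
rewrite /Linf_norm unlock; case: ifPn => [_|/negP/(_ h0)[]].
apply/ess_supP/nearW => z.
by rewrite abse_nrm lee_fin.
Qed.

Lemma BM_Linf f : BM f -> Linf f.
Proof. by move=> [mf [M fM]]; apply/LinfP; split => //; exists M; exact: nearW. Qed.

Lemma LinfD f g : Linf f -> Linf g -> Linf (fun z => f z + g z).
Proof.
move=> /LinfP[mf [M fM]] /LinfP[mg [M' gM]]; apply/LinfP; split; first exact: cmeasurableD.
exists (M + M'); apply: filterS2 fM gM => z fz gz.
by apply: le_trans (nrmD _ _) _; apply: lerD.
Qed.

Lemma LinfM f g : Linf f -> Linf g -> Linf (fun z => f z * g z).
Proof.
move=> /LinfP[mf [M fM]] /LinfP[mg [M' gM]]; apply/LinfP; split; first exact: cmeasurableM.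
exists (M * M'); apply: filterS2 fM gM => z fz gz.
by rewrite nrmM ler_pM ?nrm_ge0.
Qed.

Lemma Linf_conj f : Linf f -> Linf (fun z => Num.conj (f z)).
Proof.
move=> /LinfP[mf [M fM]]; apply/LinfP; split; first exact: cmeasurable_conj.
by exists M; apply: filterS fM => z; rewrite nrm_conj.
Qed.

Lemma cmeasurable_trunc f (A : set (circle R)) (c : R[i]) :
  cmeasurable f -> measurable A -> cmeasurable (fun z => if z \in A then f z else c).
Proof.
move=> mf mA; have -> : (fun z => if z \in A then f z else c) =
    (fun z => cind A z * f z + (1 - cind A z) * c).
  apply/funext => z; rewrite cindE; case: ifP => _.
    by rewrite mul1r subrr mul0r addr0.
  by rewrite mul0r subr0 mul1r add0r.
have /BM_cmeasurable mI := BM_cind mA.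
apply: cmeasurableD; first exact: cmeasurableM.
apply: cmeasurableM; last exact: cmeasurable_cst.
by apply: BM_cmeasurable; apply: BMB; [exact: BM_cst|exact: BM_cind].
Qed.

(** The representative is set to 0 on the null set where the bound fails. The new bound reads [|M|]
    so that the value 0 obeys it whatever the sign of [M]. *)
Lemma Linf_BM f M : cmeasurable f -> {ae haar R, forall z, nrm (f z) <= M} ->
  exists g, [/\ BM g, ae_equal f g & forall z, nrm (g z) <= `|M|].
Proof.
move=> mf fM; pose A := [set z | nrm (f z) <= M].
have mA : measurable A.
  have := measurable_fun_le measurableT (measurable_fun_nrm mf) (@measurable_cst _ _ _ _ setT M).
  by rewrite setTI.
exists (fun z => if z \in A then f z else 0).
have bd z : nrm (if z \in A then f z else 0) <= `|M|.
  case: ifPn => [|_]; last by rewrite nrm0.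
  by rewrite inE => /le_trans; apply; exact: ler_norm.
split => //; first by split; [exact: cmeasurable_trunc|exists `|M|].
by apply: filterS fM => z fz; rewrite ifT // inE.
Qed.

(** The mode of convergence to which both the normality of a representation and dominated
    convergence apply; the induction principles below close under it. *)
Definition blim (f_ : nat -> circle R -> R[i]) f :=
  (exists M, forall n z, nrm (f_ n z) <= M) /\ forall z, tends (fun n => f_ n z) (f z).

Lemma blim_BM (f_ : nat -> circle R -> R[i]) f : (forall n, BM (f_ n)) -> blim f_ f -> BM f.
Proof.
move=> bf [[M fM] ff]; split; last first.
  exists M => z; apply/ler_addgt0Pr => e e0; have [n Hn] := ff z e e0.
  have := Hn _ (leqnn n); have := nrmD (f z - f_ n z) (f_ n z).
  rewrite subrK; have := fM n z; lra.
have H z : ((fun n => complex.Re (f_ n z)) @ \oo --> complex.Re (f z)) /\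
   ((fun n => complex.Im (f_ n z)) @ \oo --> complex.Im (f z)).
  by apply/tends_reim; exact: ff.
split.
  apply: (@measurable_fun_cvg _ _ _ _ (fun n z => complex.Re (f_ n z))).
    by move=> n; have [[]] := bf n.
  by move=> z _; have [] := H z.
apply: (@measurable_fun_cvg _ _ _ _ (fun n z => complex.Im (f_ n z))).
  by move=> n; have [[]] := bf n.
by move=> z _; have [] := H z.
Qed.

End CircleFunctions.

(** * Complex integrals against Haar measure *)

Section CircleIntegral.
Variable R : realType.
Implicit Types f g h : circle R -> R[i].
Local Notation mu := (haar R).
Local Notation I := (@cintegral R).

Lemma integrable_bd (r : circle R -> R) (k : circle R -> R) M :
  measurable_fun setT r -> mu.-integrable setT (EFin \o k) ->
  (forall z, `|r z| <= M * `|k z|) -> mu.-integrable setT (EFin \o r).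
Proof.
move=> mr ik rk.
apply: (@le_integrable _ _ _ mu _ measurableT _ (fun z => M%:E * (k z)%:E)%E).
- exact/measurable_EFinP.
- move=> z _ /=; rewrite lee_fin; apply: le_trans (rk z) _.
  by rewrite normrM ler_wpM2r // ler_norm.
- exact: integrableZl.
Qed.

Lemma integrable_nrm g : Lone g -> mu.-integrable setT (EFin \o (fun z => nrm (g z))).
Proof.
move=> [gr gi]; apply: (@le_integrable _ _ _ mu _ measurableT _
  (fun z => `|(complex.Re (g z))%:E| + `|(complex.Im (g z))%:E|)%E).
- apply/measurable_EFinP/measurable_fun_nrm; split.
    by apply/measurable_EFinP; apply: (measurable_int mu).
  by apply/measurable_EFinP; apply: (measurable_int mu).
- move=> z _ /=; rewrite lee_fin ger0_norm ?nrm_ge0 // ger0_norm ?addr_ge0 //.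
  exact: nrm_le_reim.
- by apply: integrableD => //; exact: integrable_abse.
Qed.

Lemma Lone_cmeasurable g : Lone g -> cmeasurable g.
Proof.
by move=> [gr gi]; split; apply/measurable_EFinP; apply: (measurable_int mu).
Qed.

Lemma Lone_bd f g M : cmeasurable f -> Lone g ->
  (forall z, nrm (f z) <= M * nrm (g z)) -> Lone f.
Proof.
move=> [mr mi] lg fg; have ig := integrable_nrm lg.
split; apply: (integrable_bd (M := M) _ ig) => // z; rewrite (ger0_norm (nrm_ge0 _)).
  exact: le_trans (le_re_nrm _) _.
exact: le_trans (le_im_nrm _) _.
Qed.

Lemma Lone_cst (c : R[i]) : Lone (fun _ : circle R => c).
Proof.
by split; apply: (finite_measure_integrable_cst mu).
Qed.

Lemma LoneM f g : BM f -> Lone g -> Lone (fun z => f z * g z).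
Proof.
move=> [mf [M fM]] lg; apply: (Lone_bd (M := M) _ lg).
  by apply: cmeasurableM => //; exact: Lone_cmeasurable.
by move=> z; rewrite nrmM ler_wpM2r ?nrm_ge0.
Qed.

Lemma BM_Lone f : BM f -> Lone f.
Proof.
move=> bf; have := LoneM bf (Lone_cst 1).
by under eq_fun do rewrite mulr1.
Qed.

Lemma cintegral_lin (c : R[i]) f g : Lone f -> Lone g ->
  I (fun z => c * f z + g z) = c * I f + I g.
Proof.
move=> [fr fi] [gr gi]; rewrite /cintegral.
have ZI (a : R) (k : circle R -> R) : mu.-integrable setT (EFin \o k) ->
    mu.-integrable setT (EFin \o (fun z => a * k z)).
  by move=> ik; exact: (integrableZl measurableT a ik).
have DI (k l : circle R -> R) : mu.-integrable setT (EFin \o k) ->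
    mu.-integrable setT (EFin \o l) -> mu.-integrable setT (EFin \o (fun z => k z + l z)).
  by move=> ik il; exact: (integrableD measurableT ik il).
case: c => a b.
have -> : (fun z => complex.Re ((a +i* b) * f z + g z)) =
   (fun z => (a * complex.Re (f z) + (- b) * complex.Im (f z)) + complex.Re (g z)).
  by apply/funext => z; case: (f z); case: (g z) => *; rewrite /= mulNr.
have -> : (fun z => complex.Im ((a +i* b) * f z + g z)) =
   (fun z => (a * complex.Im (f z) + b * complex.Re (f z)) + complex.Im (g z)).
  by apply/funext => z; case: (f z); case: (g z) => *; rewrite /=.
rewrite !RintegralD ?RintegralZl //; do ?[exact: ZI | apply: DI; exact: ZI].
by apply/eqP; rewrite eq_complex /= mulNr !eqxx.
Qed.

Lemma eq_cintegral f g : f =1 g -> I f = I g.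
Proof. by move=> /funext ->. Qed.

Lemma haar_Rintegral_cst (r : R) : \int[mu]_z r = r.
Proof.
rewrite Rintegral_cst //; transitivity (r * fine 1%E); last by rewrite mulr1.
by congr (_ * fine _); exact: haarT.
Qed.

Lemma cintegral1 : I (fun=> 1) = 1.
Proof. by rewrite /cintegral /= !haar_Rintegral_cst. Qed.

Lemma cintegralB f g : Lone f -> Lone g -> I (fun z => f z - g z) = I f - I g.
Proof.
move=> lf lg; rewrite addrC -mulN1r -cintegral_lin //.
by apply: eq_cintegral => z; rewrite mulN1r addrC.
Qed.

Lemma ae_cintegral f g : cmeasurable f -> cmeasurable g -> ae_equal f g -> I f = I g.
Proof.
move=> [fr fi] [gr gi] fg; rewrite /cintegral /Rintegral; congr (fine _ +i* fine _);
  apply: ae_eq_integral => //; try exact/measurable_EFinP;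
  by apply: filterS fg => z -> _.
Qed.

Lemma cintegral_real (r : circle R -> R) : I (fun z => (r z)%:C) = (\int[mu]_z r z)%:C.
Proof. by rewrite /cintegral /= Rintegral_cst // mul0r. Qed.

Lemma Rintegral_eq0 (r : circle R -> R) : mu.-integrable setT (EFin \o r) ->
  (forall z, 0 <= r z) -> \int[mu]_z r z = 0 -> {ae mu, forall z, r z = 0}.
Proof.
move=> ir r0 i0; have mr := measurable_int mu ir.
have : (\int[mu]_z `|(EFin \o r) z| = 0)%E.
  under eq_integral do rewrite /= ger0_norm //.
  by rewrite -[LHS]fineK ?[X in X%:E]i0 //; exact: integrable_fin_num.
move/(ae_eq_integral_abs mu measurableT mr); apply: filterS => z h.
by have [] := h Logic.I.
Qed.

Lemma cintegral_eq0 (r : circle R -> R) : BM (fun z => (r z)%:C) ->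
  (forall z, 0 <= r z) -> I (fun z => (r z)%:C) = 0 -> {ae mu, forall z, r z = 0}.
Proof.
move=> br r0; rewrite cintegral_real => /complexI i0.
by have [ir _] := BM_Lone br; exact: Rintegral_eq0.
Qed.

(** The factor 2 is the price of bounding real and imaginary parts separately; later only some
    uniform constant matters. *)
Lemma nrm_cintegral f M : cmeasurable f -> (forall z, nrm (f z) <= M) ->
  nrm (I f) <= 2 * M.
Proof.
move=> mf fM; have lf : Lone f by apply: BM_Lone; split => //; exists M.
have bd (k : circle R -> R) : mu.-integrable setT (EFin \o k) ->
    (forall z, `|k z| <= M) -> `|\int[mu]_z k z| <= M.
  move=> ik kM; apply: le_trans (le_normr_Rintegral measurableT ik) _.
  have -> : M = \int[mu]_z M by rewrite haar_Rintegral_cst.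
  apply: le_Rintegral => //; last exact: (finite_measure_integrable_cst mu).
  by have := integrable_abse ik.
have [lr li] := lf.
apply: le_trans (nrm_le_reim _) _; rewrite mulr_natl mulr2n.
apply: lerD; apply: bd => // z; apply: le_trans (fM z).
  exact: le_re_nrm.
exact: le_im_nrm.
Qed.

Lemma cintegral_blim (f_ : nat -> circle R -> R[i]) f g : (forall n, BM (f_ n)) -> blim f_ f -> Lone g ->
  tends (fun n => I (fun z => f_ n z * g z)) (I (fun z => f z * g z)).
Proof.
move=> bf bl lg; have Bf := blim_BM bf bl; case: bl => -[M fM] ff.
have ig := integrable_nrm lg.
have DC (k_ : nat -> circle R -> R) (k : circle R -> R) :
    (forall n, measurable_fun setT (k_ n)) -> measurable_fun setT k ->
    (forall n z, `|k_ n z| <= M * nrm (g z)) ->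
    (forall z, (fun n => k_ n z) @ \oo --> k z) ->
    (fun n => \int[mu]_z k_ n z) @ \oo --> \int[mu]_z k z.
  move=> mk mk' kM kk.
  have [|||||ik _ H] := @dominated_convergence _ _ _ mu setT measurableT
    (fun n z => (k_ n z)%:E) (EFin \o k) (fun z => (M%:E * (nrm (g z))%:E)%E).
  - by move=> n; exact/measurable_EFinP.
  - exact/measurable_EFinP.
  - by apply: nearW => z _; apply: cvg_EFin; [exact: nearW|exact: kk].
  - exact: integrableZl.
  - by apply: nearW => z n _; rewrite /= lee_fin.
  apply: fine_cvg; rewrite fineK //; exact: integrable_fin_num.
have mg := Lone_cmeasurable lg.
have mfg n : cmeasurable (fun z => f_ n z * g z).
  by apply: cmeasurableM => //; have [] := bf n.
have mfg' : cmeasurable (fun z => f z * g z).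
  by apply: cmeasurableM => //; have [] := Bf.
have bd n z : nrm (f_ n z * g z) <= M * nrm (g z) by rewrite nrmM ler_wpM2r ?nrm_ge0.
have lim z := tends_mulr (g z) (ff z).
apply/tends_reim; split; apply: DC => /=.
- by move=> n; have [] := mfg n.
- by have [] := mfg'.
- by move=> n z; apply: le_trans (le_re_nrm _) _.
- by move=> z; have /tends_reim[] := lim z.
- by move=> n; have [] := mfg n.
- by have [] := mfg'.
- by move=> n z; apply: le_trans (le_im_nrm _) _.
- by move=> z; have /tends_reim[] := lim z.
Qed.

End CircleIntegral.
(** * Monotone class theorem for trigonometric polynomials *)

Section Monotone.
Variable R : realType.
Implicit Types (f g : circle R -> R[i]) (F : nat -> set (circle R)).

Lemma sum_cind F n z k : trivIset setT F -> F k z ->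
  \sum_(i < n) cind (F i) z = (k < n)%N%:R.
Proof.
move=> tF Fkz; have cF i : cind (F i) z = (i == k)%:R.
  rewrite cindE; case: eqP => [->|ik]; first by rewrite mem_set.
  rewrite memNset // => Fiz; apply: ik.
  by apply: tF => //; exists z.
under eq_bigr do rewrite cF.
case: (ltnP k n) => kn; last first.
  rewrite big1 // => i _; case: eqP => // ik.
  by have := ltn_ord i; rewrite ik ltnNge kn.
rewrite (bigD1 (Ordinal kn)) //= eqxx big1 ?addr0 // => i /negP ik.
by case: eqP => // e; case: ik; apply/eqP/val_inj.
Qed.

Lemma blim_sum_cind F : trivIset setT F ->
  blim (fun n z => \sum_(i < n) cind (F i) z) (cind (\bigcup_i F i)).
Proof.
move=> tF; split.
  exists 1 => n z; have [[k _ Fkz]|nF] := pselect ((\bigcup_i F i) z).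
    by rewrite (sum_cind n tF Fkz); case: (k < n)%N; rewrite ?nrm1 ?nrm0.
  rewrite big1 ?nrm0 // => i _; rewrite cindE memNset // => Fi.
  by apply: nF; exists i.
move=> z; have [[k _ Fkz]|nF] := pselect ((\bigcup_i F i) z).
  move=> e e0; exists k.+1 => n kn.
  by rewrite (sum_cind n tF Fkz) kn cindE mem_set ?subrr ?nrm0 //; exists k.
move=> e e0; exists 0%N => n _.
rewrite cindE memNset // big1 ?subrr ?nrm0 // => i _; rewrite cindE memNset // => Fi.
by apply: nF; exists i.
Qed.

Lemma BM_sum (I : Type) (s : seq I) (f_ : I -> circle R -> R[i]) :
  (forall i, BM (f_ i)) -> BM (fun z => \sum_(i <- s) f_ i z).
Proof.
move=> bf; elim: s => [|i s IH].
  by under eq_fun do rewrite big_nil; exact: BM_cst.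
by under eq_fun do rewrite big_cons; exact: BMD.
Qed.

Section Induction.
Variable P : (circle R -> R[i]) -> Prop.
Hypothesis Plin : forall (a : R[i]) f g, BM f -> BM g -> P f -> P g ->
  P (fun z => a * f z + g z).
Hypothesis Plim : forall (f_ : nat -> circle R -> R[i]) f,
  (forall n, BM (f_ n)) -> (forall n, P (f_ n)) -> blim f_ f -> P f.

Lemma BM_ind_sum (I : Type) (s : seq I) (c : I -> R[i]) (f_ : I -> circle R -> R[i]) :
  P (fun=> 0) -> (forall i, BM (f_ i)) -> (forall i, P (f_ i)) ->
  P (fun z => \sum_(i <- s) c i * f_ i z).
Proof.
move=> P0 bf Pf; elim: s => [|i s IH].
  by under eq_fun do rewrite big_nil.
under eq_fun do rewrite big_cons; apply: Plin => //.
by apply: BM_sum => j; exact: BMZ.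
Qed.

(** The usual ascent from sets to simple, nonnegative, real and complex functions. *)
Lemma indicator_ind : (forall A, measurable A -> P (cind A)) -> forall f, BM f -> P f.
Proof.
move=> Pind.
have P0 : P (fun=> 0).
  have := Pind _ measurable0; congr P; apply/funext => z.
  by rewrite cindE in_set0.
have Ppos (r : circle R -> R) M : measurable_fun setT r ->
    (forall z, 0 <= r z <= M) -> P (fun z => (r z)%:C).
  move=> mr rM.
  have mr' : measurable_fun setT (EFin \o r) by exact/measurable_EFinP.
  pose h_ := nnsfun_approx measurableT mr'; pose h n : circle R -> R := h_ n.
  have cvh z : (fun n => h n z) @ \oo --> r z.
    have /fine_cvg : EFin \o h ^~ z @ \oo --> (EFin \o r) z.
      apply: cvg_nnsfun_approx => //= x _; rewrite lee_fin.
      by have /andP[] := rM x.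
    exact.
  (* The simple approximations increase to [r], so they inherit its bound; this makes the
     convergence a bounded one. *)
  have hM n z : `|h n z| <= M.
    rewrite ger0_norm //; have /andP[_] := rM z; apply: le_trans.
    have nd : nondecreasing_seq (fun n => h n z).
      by move=> i j ij; have /lefP := nd_nnsfun_approx measurableT mr' ij; exact.
    have := nondecreasing_cvgn_le nd (cvgP _ (cvh z)) n.
    by rewrite (cvg_lim _ (cvh z)).
  apply: (Plim (f_ := fun n z => (h n z)%:C)).
  - by move=> n; apply: (@BM_real _ _ M).
  - move=> n; pose s : seq R := finmap.enum_fset (fset_set (range (h n))).
    have -> : (fun z => (h n z)%:C) =
        (fun z => \sum_(y <- s) y%:C * cind (h n @^-1` [set y]) z).
      apply/funext => z; rewrite /h [in LHS]fimfunE fsbig_finite //= rmorph_sum /=.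
      by apply: eq_bigr => y _; rewrite rmorphM.
    by apply: BM_ind_sum => // y; [exact: BM_cind|exact: Pind].
  - split; first by exists M => n z; rewrite nrmC.
    by move=> z; apply/tends_reim; split => //=; exact: cvg_cst.
(* Adding [M] makes [r] nonnegative; the constant is removed again as a multiple of the indicator of
   the whole circle. *)
have Preal (r : circle R -> R) : BM (fun z => (r z)%:C) -> P (fun z => (r z)%:C).
  move=> br; have [[/= mr _] [M rM]] := br.
  have rM' z : - M <= r z <= M by rewrite -ler_norml -nrmC.
  have H1 : P (fun z => (r z + M)%:C).
    apply: (@Ppos _ (M + M)); first by apply: measurable_funD.
    by move=> z; have /andP[] := rM' z; lra.
  have bD : BM (fun z => (r z + M)%:C).
    under eq_fun do rewrite rmorphD; apply: BMD => //; exact: BM_cst.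
  have := Plin (- M%:C) (BM_cind measurableT) bD (Pind _ measurableT) H1.
  congr P; apply/funext => z; rewrite cindE in_setT mulr1 rmorphD /=.
  by rewrite addrC addrK.
move=> f bf.
have := Plin 'i (BM_im bf) (BM_re bf) (Preal _ (BM_im bf)) (Preal _ (BM_re bf)).
by congr P; apply/funext => z; rewrite addrC -complexE.
Qed.

(** The pi-lambda theorem relative to a fixed set [E]: [Plin] gives complements within [E], and
    [Plim] gives countable disjoint unions. Keeping [E] around allows one coordinate to be released
    while the other stays frozen. *)
Lemma dynkin_cind d (T : measurableType d) (c : circle R -> T) (G : set (set T))
    (E : set (circle R)) :
  measurable_fun setT c -> @measurable _ T = <<s G >> -> setI_closed G ->
  measurable E -> P (cind E) -> (forall S, G S -> P (cind (E `&` c @^-1` S))) ->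
  forall S, measurable S -> P (cind (E `&` c @^-1` S)).
Proof.
move=> mc GE GI mE PE PG S mS.
have mpre X : measurable X -> measurable (E `&` c @^-1` X).
  move=> mX; apply: measurableI => //; rewrite -[_ @^-1` _]setTI.
  by have := mc measurableT X mX.
have P0 : P (fun=> 0).
  have := Plin (-1) (BM_cind mE) (BM_cind mE) PE PE; congr P.
  by apply/funext => z; rewrite mulN1r addNr.
apply: (@dynkin_induction _ T G (fun S => P (cind (E `&` c @^-1` S)))) => //.
- by rewrite preimage_setT setIT.
- move=> X mX PX; have := Plin (-1) (BM_cind (mpre _ mX)) (BM_cind mE) PX PE.
  congr P; apply/funext => z; rewrite !cindE !in_setI.
  rewrite (_ : (z \in c @^-1` (~` X)) = ~~ (z \in c @^-1` X)); last first.
    by rewrite preimage_setC in_setC.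
  case: (z \in E) => /=; last by rewrite mulr0 addr0.
  by case: (z \in _); rewrite ?mulr0 ?add0r // mulr1 addNr.
- move=> F mF tF PF.
  have tF' : trivIset setT (fun n => E `&` c @^-1` F n).
    move=> i j _ _ [z [[_ Fi] [_ Fj]]]; apply: tF => //.
    by exists (c z).
  rewrite preimage_bigcup setI_bigcupr.
  apply: (Plim _ _ (blim_sum_cind tF')).
    by move=> n; apply: BM_sum => i; apply: BM_cind; exact: mpre.
  move=> n; have := @BM_ind_sum _ (index_enum 'I_n) (fun=> 1) (fun i => cind (E `&` c @^-1` F i)) P0
    (fun i => BM_cind (mpre _ (mF i))) (fun i => PF i).
  by congr P; apply/funext => z; apply: eq_bigr => i _; rewrite mul1r.
- by rewrite -GE.
Qed.

End Induction.
End Monotone.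

(** * Polynomials converging pointwise to a step function *)

Section Threshold.
Variable R : realType.

Lemma bernoulli (x : R) m : -1 <= x -> 1 + m%:R * x <= (1 + x) ^+ m.
Proof.
move=> x1; elim: m => [|m IH]; first by rewrite mul0r addr0 expr0.
rewrite exprS; have := ler_wpM2l (_ : 0 <= 1 + x) IH; rewrite -natr1 => H.
apply: le_trans (H _); last by lra.
have : 0 <= m%:R * x ^+ 2 by rewrite mulr_ge0 ?sqr_ge0.
lra.
Qed.

(* Polynomials in t, bounded on [0, 1], converging pointwise to the indicator of
   t < 1/2: the exponent n 2^n also forces the limit 0 at the threshold itself. *)
Definition thr (n : nat) (t : R) : R := (1 - t ^+ n) ^+ (n * 2 ^ n).

Lemma thr_bound n t : 0 <= t <= 1 -> 0 <= thr n t <= 1.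
Proof.
move=> /andP[t0 t1]; have h1 : t ^+ n <= 1 by rewrite exprn_ile1.
have h0 : 0 <= t ^+ n by rewrite exprn_ge0.
apply/andP; split; first by rewrite exprn_ge0; lra.
by apply: exprn_ile1; lra.
Qed.

(** Put x = 2^-n and m = n 2^n. Bernoulli gives (1 + x)^m >= 1 + n, while (1 - x)^m (1 + x)^m = (1 -
    x^2)^m is at most 1; and t^n >= x. *)
Lemma thr_ge n t : 2^-1 <= t <= 1 -> thr n t * (1 + n%:R) <= 1.
Proof.
move=> /andP[t2 t1]; pose x : R := 2^-1 ^+ n.
have x0 : 0 <= x by rewrite exprn_ge0.
have x1 : x <= 1 by apply: exprn_ile1; lra.
have xt : x <= t ^+ n by rewrite lerXn2r ?nnegrE //; lra.
have t1' : t ^+ n <= 1 by rewrite exprn_ile1; lra.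
have mx : (n * 2 ^ n)%:R * x = n%:R.
  by rewrite /x natrM natrX -mulrA -exprMn divff ?expr1n ?mulr1 // pnatr_eq0.
have H1 : thr n t <= (1 - x) ^+ (n * 2 ^ n) by rewrite lerXn2r ?nnegrE; lra.
have H2 : 1 + n%:R <= (1 + x) ^+ (n * 2 ^ n) by rewrite -mx bernoulli //; lra.
apply: (@le_trans _ _ ((1 - x) ^+ (n * 2 ^ n) * (1 + x) ^+ (n * 2 ^ n))).
  have t01 : 0 <= t <= 1 by lra.
  by have /andP[h0 _] := thr_bound n t01; apply: ler_pM.
rewrite -exprMn; apply: exprn_ile1; have := sqr_ge0 x; have := ler_pM x0 x0 x1 x1; lra.
Qed.

(** Choose s between the square root of r and 1 and write s = 1/(1 + h). Bernoulli gives s^n <= 1/(n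
    h), and squaring gains a factor: n r^n <= n s^(2n) <= 1/(h^2 n). *)
Lemma natr_expr_cvg0 (r e : R) : 0 <= r < 1 -> 0 < e ->
  exists n0, forall n, (n0 <= n)%N -> n%:R * r ^+ n < e.
Proof.
move=> /andP[r0 r1] e0.
have sq1 : Num.sqrt r < 1 by rewrite -sqrtr1 ltr_sqrt.
have sq0 := sqrtr_ge0 r; pose s := (1 + Num.sqrt r) / 2.
have s0 : 0 < s by rewrite /s; lra.
have s1 : s < 1 by rewrite /s; lra.
have rs : r <= s ^+ 2.
  by rewrite -(sqr_sqrtr r0) lerXn2r ?nnegrE // /s; lra.
pose h := s^-1 - 1; have h0 : 0 < h by rewrite subr_gt0 invf_gt1.
have sh : s = (1 + h)^-1 by rewrite /h addrC subrK invrK.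
exists (Num.truncn (h ^- 2 / e)).+1 => n nn0.
have n0 : (0 < n)%N by apply: leq_trans nn0.
have n0' : 0 < n%:R :> R by rewrite ltr0n.
have key : n%:R * r ^+ n <= h ^- 2 / n%:R.
  have H1 : r ^+ n <= (s ^+ n) ^+ 2 by rewrite -exprM mulnC exprM lerXn2r ?nnegrE ?sqr_ge0.
  have H2 : s ^+ n * (n%:R * h) <= 1.
    have h1 : 0 < 1 + h by lra.
    rewrite sh exprVn mulrC ler_pdivrMr ?exprn_gt0 // mul1r.
    have hb : 1 + n%:R * h <= (1 + h) ^+ n by apply: bernoulli; lra.
    lra.
  rewrite ler_pdivlMr //; apply: (@le_trans _ _ ((s ^+ n * n%:R) ^+ 2)).
    have := ler_wpM2l (_ : 0 <= n%:R * n%:R :> R) H1; rewrite mulr_ge0 //.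
    move=> /(_ isT); rewrite exprMn expr2; lra.
  have : (s ^+ n * (n%:R * h)) ^+ 2 <= 1.
    by rewrite exprn_ile1 // mulr_ge0 ?exprn_ge0 ?mulr_ge0 // ltW.
  rewrite mulrA exprMn -ler_pdivlMr ?exprn_gt0 // div1r.
  by [].
apply: le_lt_trans key _; rewrite ltr_pdivrMr // -ltr_pdivrMl // mulrC.
apply: lt_le_trans (truncnS_gt _) _.
by rewrite ler_nat.
Qed.

(** Below the threshold Bernoulli gives 1 - thr n t <= n (2t)^n, which tends to 0; from the
    threshold on, [thr_ge] gives the bound 1/(1 + n). *)
Lemma thr_cvg t : 0 <= t <= 1 -> (fun n => thr n t) @ \oo --> ((t < 2^-1)%R%:R : R).
Proof.
move=> t01; apply/cvgrPdist_lt => e e0; have /andP[t0 t1] := t01.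
have [t2|t2] := ltP t 2^-1.
  have r01 : 0 <= 2 * t < 1 by lra.
  have [n0 Hn] := natr_expr_cvg0 r01 e0; exists n0 => // n /= /Hn.
  have /andP[_ h1] := thr_bound n t01.
  rewrite ger0_norm; last by lra.
  apply: le_lt_trans.
  have y1 : t ^+ n <= 1 by rewrite exprn_ile1.
  have := @bernoulli (- t ^+ n) (n * 2 ^ n) _.
  rewrite -/(thr n t) natrM natrX exprMn => H.
  have := H _; lra.
exists (Num.truncn e^-1).+1 => // n /= nn.
have /andP[h0 _] := thr_bound n t01.
rewrite sub0r normrN ger0_norm //.
have := @thr_ge n t _; rewrite t2 t1 => /(_ isT) H.
have n0 : 0 < 1 + n%:R :> R by rewrite ltr_pwDl.
have : thr n t <= (1 + n%:R)^-1 by rewrite -div1r ler_pdivlMr.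
move/le_lt_trans; apply; rewrite invf_plt ?posrE //.
apply: lt_trans (truncnS_gt _) _.
by apply: (@le_lt_trans _ _ n%:R); rewrite ?ler_nat // ltrDr.
Qed.

End Threshold.

(** * Trigonometric polynomials generate all bounded Borel functions *)

Section TrigPoly.
Variable R : realType.
Implicit Types f g : circle R -> R[i].

Definition zpow (k : int) : circle R -> R[i] := fun z => (z : R[i]) ^ k.

Lemma circle_neq0 (z : circle R) : (z : R[i]) != 0.
Proof. by rewrite -normr_eq0 (eqP (circle_valP z)) oner_eq0. Qed.

Lemma nrm_circle (z : circle R) : nrm (z : R[i]) = 1.
Proof. by rewrite /nrm (eqP (circle_valP z)). Qed.

Lemma zpowD k l z : zpow (k + l) z = zpow k z * zpow l z.
Proof. by rewrite /zpow expfzDr ?circle_neq0. Qed.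

Lemma zpow0 z : zpow 0 z = 1.
Proof. by rewrite /zpow expr0z. Qed.

Lemma nrm_zpow k z : nrm (zpow k z) = 1.
Proof.
by case: k => n; rewrite /nrm /zpow /exprz ?normfV normrX (eqP (circle_valP z)) expr1n ?invr1.
Qed.

Lemma zpowN k z : zpow (- k) z = Num.conj (zpow k z).
Proof.
have k0 : zpow k z != 0 by rewrite -nrm_eq0 nrm_zpow oner_eq0.
by apply: (mulfI k0); rewrite -zpowD subrr zpow0 mulcJ nrm_zpow expr1n.
Qed.

Lemma zpow_pow k (M : nat) z : zpow k (circle_pow M z) = zpow (k * M%:Z) z.
Proof.
by rewrite /zpow (_ : (circle_pow M z : R[i]) = (z : R[i]) ^ M%:Z) // exprz_exp mulrC.
Qed.

Lemma cmeasurable_zpow k : cmeasurable (zpow k).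
Proof.
have H n : cmeasurable (fun z : circle R => (z : R[i]) ^+ n).
  elim: n => [|n IH]; first exact: cmeasurable_cst.
  by under eq_fun do rewrite exprS; apply: cmeasurableM => //; exact: cmeasurable_id.
case: k => n; first exact: H.
have := cmeasurable_conj (H n.+1); congr cmeasurable; apply/funext => z.
by rewrite NegzE zpowN.
Qed.

Lemma BM_zpow k : BM (zpow k).
Proof. by split; [exact: cmeasurable_zpow|exists 1 => z; rewrite nrm_zpow]. Qed.

Inductive trig : (circle R -> R[i]) -> Prop :=
| trig_zpow k : trig (zpow k)
| trig_lin (a : R[i]) f g : trig f -> trig g -> trig (fun z => a * f z + g z).

Lemma trig_ext f g : f =1 g -> trig f -> trig g.
Proof. by move=> /funext ->. Qed.

Lemma trig_BM f : trig f -> BM f.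
Proof. by elim => [k|a f' g _ ? _ ?]; [exact: BM_zpow|exact: BM_lin]. Qed.

Lemma trigZ (a : R[i]) f : trig f -> trig (fun z => a * f z).
Proof. by move=> tf; apply: trig_ext (trig_lin (a - 1) tf tf) => z; ring. Qed.

Lemma trigD f g : trig f -> trig g -> trig (fun z => f z + g z).
Proof. by move=> tf tg; apply: trig_ext (trig_lin 1 tf tg) => z; ring. Qed.

Lemma trigM f g : trig f -> trig g -> trig (fun z => f z * g z).
Proof.
move=> tf tg; elim: tf => [k|a f1 f2 _ IH1 _ IH2]; last first.
  by apply: trig_ext (trig_lin a IH1 IH2) => z; ring.
elim: tg => [l|a g1 g2 _ IH1 _ IH2]; last first.
  by apply: trig_ext (trig_lin a IH1 IH2) => z; ring.
by apply: trig_ext (trig_zpow (k + l)) => z; rewrite zpowD.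
Qed.

Lemma trig_cst (c : R[i]) : trig (fun _ => c).
Proof. by apply: trig_ext (trigZ c (trig_zpow 0)) => z; rewrite zpow0 mulr1. Qed.

Lemma trigX f n : trig f -> trig (fun z => f z ^+ n).
Proof.
move=> tf; elim: n => [|n IH]; first exact: trig_cst.
by under eq_fun do rewrite exprS; exact: trigM.
Qed.

Lemma zpow1 (z : circle R) : zpow 1 z = z.
Proof. by rewrite /zpow expr1z. Qed.

Lemma trig_re : trig (fun z : circle R => (complex.Re (z : R[i]))%:C).
Proof.
apply: trig_ext (trigD (trigZ (2^-1)%:C (trig_zpow 1)) (trigZ (2^-1)%:C (trig_zpow (- 1)))) => z.
rewrite zpowN zpow1; case: (z : R[i]) => a b; apply/eqP; rewrite eq_complex /=.
by apply/andP; split; apply/eqP; field.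
Qed.

Lemma trig_im : trig (fun z : circle R => (complex.Im (z : R[i]))%:C).
Proof.
apply: trig_ext (trigD (trigZ (0 -i* 2^-1) (trig_zpow 1)) (trigZ (0 +i* 2^-1) (trig_zpow (- 1)))) => z.
rewrite zpowN zpow1; case: (z : R[i]) => a b; apply/eqP; rewrite eq_complex /=.
by apply/andP; split; apply/eqP; field.
Qed.

(** Moves the threshold of [thr] from 1/2 to [a]. The slope is small enough that [-1, 1] lands in
    [0, 1], because |x - a| <= 1 + |a| there. *)
Definition affine_half (a x : R) := 2^-1 + (x - a) / (2 * (1 + `|a|)).

Lemma affine_halfE a x : `|x| <= 1 ->
  0 <= affine_half a x <= 1 /\ (affine_half a x < 2^-1) = (x < a).
Proof.
move=> x1; rewrite /affine_half; have a0 := normr_ge0 a.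
have c0 : 0 < (2 * (1 + `|a|))^-1 by rewrite invr_gt0; lra.
split; last by rewrite gtrDl pmulr_llt0 // subr_lt0.
have H : `|(x - a) / (2 * (1 + `|a|))| <= 2^-1.
  rewrite normrM [X in _ * X]gtr0_norm // ler_pdivrMr; last by lra.
  have := ler_normB x a; lra.
move: H; rewrite ler_norml; lra.
Qed.

Lemma trig_thr (a : R) (r : circle R -> R) n : trig (fun z => (r z)%:C) ->
  trig (fun z => (thr n (affine_half a (r z)))%:C).
Proof.
move=> tr; apply: (@trig_ext (fun z => (1 + (- 1) *
    ((2^-1 - a / (2 * (1 + `|a|)))%:C + ((2 * (1 + `|a|))^-1)%:C * (r z)%:C) ^+ n) ^+ (n * 2 ^ n))).
  move=> z; have H (x : R) m1 m2 :
      ((1 - x ^+ m1) ^+ m2)%:C = (1 + (- 1) * x%:C ^+ m1) ^+ m2 :> R[i].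
    by rewrite rmorphXn rmorphB rmorphXn rmorph1 mulN1r.
  have E : (2^-1 - a / (2 * (1 + `|a|)))%:C + ((2 * (1 + `|a|))^-1)%:C * (r z)%:C
           = (affine_half a (r z))%:C.
    by rewrite -rmorphM -rmorphD; congr (_%:C); rewrite /affine_half; ring.
  by rewrite E; apply/esym; exact: H.
apply: trigX; apply: trigD; first exact: trig_cst.
apply: trigZ; apply: trigX; apply: trigD; first exact: trig_cst.
exact: trigZ.
Qed.

Section Induction.
Variable P : (circle R -> R[i]) -> Prop.
Hypothesis Plin : forall (a : R[i]) f g, BM f -> BM g -> P f -> P g ->
  P (fun z => a * f z + g z).
Hypothesis Plim : forall (f_ : nat -> circle R -> R[i]) f,
  (forall n, BM (f_ n)) -> (forall n, P (f_ n)) -> blim f_ f -> P f.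
Hypothesis Pzpow : forall k, P (zpow k).

Lemma trig_ind_P f : trig f -> P f.
Proof. by elim=> // a f1 f2 /trig_BM b1 P1 /trig_BM b2 P2; exact: Plin. Qed.

Let rect (a b : R) : set (circle R) :=
  [set z | complex.Re (z : R[i]) < a] `&` [set z | complex.Im (z : R[i]) < b].

(** A product of threshold polynomials in the two coordinates is a trigonometric polynomial bounded
    by 1. The convergence holds at every point, including the boundary of the quadrant, so no null
    set enters. *)
Lemma P_rect a b : P (cind (rect a b)).
Proof.
pose F n (z : circle R) : R[i] :=
  (thr n (affine_half a (complex.Re (z : R[i]))))%:C *
  (thr n (affine_half b (complex.Im (z : R[i]))))%:C.
have tF n : trig (F n).
  by apply: trigM; apply: trig_thr; [exact: trig_re|exact: trig_im].
apply: (Plim (f_ := F)).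
- by move=> n; exact: trig_BM.
- by move=> n; exact: trig_ind_P.
have re1 (z : circle R) : `|complex.Re (z : R[i])| <= 1.
  by rewrite -(nrm_circle z) le_re_nrm.
have im1 (z : circle R) : `|complex.Im (z : R[i])| <= 1.
  by rewrite -(nrm_circle z) le_im_nrm.
split.
  exists 1 => n z; rewrite nrmM !nrmC.
  have [/(thr_bound n)/andP[h1 h2] _] := affine_halfE a (re1 z).
  have [/(thr_bound n)/andP[h3 h4] _] := affine_halfE b (im1 z).
  by rewrite !ger0_norm // mulr_ile1.
move=> z; apply/tends_reim.
have [ha ea] := affine_halfE a (re1 z); have [hb eb] := affine_halfE b (im1 z).
have -> : cind (rect a b) z = (((complex.Re (z : R[i]) < a)%R%:R * (complex.Im (z : R[i]) < b)%R%:R : R))%:C.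
  rewrite cindE /rect in_setI -natrM mulnb.
  have -> : (z \in [set z : circle R | complex.Re (z : R[i]) < a]) = (complex.Re (z : R[i]) < a).
    by apply/idP/idP; rewrite inE.
  have -> : (z \in [set z : circle R | complex.Im (z : R[i]) < b]) = (complex.Im (z : R[i]) < b).
    by apply/idP/idP; rewrite inE.
  by case: ifP => _; rewrite ?rmorph1 ?rmorph0.
split => /=.
  under eq_fun do rewrite mul0r subr0.
  by rewrite -ea -eb; apply: cvgM; exact: thr_cvg.
under eq_fun do rewrite mulr0 mul0r addr0.
exact: cvg_cst.
Qed.

Lemma measurable_circle_re : measurable_fun setT (fun z : circle R => complex.Re (z : R[i])).
Proof. by have [] := @cmeasurable_id R. Qed.

Lemma measurable_circle_im : measurable_fun setT (fun z : circle R => complex.Im (z : R[i])).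
Proof. by have [] := @cmeasurable_id R. Qed.

(** Quadrants reach all Borel sets in three runs of [dynkin_cind]: the real coordinate is released
    over a frozen half-plane in the imaginary one, then the imaginary coordinate, and finally the
    plane is generated by measurable rectangles. *)
Lemma BM_ind f : BM f -> P f.
Proof.
apply: indicator_ind => //.
have GI : setI_closed (@RGenInftyO.G R).
  move=> _ _ [x ->] [y ->]; exists (Num.min x y).
  by apply/seteqP; split => t /=; rewrite !in_itv /= lt_min => /andP.
have GE : @measurable _ (measurableTypeR R) = <<s @RGenInftyO.G R >>.
  exact: RGenInftyO.measurableE.
have mre := measurable_circle_re; have mim := measurable_circle_im.
have mpre (c : circle R -> R) B : measurable_fun setT c -> measurable B ->
    measurable (c @^-1` B) by move=> mc mB; rewrite -[_ @^-1` _]setTI; exact: mc.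
have S1 y B : measurable B ->
    P (cind ([set z : circle R | complex.Im (z : R[i]) < y] `&`
             (fun z : circle R => complex.Re (z : R[i])) @^-1` B)).
  move=> mB; apply: (dynkin_cind Plin Plim mre GE GI) => //.
  - have := mpre _ `]-oo, y[%classic mim (measurable_itv _).
    by congr measurable; apply/seteqP; split => z /=; rewrite in_itv.
  (* The half-plane Re z < 2 contains the circle, so this half-plane in Im z is one of the
     quadrants. *)
  - rewrite -[X in P (cind X)]setTI (_ : setT = [set z : circle R | complex.Re (z : R[i]) < 2]); first exact: P_rect.
    apply/seteqP; split => // z _ /=; have := le_re_nrm (z : R[i]).
    by rewrite nrm_circle ler_norml; lra.
  - move=> _ [x ->]; have := P_rect x y; congr (P (cind _)).
    by rewrite /rect setIC; congr (_ `&` _); apply/seteqP; split => z /=; rewrite in_itv.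
have S2 B1 B2 : measurable B1 -> measurable B2 ->
    P (cind (((fun z : circle R => complex.Re (z : R[i])) @^-1` B1) `&`
             (fun z : circle R => complex.Im (z : R[i])) @^-1` B2)).
  move=> mB1 mB2; apply: (dynkin_cind Plin Plim mim GE GI) => //.
  - exact: mpre.
  - have := S1 2 B1 mB1; congr (P (cind _)).
    rewrite -[RHS]setTI; congr (_ `&` _).
    apply/seteqP; split => // z _ /=; have := le_im_nrm (z : R[i]).
    by rewrite nrm_circle ler_norml; lra.
  - move=> _ [x ->]; have := S1 x B1 mB1; congr (P (cind _)).
    by rewrite setIC; congr (_ `&` _); apply/seteqP; split => z /=; rewrite in_itv.
move=> _ [B mB <-].
apply: (dynkin_cind Plin Plim (@measurable_circle_coord R)
  (measurable_prod_measurableType (measurableTypeR R) (measurableTypeR R))) => //.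
- move=> _ _ [A1 mA1 [B1 mB1 <-]] [A2 mA2 [B2 mB2 <-]].
  exists (A1 `&` A2); first exact: measurableI.
  by exists (B1 `&` B2); [exact: measurableI|rewrite setXI].
- have := S2 setT setT measurableT measurableT.
  by rewrite !preimage_setT setIT.
- move=> _ [A1 mA1 [B1 mB1 <-]]; rewrite setTI.
  exact: S2.
Qed.

End Induction.
End TrigPoly.
(** * Fourier coefficients and the maps z^M *)

Section HaarFourier.
Variable R : realType.
Implicit Types f g : circle R -> R[i].
Local Notation mu := (haar R).
Local Notation I := (@cintegral R).

Lemma integral01_FTC (f F : R -> R) : (forall x : R, is_derive x 1 F (f x)) ->
  continuous f ->
  (\int[lebesgue_measure]_(x in `[0%R, 1%R]) (f x)%:E = (F 1)%:E - (F 0)%:E)%E.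
Proof.
move=> dF cf; have cF x : {for x, continuous F}.
  by apply/differentiable_continuous/derivable1_diffP; have [] := dF x.
apply: continuous_FTC2; rewrite ?ltr01 //.
- exact: continuous_subspaceT.
- split.
  + by move=> x _; have [] := dF x.
  + exact/cvg_at_right_filter/cF.
  + exact/cvg_at_left_filter/cF.
- by move=> x _; rewrite derive1E; have [_ ->] := dF x.
Qed.

(** Adding 1 makes the integrand nonnegative, as required by the change of variables used for the
    image measure. *)
Lemma haar_Rintegral (r : circle R -> R) : BM (fun z => (r z)%:C) ->
  (forall z, `|r z| <= 1) ->
  ((\int[mu]_z r z)%:E + 1 =
     \int[lebesgue_measure]_(t in `[0%R, 1%R]) (r (cis t) + 1)%:E)%E.
Proof.
move=> br r1; have [ir _] := BM_Lone br; have [[/= mr _] _] := br.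
have m1 : measurable_fun setT (fun z => (r z + 1)%:E).
  by apply/measurable_EFinP; apply: measurable_funD.
have r1' z : 0 <= r z + 1 by have := r1 z; rewrite ler_norml; lra.
transitivity (\int[mu]_z (r z + 1)%:E)%E.
  rewrite (_ : (fun z => (r z + 1)%:E) = (fun z => (EFin \o r) z + (EFin \o cst (1%R : R)) z)%E) //.
  rewrite integralD //; last exact: (finite_measure_integrable_cst mu).
  congr (_ + _)%E; first by rewrite fineK //; exact: integrable_fin_num.
  rewrite (_ : (fun z => (EFin \o cst (1%R : R)) z) = cst (1%R%:E : \bar R)) //.
  by rewrite integral_cst // mul1e; exact/esym/haarT.
rewrite (ge0_integral_distribution _ m1) //.
rewrite integral_uniform //=; first by rewrite subr0 invr1 mul1e.
- exact: (measurableT_comp m1 (@measurable_cis R)).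
- by move=> t; rewrite lee_fin.
Qed.

Lemma natS_mul (n : nat) (u : R) : n.+1%:R * u = n%:R * u + u.
Proof. by rewrite -natr1 mulrDl mul1r. Qed.

Lemma cis_pow (t : R) (n : nat) :
  (cis t : R[i]) ^+ n = cos (n%:R * (2 * pi * t)) +i* sin (n%:R * (2 * pi * t)).
Proof.
elim: n => [|n IH]; first by rewrite expr0 mul0r cos0 sin0.
rewrite exprS IH (natS_mul n (2 * pi * t)) cosD sinD /=.
by apply/eqP; rewrite eq_complex /=; apply/andP; split; apply/eqP; ring.
Qed.

Lemma cos_sin_period (n : nat) :
  cos (n%:R * (2 * pi)) = 1 :> R /\ sin (n%:R * (2 * pi)) = 0 :> R.
Proof.
elim: n => [|n [IHc IHs]]; first by rewrite mul0r cos0 sin0.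
have E : n.+1%:R * (2 * pi) = n%:R * (2 * pi) + pi *+ 2 :> R.
  by rewrite natS_mul; congr (_ + _); rewrite mulr_natl.
by rewrite E cosD (sinD (n%:R * (2 * pi)) (pi *+ 2)) cos2pi sin2pi IHc IHs !mulr0 !mulr1 subr0 addr0.
Qed.

Lemma cintegral_zpow_pos n : I (zpow n.+1%:Z) = 0.
Proof.
pose w : R := n.+1%:R * (2 * pi).
have w0 : w != 0 by rewrite mulf_neq0 ?pnatr_eq0 // mulf_neq0 ?pnatr_eq0 // gt_eqF ?pi_gt0.
have [cw sw] : cos w = 1 /\ sin w = 0 by exact: cos_sin_period.
have bz := BM_zpow R n.+1%:Z.
have E t : zpow n.+1%:Z (cis t) = cos (w * t) +i* sin (w * t) :> R[i].
  by rewrite /zpow -exprnP cis_pow /w !mulrA.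
(* An antiderivative with equal values at 0 and 1 forces a zero integral; the extra summand [t]
   integrates the 1 added by [haar_Rintegral]. *)
have red (r : circle R -> R) (G : R -> R) : BM (fun z => (r z)%:C) ->
    (forall z, `|r z| <= 1) -> (forall t : R, is_derive t 1 G (r (cis t))) ->
    continuous (fun t : R => r (cis t)) -> G 1 = G 0 -> \int[mu]_z r z = 0.
  move=> br r1 dG cr G01; have := haar_Rintegral br r1.
  rewrite (@integral01_FTC _ (fun t => G t + t)).
  - rewrite addr0 G01 -EFinD -EFinB => -[]; lra.
  - by move=> t; apply: cvgD; [exact: cr|exact: cvg_cst].
have Er t : complex.Re (zpow n.+1%:Z (cis t) : R[i]) = cos (w * t) by rewrite E.
have Ei t : complex.Im (zpow n.+1%:Z (cis t) : R[i]) = sin (w * t) by rewrite E.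
suff [re0 im0] : \int[mu]_z complex.Re (zpow n.+1%:Z z) = 0 /\
    \int[mu]_z complex.Im (zpow n.+1%:Z z) = 0 by rewrite /cintegral re0 im0.
split.
- apply: (red _ (fun t => sin (w * t) / w)); first exact: BM_re.
  + by move=> z; rewrite -(nrm_zpow n.+1%:Z z) le_re_nrm.
  + move=> t; rewrite Er; apply: is_derive_eq.
    by rewrite /GRing.scale /=; field.
  + move=> t; under eq_fun do rewrite Er.
    apply: continuous_comp; last exact: continuous_cos.
    by apply: cvgM; [exact: cvg_cst|exact: cvg_id].
  + by rewrite mulr1 mulr0 sw sin0.
- apply: (red _ (fun t => - cos (w * t) / w)); first exact: BM_im.
  + by move=> z; rewrite -(nrm_zpow n.+1%:Z z) le_im_nrm.
  + move=> t; rewrite Ei; apply: is_derive_eq.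
    by rewrite /GRing.scale /=; field.
  + move=> t; under eq_fun do rewrite Ei.
    apply: continuous_comp; last exact: continuous_sin.
    by apply: cvgM; [exact: cvg_cst|exact: cvg_id].
  + by rewrite mulr1 mulr0 cw cos0.
Qed.

Lemma cintegral_conj f : Lone f -> I (fun z => Num.conj (f z)) = Num.conj (I f).
Proof.
move=> [fr fi]; rewrite /cintegral.
under [X in X +i* _]eq_Rintegral do rewrite conj_re.
under [X in _ +i* X]eq_Rintegral do rewrite conj_im -mulN1r.
by rewrite RintegralZl // mulN1r.
Qed.

Lemma cintegral_zpow k : I (zpow k) = (k == 0)%:R.
Proof.
case: k => [[|n]|n].
- by rewrite -cintegral1; apply: eq_cintegral => z; rewrite zpow0.
- exact: cintegral_zpow_pos.
- rewrite (_ : zpow (Negz n) = fun z => Num.conj (zpow n.+1%:Z z)); last first.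
    by apply/funext => z; rewrite NegzE zpowN.
  by rewrite cintegral_conj ?cintegral_zpow_pos ?rmorph0 //; apply/BM_Lone/BM_zpow.
Qed.

Lemma measurable_circle_pow M : measurable_fun setT (@circle_pow R M).
Proof.
have mc : measurable_fun [set: circle R] (@circle_coord R \o circle_pow M).
  by apply/measurable_fun_pairP; have [] := cmeasurable_zpow R M%:Z.
move=> _ _ [B mB <-].
by rewrite (setTI (_ @^-1` B)) -comp_preimage; exact: mc.
Qed.

Lemma cmeasurable_comp f (s : circle R -> circle R) :
  measurable_fun setT s -> cmeasurable f -> cmeasurable (f \o s).
Proof.
move=> ms [mr mi]; split.
  exact: (measurableT_comp mr ms).
exact: (measurableT_comp mi ms).
Qed.

Lemma BM_comp f (s : circle R -> circle R) :
  measurable_fun setT s -> BM f -> BM (f \o s).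
Proof.
move=> ms [mf [M fM]]; split; first exact: cmeasurable_comp.
by exists M => z; exact: fM.
Qed.

(** The Fourier modes of f(z^M) are multiples of M, so a character of frequency smaller than M
    detects only the constant mode. This is the source of mixing, and for k = 0 the invariance of
    Haar measure under z^M. *)
Lemma cintegral_pow_zpow (M : nat) (k : int) f : (`|k| < M)%N -> BM f ->
  I (fun z => f (circle_pow M z) * zpow k z) = (k == 0)%:R * I f.
Proof.
move=> kM; have ms := measurable_circle_pow M.
have bk := BM_zpow R k.
have lf g : BM g -> Lone (fun z => g (circle_pow M z) * zpow k z).
  by move=> bg; apply: BM_Lone; apply: BMM => //; exact: (BM_comp ms bg).
apply: (@BM_ind _ (fun f => I (fun z => f (circle_pow M z) * zpow k z) = (k == 0)%:R * I f)).
- move=> a g h bg bh Pg Ph.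
  rewrite cintegral_lin; [|exact: BM_Lone..].
  rewrite mulrDr mulrCA -Pg -Ph -cintegral_lin; [|exact: lf..].
  by apply: eq_cintegral => z; ring.
- move=> f_ g bf Pf bl; apply: (@tends_unique _ _ (fun n => I (fun z => f_ n (circle_pow M z) * zpow k z))).
    apply: cintegral_blim; [by move=> n; exact: (BM_comp ms (bf n))| |exact: BM_Lone].
    by case: bl => -[C fC] ff; split => [|z]; [exists C => n z; exact: fC|exact: ff].
  under [X in tends X _]eq_fun do rewrite Pf.
  apply: tends_mull; have := cintegral_blim bf bl (Lone_cst 1).
  under eq_fun do under eq_cintegral do rewrite mulr1.
  by under eq_cintegral do rewrite mulr1.
- move=> j; rewrite cintegral_zpow -natrM mulnb.
  have -> : (fun z : circle R => zpow j (circle_pow M z) * zpow k z) = zpow (j * M%:Z + k).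
    by apply/funext => z; rewrite zpow_pow zpowD.
  rewrite cintegral_zpow; congr (nat_of_bool _)%:R; rewrite andbC.
  apply/eqP/andP => [e|[/eqP-> /eqP->]]; last by rewrite mul0r.
  have j0 : j = 0.
    apply/eqP; case: eqP => // /eqP j0.
    have : (M <= `|k|)%N.
      have -> : k = - (j * M%:Z) by apply/eqP; rewrite -addr_eq0 addrC e.
      by rewrite abszN abszM leq_pmull // absz_gt0.
    by rewrite leqNgt kM.
  by move: e; rewrite j0 mul0r add0r => ->.
Qed.

Lemma cintegral_pow (M : nat) f : (0 < M)%N -> BM f ->
  I (fun z => f (circle_pow M z)) = I f.
Proof.
move=> M0 bf; have := @cintegral_pow_zpow M 0 f M0 bf; rewrite mul1r => <-.
by apply: eq_cintegral => z; rewrite zpow0 mulr1.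
Qed.

Lemma cintegral_cind (A : set (circle R)) : measurable A ->
  I (cind A) = (fine (mu A))%:C.
Proof.
move=> mA; rewrite /cind cintegral_real; congr (_%:C).
by rewrite /Rintegral integral_indic // setIT.
Qed.

(** Invariance of Haar measure makes the preimage of a null set null; it lets an equation valid
    almost everywhere be evaluated at z^M. *)
Lemma ae_pow (M : nat) (P : circle R -> Prop) : (0 < M)%N ->
  {ae mu, forall z, P z} -> {ae mu, forall z, P (circle_pow M z)}.
Proof.
move=> M0 [A [mA A0 PA]]; have ms := measurable_circle_pow M.
have mB : measurable (circle_pow M @^-1` A) by rewrite -[_ @^-1` _]setTI; exact: ms.
exists (circle_pow M @^-1` A); split => //; last by move=> z /= nP; exact: PA.
have : I (cind (circle_pow M @^-1` A)) = I (cind A).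
  by rewrite -(cintegral_pow M0 (BM_cind mA)).
rewrite !cintegral_cind // => /complexI; rewrite A0 => e.
by rewrite -[LHS]fineK ?e //; exact: fin_num_measure.
Qed.

Lemma Linf_pow (M : nat) f : (0 < M)%N -> Linf f ->
  Linf (fun z => f (circle_pow M z)).
Proof.
move=> M0 /LinfP[mf [C fC]]; apply/LinfP; split.
  by apply: cmeasurable_comp mf; exact: measurable_circle_pow.
by exists C; exact: (ae_pow M0 fC).
Qed.

Lemma circle_powM (m n : nat) (z : circle R) :
  circle_pow m (circle_pow n z) = circle_pow (n * m) z.
Proof. by apply: val_inj; rewrite /= exprM. Qed.

Lemma circle_pow1 (z : circle R) : circle_pow 1 z = z.
Proof. by apply: val_inj; rewrite /= expr1. Qed.

End HaarFourier.
(** * Closed subspaces and projections *)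

Section ClosedSubspaces.
Variables (R : realType) (H : hilbert R).
Implicit Types (x y : H) (V Q : set H) (A B : H -> H).

(** Coefficients are functions of the index while lists may repeat an index, so two sums cannot just
    be concatenated. Multiplicities are first absorbed into the coefficients, then both sums are
    extended by 0 to a common list without repetition. *)
Lemma lin_span_lin (I : eqType) (e : I -> H) (a : R[i]) x y :
  lin_span e x -> lin_span e y -> lin_span e (a *: x + y).
Proof.
have norm z : lin_span e z -> exists s (c : I -> R[i]), uniq s /\ z = \sum_(i <- s) c i *: e i.
  move=> [s [c ->]]; exists (undup s), (fun i => (count_mem i s)%:R * c i).
  split; first exact: undup_uniq.
  rewrite -big_undup_iterop_count /=; apply: eq_bigr => i _.
  rewrite -scalerA scaler_nat Monoid.iteropE; elim: (count_mem i s) => //= n ->.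
  by rewrite mulrS.
move=> /norm[s [c [us ->]]] /norm[t [d [ut ->]]].
have ext (r u : seq I) (k : I -> R[i]) : uniq r -> uniq u -> {subset r <= u} ->
    \sum_(i <- r) k i *: e i = \sum_(i <- u) (if i \in r then k i else 0) *: e i.
  move=> ur uu ru; rewrite [RHS](bigID (fun i => i \in r)) /= [X in _ + X]big1 ?addr0; last first.
    by move=> i /negbTE ->; rewrite scale0r.
  rewrite [RHS](eq_bigr (fun i => k i *: e i)); last by move=> i ->.
  rewrite -[RHS]big_filter.
  apply: perm_big; apply: uniq_perm => //; first exact: filter_uniq.
  by move=> i; rewrite mem_filter; case: (boolP (i \in r)) => // /ru ->.
pose u := undup (s ++ t).
exists u, (fun i => a * (if i \in s then c i else 0) + (if i \in t then d i else 0)).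
rewrite (ext s u) ?undup_uniq //; last by move=> i ii; rewrite mem_undup mem_cat ii.
rewrite (ext t u) ?undup_uniq //; last by move=> i ii; rewrite mem_undup mem_cat ii orbT.
rewrite scaler_sumr -big_split; apply: eq_bigr => i _ /=.
by rewrite scalerA scalerDl.
Qed.

Lemma lin_span_mem (I : eqType) (e : I -> H) i : lin_span e (e i).
Proof. by exists [:: i], (fun=> 1); rewrite big_seq1 scale1r. Qed.

Lemma near_set_mem V x : V x -> near_set V x.
Proof. by move=> Vx e e0; exists x; rewrite // subrr nrm0. Qed.

Lemma near_set_lin V (a : R[i]) x y :
  (forall (a : R[i]) x y, V x -> V y -> V (a *: x + y)) ->
  near_set V x -> near_set V y -> near_set V (a *: x + y).
Proof.
move=> linV nx ny e e0.
have a0 : 0 < nrm a + 1 by rewrite ltr_wpDl ?nrm_ge0.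
have [x' Vx' hx] := nx (e / 2 / (nrm a + 1)) ltac:(rewrite divr_gt0 //; lra).
have [y' Vy' hy] := ny (e / 2) ltac:(lra).
exists (a *: x' + y'); first exact: linV.
rewrite opprD addrACA -scalerBr; apply: le_lt_trans (nrmD _ _) _; rewrite nrmZ.
move: hx; rewrite ltr_pdivlMr // mulrDr mulr1 mulrC => hx.
have := nrm_ge0 (x - x'); lra.
Qed.

Lemma near_set_idem V x : near_set (near_set V) x -> near_set V x.
Proof.
move=> nx e e0; have e2 : 0 < e / 2 by lra.
have [y ny xy] := nx _ e2; have [z Vz yz] := ny _ e2.
exists z => //; rewrite -(subrK y x) -addrA; apply: le_lt_trans (nrmD _ _) _; lra.
Qed.

Lemma closed_subspaceP V : closed_subspace V <->
  [/\ V 0, (forall (a : R[i]) x y, V x -> V y -> V (a *: x + y)) &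
      forall x, near_set V x -> V x].
Proof. by split=> [[/closed_nearP ? ? ?]|[? ? ?]]; split => //; apply/closed_nearP. Qed.

Lemma closure_subspace V : V 0 ->
  (forall (a : R[i]) x y, V x -> V y -> V (a *: x + y)) -> closed_subspace (closure V).
Proof.
move=> V0 linV; apply/closed_subspaceP; split.
- by apply/closureP/near_set_mem.
- by move=> a x y /closureP nx /closureP ny; apply/closureP/near_set_lin.
- move=> x nx; apply/closureP/near_set_idem => e /nx[y /closureP ? ?].
  by exists y.
Qed.

Lemma closed_span (I : eqType) (e : I -> H) : closed_subspace (closure (lin_span e)).
Proof.
apply: closure_subspace; last exact: lin_span_lin.
by exists [::], (fun=> 0); rewrite big_nil.
Qed.

Lemma closed_span_mem (I : eqType) (e : I -> H) i : closure (lin_span e) (e i).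
Proof. by apply/closureP/near_set_mem/lin_span_mem. Qed.

(** The shape of the density arguments below: the set where a claim holds is shown to be a closed
    subspace, so checking generators is enough. *)
Lemma closed_span_min (I : eqType) (e : I -> H) Q : closed_subspace Q ->
  (forall i, Q (e i)) -> closure (lin_span e) `<=` Q.
Proof.
move=> /closed_subspaceP[Q0 linQ cQ] Qe x /closureP nx; apply: cQ => eps eps0.
have [y [s [c ->]] xy] := nx _ eps0; exists (\sum_(i <- s) c i *: e i) => //.
elim: s {xy} => [|i s IH]; first by rewrite big_nil.
by rewrite big_cons; exact: linQ.
Qed.

(* Bare functions, since unitary_inv is not bundled as a linear map. *)
Definition lbop A := (forall (a : R[i]) x y, A (a *: x + y) = a *: A x + A y) /\
  exists M : R, forall x, nrm (A x) <= M * nrm x.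

Lemma lbop0 A : lbop A -> A 0 = 0.
Proof. by move=> [linA _]; have := linA (-1) 0 0; rewrite scaler0 addr0 scaleN1r addNr. Qed.

Lemma lbopB A x y : lbop A -> A (x - y) = A x - A y.
Proof.
by move=> [linA _]; rewrite addrC -scaleN1r linA scaleN1r addrC.
Qed.

Lemma lbopZ A a x : lbop A -> A (a *: x) = a *: A x.
Proof. by move=> lA; have [linA _] := lA; rewrite -[a *: x]addr0 linA (lbop0 lA) addr0. Qed.

Lemma lbop_comp A B : lbop A -> lbop B -> lbop (A \o B).
Proof.
move=> [linA [M hA]] [linB [M' hB]]; split; first by move=> a x y /=; rewrite linB linA.
exists (`|M| * M') => x /=; apply: le_trans (hA _) _.
apply: (@le_trans _ _ (`|M| * nrm (B x))); first by rewrite ler_wpM2r ?nrm_ge0 ?ler_norm.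
by rewrite -mulrA ler_wpM2l.
Qed.

Lemma lbop_tends A (x_ : nat -> H) x : lbop A -> tends x_ x -> tends (fun n => A (x_ n)) (A x).
Proof.
move=> lA; have [_ [M hA]] := lA; apply: (@tends_lip _ _ _ A M) => n.
by rewrite -lbopB.
Qed.

Lemma near_tends V x : near_set V x -> exists2 x_ : nat -> H, (forall n, V (x_ n)) & tends x_ x.
Proof.
move=> nx; have h n : exists v, V v /\ nrm (x - v) < n.+1%:R^-1.
  by have [|v] := nx n.+1%:R^-1; [rewrite invr_gt0|exists v].
exists (fun n => projT1 (cid (h n))); first by move=> n; case: cid => v [].
move=> e e0; exists (Num.truncn e^-1) => n nn; case: cid => v [_ /= /lt_le_trans]; apply.
rewrite invf_ple ?posrE //; apply: ltW; apply: lt_le_trans (truncnS_gt _) _.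
by rewrite ler_nat.
Qed.

Lemma tends_near V (x_ : nat -> H) x : (forall n, V (x_ n)) -> tends x_ x -> near_set V x.
Proof. by move=> Vx t e /t[n Hn]; exists (x_ n) => //; exact: Hn. Qed.

Lemma closed_preim A V : lbop A -> closed_subspace V -> closed_subspace [set x | V (A x)].
Proof.
move=> lA /closed_subspaceP[V0 linV cV]; apply/closed_subspaceP; split => /=.
- by rewrite (lbop0 lA).
- by move=> a x y Vx Vy; have [-> _] := lA; exact: linV.
- by move=> x /near_tends[x_ Vx t]; apply: cV; exact: (@tends_near V (fun n => A (x_ n)) _ Vx (lbop_tends lA t)).
Qed.

Lemma closed_eq A B : lbop A -> lbop B -> closed_subspace [set x | A x = B x].
Proof.
move=> lA lB; apply/closed_subspaceP; split => /=.
- by rewrite !lbop0.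
- by move=> a x y ex ey; have [-> _] := lA; have [-> _] := lB; rewrite ex ey.
- move=> x /near_tends[x_ Vx t]; apply: (tends_unique (lbop_tends lA t)).
  by under eq_fun do rewrite Vx; exact: lbop_tends.
Qed.

Lemma closed_inner A B y : lbop A -> lbop B ->
  closed_subspace [set x | inner (A x) y = inner (B x) y].
Proof.
move=> lA lB; apply/closed_subspaceP; split => /=.
- by rewrite !lbop0.
- move=> a x z ex ez; have [-> _] := lA; have [-> _] := lB.
  by rewrite !innerDl !innerZl ex ez.
- move=> x /near_tends[x_ Vx t]; apply: (tends_unique (tends_innerl y (lbop_tends lA t))).
  by under eq_fun do rewrite Vx; apply: tends_innerl; exact: lbop_tends.
Qed.

Lemma lbop_id : lbop id.
Proof. by split => //; exists 1 => x; rewrite mul1r. Qed.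

Lemma lbop_zero : lbop (fun=> 0).
Proof. by split=> [a x y|]; [rewrite scaler0 addr0|exists 0 => x; rewrite nrm0 mul0r]. Qed.

Lemma lbop_bounded (A : {linear H -> H}) : bounded_operator A -> lbop A.
Proof.
move=> [M hA]; split; first by move=> a x y; rewrite linearP.
by exists M => x; have := hA x; rewrite !nrmE -rmorphM lecR.
Qed.

Lemma span_ortho (I : eqType) (e : I -> H) y : closure (lin_span e) y ->
  (forall i, inner (e i) y = 0) -> y = 0.
Proof.
move=> Vy h; apply: inner_eq0.
have C := closed_inner y lbop_id lbop_zero.
have := closed_span_min C _ Vy; rewrite /= inner0l; apply => i /=.
exact: h.
Qed.

(** Density is used in one variable at a time; conjugate symmetry moves the second variable to the
    linear side before it is treated. *)
Lemma span_ext2 (I : eqType) (e : I -> H) A B x y : lbop A -> lbop B ->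
  (forall i j, inner (A (e i)) (e j) = inner (B (e i)) (e j)) ->
  closure (lin_span e) x -> closure (lin_span e) y -> inner (A x) y = inner (B x) y.
Proof.
move=> lA lB h Vx Vy.
have h1 j : inner (A x) (e j) = inner (B x) (e j).
  by apply: (closed_span_min (closed_inner (e j) lA lB) _ Vx) => i /=.
suff E : inner y (A x) = inner y (B x) by rewrite [LHS]innerC E -innerC.
apply/eqP; rewrite -subr_eq0 -innerBr; apply/eqP; move: y Vy.
apply: closed_span_min.
  apply/closed_subspaceP; split => /=.
  - by rewrite inner0l.
  - by move=> a u v eu ev; rewrite innerDl innerZl eu ev mulr0 addr0.
  - move=> u /near_tends[x_ Vx' t]; apply: (tends_unique (tends_innerl _ t)).
    by under eq_fun do rewrite Vx'; exact: tends_cst.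
by move=> j /=; rewrite innerBr innerC h1 -innerC subrr.
Qed.

Lemma unitary_nrm (U : unitary H) x : nrm (U x) = nrm x.
Proof.
apply/eqP; rewrite -(@eqrXn2 _ 2) ?nrm_ge0 //; apply/eqP/complexI.
by rewrite -!innerxx unitary_inner.
Qed.

Lemma lbop_unitary (U : unitary H) : lbop U.
Proof. by split=> [a x y|]; [rewrite linearP|exists 1 => x; rewrite mul1r unitary_nrm]. Qed.

Lemma lbop_unitary_inv (U : unitary H) : lbop (unitary_inv U).
Proof.
split=> [a x y|].
  by rewrite -{1}(unitary_invK U x) -{1}(unitary_invK U y) -linearP unitaryK.
by exists 1 => x; rewrite mul1r -(unitary_nrm U) unitary_invK.
Qed.

Lemma lbop_iter A n : lbop A -> lbop (iter n A).
Proof.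
move=> lA; elim: n => [|n IH]; first exact: lbop_id.
exact: (lbop_comp lA IH).
Qed.

Lemma lbop_unitary_exp (U : unitary H) k : lbop (unitary_exp U k).
Proof.
by case: k => n; apply: lbop_iter; [exact: lbop_unitary|exact: lbop_unitary_inv].
Qed.

Lemma iterK (U : unitary H) n : cancel (iter n U) (iter n (unitary_inv U)).
Proof. by elim: n => // n IH x; rewrite iterSr /= unitaryK IH. Qed.

Lemma iter_invK (U : unitary H) n : cancel (iter n (unitary_inv U)) (iter n U).
Proof. by elim: n => // n IH x; rewrite iterSr /= unitary_invK IH. Qed.

Lemma iter_inner (U : unitary H) n x y : inner (iter n U x) (iter n U y) = inner x y.
Proof. by elim: n => // n IH; rewrite !iterS unitary_inner. Qed.

Lemma iter_nrm (U : unitary H) n x : nrm (iter n U x) = nrm x.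
Proof. by elim: n => // n IH; rewrite iterS unitary_nrm. Qed.

Lemma iter_inv_nrm (U : unitary H) n x : nrm (iter n (unitary_inv U) x) = nrm x.
Proof. by rewrite -(iter_nrm U n) iter_invK. Qed.

Lemma unitary_expS (U : unitary H) (k : int) x :
  unitary_exp U (k + 1) x = U (unitary_exp U k x).
Proof.
case: k => n; first by rewrite -PoszD addn1.
case: n => [|n]; first by rewrite /= unitary_invK.
rewrite (_ : Negz n.+1 + 1 = Negz n); last by rewrite !NegzE; lia.
by rewrite /= unitary_invK.
Qed.

Lemma unitary_expSr (U : unitary H) (k : int) x :
  unitary_exp U (k + 1) x = unitary_exp U k (U x).
Proof.
case: k => n; first by rewrite -PoszD addn1 /unitary_exp iterSr.
case: n => [|n]; first by rewrite /= unitaryK.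
rewrite (_ : Negz n.+1 + 1 = Negz n); last by rewrite !NegzE; lia.
by rewrite /unitary_exp [in RHS]iterSr unitaryK.
Qed.

End ClosedSubspaces.
Lemma conj_realM (R : realType) (r : R) (a : R[i]) :
  Num.conj (r%:C * a) = r%:C * Num.conj a.
Proof.
by case: a => a b; apply/eqP; rewrite eq_complex /=; apply/andP; split; apply/eqP; ring.
Qed.

(** * Orthogonal projection onto a closed subspace *)

Section Projection.
Variables (R : realType) (H : hilbert R) (V : set H).
Hypothesis cV : closed_subspace V.
Implicit Types x y v : H.

Lemma parallelogram x y :
  nrm (x + y) ^+ 2 + nrm (x - y) ^+ 2 = 2 * nrm x ^+ 2 + 2 * nrm y ^+ 2.
Proof. by rewrite nrm_sqrD nrm_sqrB; ring. Qed.

Lemma invn_small (e : R) : 0 < e -> exists n0, forall n, (n0 <= n)%N -> n.+1%:R^-1 < e.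
Proof.
move=> e0; exists (Num.truncn e^-1) => n hn.
rewrite invf_plt ?posrE //; apply: lt_le_trans (truncnS_gt _) _.
by rewrite ler_nat.
Qed.

Lemma hilbert_complete (x_ : nat -> H) :
  (forall e : R, 0 < e -> exists n0, forall m n, (n0 <= m)%N -> (n0 <= n)%N ->
     nrm (x_ m - x_ n) < e) -> exists x, tends x_ x.
Proof.
move=> hc; have /cauchy_cvgP : cauchy (x_ @ \oo).
  apply/cauchy_ballP => e e0; have eR : e = (complex.Re e)%:C.
    by rewrite RRe_real // gtr0_real.
  have e0' : 0 < complex.Re e by rewrite -ltcR -eR.
  have [n0 Hn] := hc _ e0'.
  exists (x_ @` [set n | (n0 <= n)%N], x_ @` [set n | (n0 <= n)%N]) => /=.
    by split; exists n0 => // n ? /=; exists n.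
  move=> [_ _] /= [[m hm <-] [n hn <-]]; rewrite -ball_normE /= nrmE eR ltcR; exact: Hn.
by move=> /cvg_ex[x /tendsP]; exists x.
Qed.

(** By the parallelogram law a minimizing sequence is Cauchy. Orthogonality is proved approximately
    along the sequence and passed to the limit. *)
Lemma projection_exists x : exists2 v, V v & forall w, V w -> inner (x - v) w = 0.
Proof.
have /closed_subspaceP[V0 linV clV] := cV.
pose D := [set nrm (x - v) ^+ 2 | v in V].
have D0 : D (nrm (x - 0) ^+ 2) by exists 0.
have hD : has_inf D.
  by split; [exists (nrm (x - 0) ^+ 2)|exists 0 => _ [v _ <-]; exact: sqr_ge0].
pose d := inf D.
have dle v : V v -> d <= nrm (x - v) ^+ 2.
  by move=> Vv; apply: inf_lbound; [case: hD|exists v].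
have app e : 0 < e -> exists v, V v /\ nrm (x - v) ^+ 2 < d + e.
  by move=> e0; have [_ [v Vv <-] h] := inf_adherent e0 hD; exists v.
have app' n : exists v, V v /\ nrm (x - v) ^+ 2 < d + n.+1%:R^-1.
  by apply: app; rewrite invr_gt0.
pose v_ n := projT1 (cid (app' n)).
have Vv n : V (v_ n) by rewrite /v_; case: cid => v [].
have dv n : nrm (x - v_ n) ^+ 2 < d + n.+1%:R^-1 by rewrite /v_; case: cid => v [].
have key m n : nrm (v_ m - v_ n) ^+ 2 <= 2 * m.+1%:R^-1 + 2 * n.+1%:R^-1.
  have := parallelogram (x - v_ n) (x - v_ m).
  have -> : x - v_ n - (x - v_ m) = v_ m - v_ n by rewrite opprB addrC -addrA [- x + _]addrA addNr add0r.
  have -> : x - v_ n + (x - v_ m) = (2 : R[i]) *: (x - (2^-1 : R[i]) *: (v_ n + v_ m)).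
    rewrite scalerBr scalerA divff ?pnatr_eq0 // scale1r scaler_nat mulr2n.
    by rewrite opprD addrACA.
  have hV : V ((2^-1 : R[i]) *: (v_ n + v_ m)).
    rewrite -[_ *: _]addr0; apply: (linV _ (v_ n + v_ m) 0) => //.
    by rewrite -[v_ n]scale1r; exact: linV.
  have := dle _ hV; rewrite nrmZ exprMn.
  have -> : nrm (2 : R[i]) = 2 by rewrite /nrm ger0_norm.
  move: (dv m) (dv n); set a := m.+1%:R^-1; set b := n.+1%:R^-1.
  set A := nrm (x - v_ n) ^+ 2; set B := nrm (x - v_ m) ^+ 2.
  set X := nrm (x - _) ^+ 2; set D' := nrm (v_ m - v_ n) ^+ 2.
  rewrite -[d]/(inf D); move: (inf D) => d' h1 h2 h3 h4; lra.
have [v tv] : exists v, tends v_ v.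
  apply: hilbert_complete => e e0; have e2 : 0 < e ^+ 2 by rewrite exprn_gt0.
  have e4 : 0 < e ^+ 2 / 4 by lra.
  have [n0 small] := invn_small e4; exists n0 => m n hm hn.
  rewrite -(@ltr_pXn2r _ 2) ?nnegrE ?nrm_ge0 ?(ltW e0) //.
  move: (key m n) (small m hm) (small n hn).
  by set a := m.+1%:R^-1; set b := n.+1%:R^-1; lra.
have Vlim : V v by apply: clV; exact: (tends_near Vv tv).
exists v => // w Vw.
have tx : tends (fun n => x - v_ n) (x - v).
  apply: (@tends_lip _ _ _ (fun u => x - u) 1) tv => n.
  by rewrite mul1r opprB addrC -addrA [- x + _]addrA addNr add0r nrm_distC.
apply: (tends_unique (tends_innerl w tx)) => e e0.
(* The competitor v_n + s <x - v_n, w> w cannot come closer to x than the infimum, which bounds the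
   inner product. The 1 in the denominator covers w = 0. *)
pose s := (nrm w ^+ 2 + 1)^-1; have w0 := sqr_ge0 (nrm w).
have s0 : 0 < s by rewrite invr_gt0; lra.
have bound n : nrm (inner (x - v_ n) w) ^+ 2 * s <= n.+1%:R^-1.
  set a := inner (x - v_ n) w; pose t := s%:C * a.
  have hV : V (v_ n + t *: w) by rewrite addrC; exact: linV.
  have := dle _ hV; rewrite opprD addrA nrm_sqrB innerZr nrmZ exprMn -/a.
  have -> : Num.conj t * a = (s * nrm a ^+ 2)%:C.
    rewrite /t conj_realM.
    by rewrite -mulrA [_ * a]mulrC mulcJ -rmorphM.
  rewrite /t nrmM nrmC gtr0_norm //= => h; have hd := dv n.
  have sw : s * nrm w ^+ 2 <= 1.
    by rewrite mulrC ler_pdivrMr; lra.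
  have := ler_wpM2l (_ : 0 <= s * nrm a ^+ 2) sw.
  rewrite mulr_ge0 ?sqr_ge0 ?(ltW s0) // => /(_ isT).
  have num (d' X s' a' w' q : R) : d' <= X + (s' * a') ^+ 2 * w' ^+ 2 - 2 * (s' * a' ^+ 2) ->
    X < d' + q -> s' * a' ^+ 2 * (s' * w' ^+ 2) <= s' * a' ^+ 2 * 1 -> a' ^+ 2 * s' <= q.
    by rewrite exprMn; lra.
  exact: num h hd.
have es0 : 0 < e ^+ 2 * s by rewrite mulr_gt0 ?exprn_gt0.
have [n0 small] := invn_small es0; exists n0 => n /small hn.
rewrite sub0r nrmN -(@ltr_pXn2r _ 2) ?nnegrE ?nrm_ge0 ?(ltW e0) //.
by rewrite -(ltr_pM2r s0); apply: le_lt_trans (bound n) _.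
Qed.

Definition proj x : H := projT1 (cid2 (projection_exists x)).

Lemma proj_mem x : V (proj x).
Proof. by rewrite /proj; case: cid2. Qed.

Lemma proj_ortho x w : V w -> inner (x - proj x) w = 0.
Proof. by rewrite /proj; case: cid2 => v ? /= h; exact: h. Qed.

Lemma proj_unique x v : V v -> (forall w, V w -> inner (x - v) w = 0) -> proj x = v.
Proof.
have /closed_subspaceP[_ linV _] := cV.
move=> Vv h; apply/eqP; rewrite -subr_eq0; apply/eqP/inner_eq0.
have Vd : V (proj x - v) by rewrite addrC -scaleN1r; apply: linV => //; exact: proj_mem.
rewrite [X in inner X _](_ : proj x - v = (x - v) - (x - proj x)); last first.
  by rewrite opprB addrA (addrC (x - v)) addrA addrAC addrK.
by rewrite innerBl h // proj_ortho // subrr.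
Qed.

Lemma proj_id v : V v -> proj v = v.
Proof. by move=> Vv; apply: proj_unique => // w _; rewrite subrr inner0l. Qed.

Lemma proj_linear : linear proj.
Proof.
have /closed_subspaceP[_ linV _] := cV.
move=> a x y; apply: proj_unique.
  by apply: linV; exact: proj_mem.
move=> w Vw; rewrite opprD addrACA -scalerBr innerDl innerZl.
by rewrite !proj_ortho // mulr0 addr0.
Qed.

HB.instance Definition _ := GRing.isLinear.Build R[i] H H *:%R proj proj_linear.

Lemma proj_inner x y : inner (proj x) y = inner x (proj y).
Proof.
have E z w : inner (proj z) w = inner (proj z) (proj w).
  apply/eqP; rewrite -subr_eq0 -innerBr innerC proj_ortho ?rmorph0 //.
  exact: proj_mem.
rewrite E; apply/esym/eqP; rewrite -subr_eq0 -innerBl; apply/eqP.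
by apply: proj_ortho; exact: proj_mem.
Qed.

Lemma nrm_proj x : nrm (proj x) <= nrm x.
Proof.
have := cauchy_schwarz (proj x) x.
rewrite proj_inner -[X in inner x X](proj_id (proj_mem x)) -proj_inner innerxx nrmC.
rewrite ger0_norm ?sqr_ge0 // expr2.
have [->|p0] := eqVneq (nrm (proj x)) 0; first by rewrite nrm_ge0.
by rewrite ler_pM2l // lt_def p0 nrm_ge0.
Qed.

Lemma proj_orthogonal : orthogonal_projection proj.
Proof.
split.
- by exists 1 => x; rewrite mul1r !nrmE lecR nrm_proj.
- by move=> x; apply: proj_id; exact: proj_mem.
- exact: proj_inner.
Qed.

(** Invariance under [A] keeps A (proj x) in [V]; invariance under the adjoint [B] makes A (x - proj
    x) orthogonal to [V]. *)
Lemma proj_commute (A B : H -> H) : lbop A ->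
  (forall x y, inner (A x) y = inner x (B y)) ->
  (forall x, V x -> V (A x)) -> (forall x, V x -> V (B x)) ->
  forall x, proj (A x) = A (proj x).
Proof.
move=> lA AB VA VB x; apply: proj_unique; first by apply/VA/proj_mem.
by move=> w Vw; rewrite -lbopB // AB proj_ortho //; exact: VB.
Qed.

End Projection.
(** * Normal wavelet representations *)

Section Representation.
Variables (R : realType) (N : nat) (W : wavelet_rep R N).
Hypothesis normalW : normal_rep W.
Hypothesis N2 : (2 <= N)%N.
Implicit Types (x y v : wspace W) (f g h : circle R -> R[i]).
Local Notation pi := (wpi W).
Local Notation U := (wU W).
Local Notation V' := (unitary_inv (wU W)).

Lemma lbop_pi f : Linf f -> lbop (pi f).
Proof. by move=> Lf; apply: lbop_bounded; exact: wpi_bounded. Qed.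

Lemma pi_ext f g x : f =1 g -> pi f x = pi g x.
Proof. by move=> /funext ->. Qed.

Lemma piD f g x : Linf f -> Linf g -> pi (fun z => f z + g z) x = pi f x + pi g x.
Proof.
move=> Lf Lg; rewrite -[pi f x]scale1r -wpi_linear //.
by apply: pi_ext => z; rewrite mul1r.
Qed.

Lemma Linf_cst (c : R[i]) : Linf (fun _ : circle R => c).
Proof. exact/BM_Linf/BM_cst. Qed.

Lemma pi0 x : pi (fun=> 0) x = 0.
Proof.
have := @wpi_linear _ _ W (-1) _ _ (Linf_cst 1) (Linf_cst 1) x.
by rewrite scaleN1r addNr => <-; apply: pi_ext => z; rewrite mulr1 addNr.
Qed.

Lemma piZ (a : R[i]) f x : Linf f -> pi (fun z => a * f z) x = a *: pi f x.
Proof.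
move=> Lf; rewrite -[RHS]addr0 -(pi0 x) -wpi_linear //; last exact: Linf_cst.
by apply: pi_ext => z; rewrite addr0.
Qed.

Lemma piB f g x : Linf f -> Linf g -> pi (fun z => f z - g z) x = pi f x - pi g x.
Proof.
move=> Lf Lg; rewrite addrC -scaleN1r -wpi_linear //.
by apply: pi_ext => z; rewrite mulN1r addrC.
Qed.

Lemma pi_sum (I : Type) (s : seq I) (f_ : I -> circle R -> R[i]) x :
  (forall i, BM (f_ i)) -> pi (fun z => \sum_(i <- s) f_ i z) x = \sum_(i <- s) pi (f_ i) x.
Proof.
move=> bf; elim: s => [|i s IH].
  by rewrite big_nil -(pi0 x); apply: pi_ext => z; rewrite big_nil.
rewrite big_cons -IH -piD; [|exact/BM_Linf|exact/BM_Linf/BM_sum].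
by apply: pi_ext => z; rewrite big_cons.
Qed.

Lemma pi_comm f g x : Linf f -> Linf g -> pi f (pi g x) = pi g (pi f x).
Proof.
by move=> Lf Lg; rewrite -!wpi_mul //; apply: pi_ext => z; rewrite mulrC.
Qed.

Lemma pi_blim (f_ : nat -> circle R -> R[i]) f x : (forall n, BM (f_ n)) -> blim f_ f ->
  tends (fun n => pi (f_ n) x) (pi f x).
Proof.
move=> bf bl; have Bf := blim_BM bf bl; have [[M fM] ff] := bl.
apply/tendsP; apply: normalW.
- by move=> n; exact: BM_Linf.
- exact: BM_Linf.
- by apply: nearW => z; apply/(tendsP (V := R[i]^o)); exact: ff.
- exists (`|M| + 1); first by rewrite ltr_wpDl.
  move=> n; apply: Linf_norm_le => z; apply: le_trans (fM n z) _.
  by apply: le_trans (ler_norm _) _; rewrite lerDl.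
Qed.

Lemma pi_innerC f x y : Linf f -> inner x (pi f y) = inner (pi (fun z => Num.conj (f z)) x) y.
Proof.
move=> Lf; rewrite wpi_star; last exact: Linf_conj.
by congr (inner x _); apply: pi_ext => z; rewrite conjCK.
Qed.

Lemma pi_cind_inner A x : measurable A ->
  inner (pi (cind A) x) x = (nrm (pi (cind A) x) ^+ 2)%:C.
Proof.
move=> mA; have LA := BM_Linf (BM_cind mA).
rewrite -innerxx [RHS]wpi_star // -wpi_mul //; last exact: Linf_conj.
rewrite [RHS]innerC [LHS]innerC -[in RHS]innerC -[in LHS]innerC.
rewrite wpi_star //; congr (inner x _); apply: pi_ext => z.
by rewrite cind_conj cindM.
Qed.

(** With r = sqrt(C^2 - |f|^2) one has |pi(f) x|^2 + |pi(r) x|^2 = C^2 |x|^2. Unlike the constant of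
    [wpi_bounded], this one depends on [f] only through its sup bound. *)
Lemma nrm_pi_le f C x : cmeasurable f -> (forall z, nrm (f z) <= C) ->
  nrm (pi f x) <= C * nrm x.
Proof.
move=> mf fC; have C0 : 0 <= C by apply: le_trans (fC (@circle_one R)); exact: nrm_ge0.
have bf : BM f by split => //; exists C.
pose r z := Num.sqrt (C ^+ 2 - nrm (f z) ^+ 2).
have rE z : r z ^+ 2 = C ^+ 2 - nrm (f z) ^+ 2.
  by rewrite sqr_sqrtr // subr_ge0 lerXn2r ?nnegrE ?nrm_ge0.
have br : BM (fun z => (r z)%:C).
  apply: (@BM_real _ _ C).
    apply: (measurableT_comp (@measurable_fun_sqrt R)).
    apply: measurable_funB; first exact: measurable_cst.
    by apply: measurable_funX; exact: measurable_fun_nrm.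
  move=> z; rewrite ger0_norm ?sqrtr_ge0 // -(@ler_pXn2r _ 2) ?nnegrE ?sqrtr_ge0 //.
  by rewrite -/(r z) rE gerBl sqr_ge0.
have Lf := BM_Linf bf; have Lr := BM_Linf br.
have E : (nrm (pi f x) ^+ 2)%:C + (nrm (pi (fun z => (r z)%:C) x) ^+ 2)%:C = (C ^+ 2 * nrm x ^+ 2)%:C :> R[i].
  rewrite -!innerxx !wpi_star // -!wpi_mul //; [|exact: Linf_conj..].
  rewrite -innerDr -piD; [|by apply: LinfM => //; exact: Linf_conj..].
  rewrite (_ : pi _ x = (C ^+ 2)%:C *: x).
    by rewrite innerZr innerxx [in RHS]rmorphM; congr (_ * _); exact: conjc_real.
  rewrite -[x in RHS]wpi_one -piZ; last exact: Linf_cst.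
  apply: pi_ext => z; rewrite [Num.conj (f z) * _]mulrC mulcJ.
  rewrite [Num.conj _ * _]mulrC mulcJ nrmC real_normK ?num_real // rE.
  by rewrite -rmorphD mulr1 addrC subrK.
rewrite -(@ler_pXn2r _ 2) ?nnegrE ?nrm_ge0 ?mulr_ge0 ?nrm_ge0 // exprMn.
move: E; rewrite -rmorphD => /complexI <-; by rewrite lerDl sqr_ge0.
Qed.

Lemma scale_gt0 : (0 < N)%N. Proof. exact: leq_trans N2. Qed.

Lemma U_pi f x : Linf f -> U (pi f x) = pi (fun z => f (circle_pow N z)) (U x).
Proof. by move=> Lf; rewrite -wpi_intertwine // unitaryK. Qed.

Lemma iterU_pi m f x : Linf f ->
  iter m U (pi f x) = pi (fun z => f (circle_pow (N ^ m) z)) (iter m U x).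
Proof.
elim: m f x => [|m IH] f x Lf.
  by apply: pi_ext => z; rewrite expn0 circle_pow1.
rewrite iterS IH // U_pi; last by apply: Linf_pow => //; rewrite expn_gt0 scale_gt0.
by rewrite -iterS; apply: pi_ext => z; rewrite circle_powM expnS.
Qed.

Lemma pi_iterV m f x : Linf f ->
  pi f (iter m V' x) = iter m V' (pi (fun z => f (circle_pow (N ^ m) z)) x).
Proof.
by move=> Lf; rewrite -{2}(iter_invK U m x) -iterU_pi // iterK.
Qed.

Lemma T_orbitE v k : T_orbit v k = pi (zpow k) v.
Proof.
rewrite /T_orbit; case: k => n /=.
  elim: n => [|n IH] /=; first by rewrite -[LHS]wpi_one; apply: pi_ext => z; rewrite zpow0.
  rewrite IH /wT_fun -wpi_mul; [|exact: Linf_id|exact/BM_Linf/BM_zpow].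
  by apply: pi_ext => z; rewrite -[X in X * _]zpow1 -zpowD.
have H m : iter m (wT_inv (W := W)) v = pi (zpow (- m%:Z)) v.
  elim: m => [|m IH] /=.
    by rewrite -[LHS]wpi_one; apply: pi_ext => z; rewrite oppr0 zpow0.
  rewrite IH /wT_inv -wpi_mul; [|exact: Linf_conj_id|exact/BM_Linf/BM_zpow].
  apply: pi_ext => z; rewrite -[X in Num.conj X * _]zpow1 -zpowN -zpowD.
  by congr (zpow _ z); lia.
by rewrite NegzE -(H n.+1).
Qed.

Lemma Linf_repr f : Linf f -> exists g, [/\ BM g, ae_equal f g & forall x, pi f x = pi g x].
Proof.
move=> Lf; have /LinfP[mf [M fM]] := Lf; have [g [bg fg _]] := Linf_BM mf fM.
by exists g; split => // x; apply: wpi_ae => //; exact: BM_Linf.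
Qed.

Local Notation V0 v := (closure (lin_span (T_orbit v))).

(** Normality upgrades invariance under the powers of T to invariance under all of [pi], by
    [BM_ind]. *)
Lemma pi_stable (V : set (wspace W)) : closed_subspace V ->
  (forall k v, V v -> V (pi (zpow k) v)) -> forall f v, Linf f -> V v -> V (pi f v).
Proof.
move=> /closed_subspaceP[V00 linV clV] Vz f v Lf Vv.
have [g [bg _ ->]] := Linf_repr Lf.
apply: (@BM_ind _ (fun g => V (pi g v))) => //.
- by move=> a f1 f2 b1 b2 V1 V2; rewrite wpi_linear; [exact: linV|exact: BM_Linf..].
- move=> f_ f1 bf Vf bl; apply: clV.
  exact: (@tends_near _ _ V (fun n => pi (f_ n) v) _ Vf (pi_blim v bf bl)).
- by move=> k; exact: Vz.
Qed.

Lemma V0_pi v f x : Linf f -> V0 v x -> V0 v (pi f x).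
Proof.
move=> Lf Vx; apply: (pi_stable (closed_span (T_orbit v))) => //.
move=> k y Vy; have lk : lbop (pi (zpow k)) by apply: lbop_pi; exact/BM_Linf/BM_zpow.
have C := closed_preim lk (closed_span (T_orbit v)).
apply: (closed_span_min C _ Vy) => j /=.
have -> : pi (zpow k) (T_orbit v j) = T_orbit v (k + j); last exact: closed_span_mem.
rewrite !T_orbitE -wpi_mul; [|exact/BM_Linf/BM_zpow..].
by apply: pi_ext => z; rewrite zpowD.
Qed.

Lemma V0_self v : V0 v v.
Proof. exact: (@closed_span_mem _ _ _ (T_orbit v) 0). Qed.

Lemma V0_ortho v y : V0 v y -> (forall f, BM f -> inner (pi f y) v = 0) -> y = 0.
Proof.
move=> Vy h; apply: (span_ortho Vy) => k.
rewrite T_orbitE wpi_star; last exact/BM_Linf/BM_zpow.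
by rewrite innerC h ?rmorph0 //; exact/BM_conj/BM_zpow.
Qed.

End Representation.
(** * Symbols of vectors *)

Section RadonNikodym.
Variable R : realType.
Local Notation mu := (haar R).
Variable m : set (circle R) -> R.
Hypothesis m0 : m set0 = 0.
Hypothesis m_sigma : forall F : nat -> set (circle R), (forall n, measurable (F n)) ->
  trivIset setT F -> (fun n => \sum_(i < n) m (F i)) @ \oo --> m (\bigcup_n F n).
Hypothesis m_ac : forall A, measurable A -> mu A = 0 -> m A = 0.

Let nu : set (circle R) -> \bar R := fun A => (m A)%:E.

Let nu0 : nu set0 = 0%E. Proof. by rewrite /nu m0. Qed.

Let nu_fin A : measurable A -> nu A \is a fin_num. Proof. by []. Qed.

Let nu_sigma : semi_sigma_additive nu.
Proof.
move=> F mF tF _; rewrite /nu.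
under eq_fun do rewrite sumEFin big_mkord.
by apply: cvg_EFin; [exact: nearW|exact: m_sigma].
Qed.

HB.instance Definition _ := isCharge.Build _ _ _ nu nu0 nu_fin nu_sigma.

Lemma haar_density : exists g : circle R -> R, mu.-integrable setT (EFin \o g) /\
  forall A, measurable A -> m A = \int[mu]_z (\1_A z * g z).
Proof.
have ac : nu `<< mu.
  by move=> B hB A mA AB; rewrite /nu m_ac //; exact: hB.
have ri := Radon_Nikodym_integrable ac.
have rf z := Radon_Nikodym_fin_num z ac.
exists (fun z => fine (Radon_Nikodym nu mu z)).
have E : EFin \o (fun z => fine (Radon_Nikodym nu mu z)) = Radon_Nikodym nu mu.
  by apply/funext => z /=; rewrite fineK.
split; first by rewrite E.
move=> A mA; apply: EFin_inj; rewrite -[LHS]/(nu A) (Radon_Nikodym_integral ac mA).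
rewrite /Rintegral fineK; last first.
  apply: integrable_fin_num => //; apply: (integrable_bd (k := fun z => fine (Radon_Nikodym nu mu z)) (M := 1)).
  - apply: measurable_funM; first exact: measurable_indic.
    by apply/measurable_EFinP; rewrite [X in measurable_fun _ X]E; exact: (measurable_int mu ri).
  - by rewrite [X in integrable _ _ X]E.
  - move=> z; rewrite mul1r normrM indicE.
    by case: (z \in A); rewrite ?normr1 ?normr0 ?mul1r ?mul0r.
rewrite [LHS]integral_mkcond; apply: eq_integral => z _.
rewrite patchE indicE; case: ifP => _; last by rewrite mul0r.
by rewrite mul1r fineK.
Qed.

End RadonNikodym.

(** * Almost everywhere bounds from bounds on integrals over sets *)

Section Density.
Variable R : realType.
Local Notation mu := (haar R).

(** Tested on the set A where g exceeds C: the function 1_A (g - C) is nonnegative and its integral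
    is at most 0. *)
Lemma density_le (g : circle R -> R) (C : R) : mu.-integrable setT (EFin \o g) ->
  (forall A, measurable A -> \int[mu]_z (\1_A z * g z) <= C * fine (mu A)) ->
  {ae mu, forall z, g z <= C}.
Proof.
move=> ig gC; have mg : measurable_fun setT g by apply/measurable_EFinP; exact: (measurable_int mu ig).
pose A := [set z | C < g z].
have mA : measurable A.
  have := measurable_fun_le measurableT mg (@measurable_cst _ _ _ _ setT C).
  rewrite setTI => /measurableC; congr measurable; apply/seteqP.
  by split => z; rewrite /A /= ltNge => /negP.
have iC : mu.-integrable setT (EFin \o (cst C : circle R -> R)) by exact: (finite_measure_integrable_cst mu).
have iI (k : circle R -> R) : mu.-integrable setT (EFin \o k) ->
    mu.-integrable setT (EFin \o (fun z => \1_A z * k z)).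
  move=> ik; apply: (integrable_bd (k := k) (M := 1) _ ik).
    apply: measurable_funM; first exact: measurable_indic.
    by apply/measurable_EFinP; exact: (measurable_int mu ik).
  move=> z; rewrite mul1r normrM indicE.
  by case: (z \in A); rewrite ?normr1 ?normr0 ?mul1r ?mul0r.
pose r z := \1_A z * g z - \1_A z * C.
have r0 z : 0 <= r z.
  rewrite /r -mulrBr indicE; case: (boolP (z \in A)) => [|_]; last by rewrite mul0r.
  by rewrite inE mul1r subr_ge0 => /ltW.
have ir : mu.-integrable setT (EFin \o r).
  exact: (integrableB measurableT (iI _ ig) (iI _ iC)).
have : \int[mu]_z r z = 0.
  apply: le_anti; rewrite Rintegral_ge0 // andbT.
  rewrite RintegralB //; [|exact: iI|exact: (iI _ iC)].
  rewrite RintegralZr //; last first.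
    by have := iI _ (finite_measure_integrable_cst mu 1 measurableT); congr (integrable _ _ _); apply/funext => z /=; rewrite mulr1.
  rewrite (_ : \int[mu]_z \1_A z = fine (mu A)).
    by rewrite subr_le0 mulrC gC.
  by rewrite /Rintegral integral_indic // setIT.
move/(Rintegral_eq0 ir r0); apply: filterS => z; rewrite /r indicE leNgt => rz.
apply/negP => Cg; move: rz; rewrite mem_set // !mul1r => /eqP.
by rewrite subr_eq0 => /eqP e; move: Cg; rewrite e ltxx.
Qed.

Lemma density_norm_le (g : circle R -> R) (C : R) : mu.-integrable setT (EFin \o g) ->
  (forall A, measurable A -> `|\int[mu]_z (\1_A z * g z)| <= C * fine (mu A)) ->
  {ae mu, forall z, `|g z| <= C}.
Proof.
move=> ig gC.
have h1 : {ae mu, forall z, g z <= C}.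
  by apply: density_le => // A mA; apply: le_trans (gC A mA); exact: ler_norm.
have iNg : mu.-integrable setT (EFin \o (fun z => - g z)) by exact: (integrableN ig).
have h2 : {ae mu, forall z, - g z <= C}.
  apply: density_le => // A mA; apply: le_trans (gC A mA).
  rewrite (_ : \int[mu]_z (\1_A z * - g z) = - \int[mu]_z (\1_A z * g z)).
    by rewrite -normrN ler_norm.
  under eq_Rintegral do rewrite mulrN -mulN1r.
  rewrite RintegralZl ?mulN1r //; apply: (integrable_bd (k := g) (M := 1) _ ig).
    apply: measurable_funM; first exact: measurable_indic.
    by apply/measurable_EFinP; exact: (measurable_int mu ig).
  move=> z; rewrite mul1r normrM indicE.
  by case: (z \in A); rewrite ?normr1 ?normr0 ?mul1r ?mul0r.
by apply: filterS2 h1 h2 => z a b; rewrite ler_norml; lra.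
Qed.

End Density.

Section Symbol.
Variables (R : realType) (N : nat) (W : wavelet_rep R N).
Hypothesis normalW : normal_rep W.
Hypothesis N2 : (2 <= N)%N.
Implicit Types (x y v phi : wspace W) (f g h : circle R -> R[i]).
Local Notation pi := (wpi W).
Local Notation I := (@cintegral R).
Local Notation mu := (haar R).
Local Notation V0 v := (closure (lin_span (T_orbit v))).

Lemma pi_null A x : measurable A -> mu A = 0 -> pi (cind A) x = 0.
Proof.
move=> mA A0; rewrite -(pi0 x); apply: wpi_ae; first exact/BM_Linf/BM_cind.
  exact: Linf_cst.
exists A; split => // z /= h; apply: contrapT => nA; apply: h.
by rewrite cindE memNset.
Qed.

(** Normality is what makes this set function countably additive; it charges no null set because
    [pi] factors through a.e. equality. *)
Lemma pi_density v phi : exists g : circle R -> R, mu.-integrable setT (EFin \o g) /\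
  forall A, measurable A -> complex.Re (inner (pi (cind A) v) phi) = \int[mu]_z (\1_A z * g z).
Proof.
apply: (haar_density (m := fun A => complex.Re (inner (pi (cind A) v) phi))).
- by rewrite pi_null // ?inner0l ?measure0.
- move=> F mF tF.
  have bF n : BM (fun z => \sum_(i < n) cind (F i) z).
    by apply: BM_sum => i; exact: BM_cind.
  have := tends_innerl phi (pi_blim normalW v bF (blim_sum_cind tF)).
  move/tends_reim => [+ _].
  suff -> : (fun n => complex.Re (inner (pi (fun z => \sum_(i < n) cind (F i) z) v) phi)) =
    (fun n => \sum_(i < n) complex.Re (inner (pi (cind (F i)) v) phi)) by [].
  apply/funext => n.
  rewrite (@pi_sum _ _ W _ _ (fun i : 'I_n => cind (F i))) /=; last by move=> i; exact: BM_cind.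
  elim/big_ind2: _ => [|a b c d <- <-|//]; first by rewrite inner0l.
  by rewrite innerDl re_add.
- by move=> A mA A0; rewrite pi_null // inner0l.
Qed.

Lemma pi_symbol v phi : exists2 g, Lone g &
  forall f, Linf f -> inner (pi f v) phi = I (fun z => f z * g z).
Proof.
have [gr [ir hr]] := pi_density v phi.
(* The imaginary part is obtained as a real part, from Re (-i w) = Im w. *)
have [gi [ii hi]] := pi_density (- 'i *: v) phi.
pose g z : R[i] := gr z +i* gi z.
have lg : Lone g by split.
exists g => //.
have H f : BM f -> inner (pi f v) phi = I (fun z => f z * g z).
  apply: (@indicator_ind _ (fun f => inner (pi f v) phi = I (fun z => f z * g z))).
  - move=> a f1 f2 b1 b2 e1 e2.
    rewrite wpi_linear; [|exact: BM_Linf..].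
    rewrite innerDl innerZl e1 e2 -cintegral_lin; [|exact: LoneM..].
    by apply: eq_cintegral => z; ring.
  - move=> f_ f1 bf ef bl; apply: (tends_unique (tends_innerl phi (pi_blim normalW v bf bl))).
    by under eq_fun do rewrite ef; exact: cintegral_blim.
  - move=> A mA; have -> : I (fun z => cind A z * g z) =
        (\int[mu]_z (\1_A z * gr z)) +i* (\int[mu]_z (\1_A z * gi z)).
      by rewrite /cintegral; congr (_ +i* _); apply: eq_Rintegral => z _;
        rewrite ?re_mul ?im_mul /= mul0r ?subr0 ?addr0.
    rewrite -hr // -hi // linearZ innerZl.
    by case: (inner (pi (cind A) v) phi) => a b /=; rewrite oppr0 mul0r sub0r mulN1r opprK.
move=> f Lf; have [f' [bf' ff' ->]] := Linf_repr W Lf; rewrite H //.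
have [mf _] := Lf; have [mf' _] := bf'; have mg := Lone_cmeasurable lg.
apply: ae_cintegral; [exact: cmeasurableM|exact: cmeasurableM|].
by apply: filterS ff' => z ->.
Qed.

(** The a priori estimate that makes a symbol essentially bounded. The constant doubles because real
    and imaginary parts are bounded separately. *)
Lemma bounded_symbol v phi C :
  (forall A, measurable A -> nrm (inner (pi (cind A) v) phi) <= C * fine (mu A)) ->
  exists F, [/\ BM F, (forall z, nrm (F z) <= 2 * C) &
    forall f, Linf f -> inner (pi f v) phi = I (fun z => f z * F z)].
Proof.
move=> hC; have [g lg hg] := pi_symbol v phi.
have mg := Lone_cmeasurable lg; have [lr li] := lg.
have C0 : 0 <= C.
  have := hC setT measurableT; rewrite [X in fine X](_ : _ = 1%E); last exact: haarT.
  by rewrite mulr1; apply: le_trans; exact: nrm_ge0.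
have hA A : measurable A -> inner (pi (cind A) v) phi =
    (\int[mu]_z (\1_A z * complex.Re (g z))) +i* (\int[mu]_z (\1_A z * complex.Im (g z))).
  move=> mA; rewrite hg; last exact/BM_Linf/BM_cind.
  by rewrite /cintegral; congr (_ +i* _); apply: eq_Rintegral => z _;
    rewrite ?re_mul ?im_mul /= mul0r ?subr0 ?addr0.
have h1 : {ae mu, forall z, `|complex.Re (g z)| <= C}.
  apply: density_norm_le => // A mA; apply: le_trans (hC A mA).
  by apply: le_trans (le_re_nrm _); rewrite hA.
have h2 : {ae mu, forall z, `|complex.Im (g z)| <= C}.
  apply: density_norm_le => // A mA; apply: le_trans (hC A mA).
  by apply: le_trans (le_im_nrm _); rewrite hA.
have h3 : {ae mu, forall z, nrm (g z) <= 2 * C}.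
  by apply: filterS2 h1 h2 => z a b; apply: le_trans (nrm_le_reim _) _; lra.
have [F [bF gF Fle]] := Linf_BM mg h3.
exists F; split => //; first by move=> z; apply: le_trans (Fle z) _; rewrite ger0_norm //; lra.
move=> f Lf; rewrite hg //; have [mf _] := Lf; have [mF _] := bF.
apply: ae_cintegral; [exact: cmeasurableM|exact: cmeasurableM|].
by apply: filterS gF => z ->.
Qed.

(** Condition (i) as an integral identity, without naming a correlation function: f -> pi(f) phi is
    isometric for the L^2 norm. *)
Definition uncorrelated phi := forall f, Linf f -> inner (pi f phi) phi = I f.

Lemma uncorrelatedP phi : (forall f, BM f -> inner (pi f phi) phi = I f) -> uncorrelated phi.
Proof.
move=> h f Lf; have [f' [bf' ff' ->]] := Linf_repr W Lf; rewrite h //.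
have [mf _] := Lf; have [mf' _] := bf'.
by apply: ae_cintegral => //; apply: filterS ff' => z ->.
Qed.

Section Uncorrelated.
Variable phi : wspace W.
Hypothesis Hphi : uncorrelated phi.

Lemma uncorrelated_inner f g : Linf f -> Linf g ->
  inner (pi f phi) (pi g phi) = I (fun z => f z * Num.conj (g z)).
Proof.
move=> Lf Lg; rewrite pi_innerC // -wpi_mul //; last exact: Linf_conj.
rewrite Hphi; last by apply: LinfM => //; exact: Linf_conj.
by apply: eq_cintegral => z; rewrite mulrC.
Qed.

Lemma nrm_uncorrelated_cind A : measurable A ->
  nrm (pi (cind A) phi) ^+ 2 = fine (mu A).
Proof.
move=> mA; apply: complexI; rewrite -pi_cind_inner // Hphi ?cintegral_cind //.
exact/BM_Linf/BM_cind.
Qed.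

(** The difference v - pi(F) phi stays in V0 and has zero inner product with every T^k phi. Hence a
    bounded symbol recovers its vector. *)
Lemma symbol_eq v F : V0 phi v -> Linf F ->
  (forall f, BM f -> inner (pi f v) phi = I (fun z => f z * F z)) -> v = pi F phi.
Proof.
move=> Vv LF h; apply/eqP; rewrite -subr_eq0; apply/eqP.
have [_ _ linV] := closed_span (T_orbit phi).
have Vd : V0 phi (v - pi F phi).
  by rewrite addrC -scaleN1r; apply: linV => //; apply: V0_pi => //; exact: V0_self.
apply: (V0_ortho N2 Vd).
move=> f bf; have Lf := BM_Linf bf.
rewrite (lbopB _ _ (lbop_pi W Lf)) innerBl h // -wpi_mul // Hphi ?subrr //.
exact: LinfM.
Qed.

Lemma symbol_zero v g : V0 phi v -> Lone g ->
  (forall f, Linf f -> inner (pi f v) phi = I (fun z => f z * g z)) ->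
  {ae mu, forall z, g z = 0} -> v = 0.
Proof.
move=> Vv lg h g0; rewrite (@symbol_eq v (fun=> 0)) //; first exact: pi0.
  exact: Linf_cst.
move=> f bf; rewrite h; last exact: BM_Linf.
have [mf _] := bf; have mg := Lone_cmeasurable lg.
apply: ae_cintegral; [exact: cmeasurableM|by apply: cmeasurableM => //; exact: cmeasurable_cst|].
by apply: filterS g0 => z ->.
Qed.

Lemma uncorrelated_ae0 f : Linf f -> pi f phi = 0 -> {ae mu, forall z, f z = 0}.
Proof.
move=> Lf f0; have [g [bg fg e]] := Linf_repr W Lf.
have : I (fun z => (nrm (g z) ^+ 2)%:C) = 0.
  have <- : inner (pi g phi) (pi g phi) = I (fun z => (nrm (g z) ^+ 2)%:C).
    rewrite uncorrelated_inner; [|exact: BM_Linf..].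
    by apply: eq_cintegral => z; rewrite mulcJ.
  by rewrite -e f0 inner0l.
move/(@cintegral_eq0 _ (fun z => nrm (g z) ^+ 2)) => H.
have : {ae mu, forall z, nrm (g z) ^+ 2 = 0}.
  apply: H => [|z]; last exact: sqr_ge0.
  have := BMM bg (BM_conj bg); congr BM; apply/funext => z; exact: mulcJ.
apply: filterS2 fg => z -> /eqP; rewrite sqrf_eq0 nrm_eq0; exact: eqP.
Qed.

End Uncorrelated.
End Symbol.
(** * The intersection of the U^m V0 *)

Section EventuallySmall.
Variables (R : realType) (H : hilbert R) (J : Type) (D : nat -> J -> H -> R[i]) (K : R).
Hypothesis linD : forall m j (c : R[i]) x y, D m j (c *: x + y) = c * D m j x + D m j y.
Hypothesis bdD : forall m j x, nrm (D m j x) <= K * nrm x.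

(** The common bound [K] makes the forms equicontinuous, so smallness for large m, uniform in j,
    survives linear combinations and limits. It reduces mixing to generators. *)
Lemma closed_eventually : closed_subspace [set x | forall e : R, 0 < e ->
  exists m0, forall m, (m0 <= m)%N -> forall j, nrm (D m j x) <= e].
Proof.
have D0 m j : D m j 0 = 0.
  by have := linD m j 1 0 0; rewrite scale1r addr0 mul1r => /eqP; rewrite -subr_eq0 opprD addrA subrr add0r oppr_eq0 => /eqP.
apply/closed_subspaceP; split => /=.
- by move=> e e0; exists 0%N => m _ j; rewrite D0 nrm0 ltW.
- move=> c x y hx hy e e0.
  have c0 : 0 < nrm c + 1 by rewrite ltr_wpDl ?nrm_ge0.
  have e1 : 0 < e / 2 / (nrm c + 1) by rewrite divr_gt0 //; lra.
  have e2 : 0 < e / 2 by lra.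
  have [m1 H1] := hx _ e1; have [m2 H2] := hy _ e2.
  exists (maxn m1 m2) => m; rewrite geq_max => /andP[/H1 h1 /H2 h2] j.
  rewrite linD; apply: le_trans (nrmD _ _) _; rewrite nrmM.
  have := h1 j; rewrite ler_pdivlMr // mulrDr mulr1 mulrC => h1'.
  have := h2 j; have := nrm_ge0 (D m j x); lra.
- move=> x nx e e0.
  have k0 : 0 < `|K| + 1 by rewrite ltr_wpDl.
  have e1 : 0 < e / 2 / (`|K| + 1) by rewrite divr_gt0 //; lra.
  have e2 : 0 < e / 2 by lra.
  have [y hy xy] := nx _ e1; have [m1 H1] := hy _ e2.
  exists m1 => m /H1 h1 j.
  have -> : x = 1 *: (x - y) + y by rewrite scale1r subrK.
  rewrite linD mul1r; apply: le_trans (nrmD _ _) _.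
  have := h1 j; have := bdD m j (x - y); move: xy; rewrite ltr_pdivlMr // mulrDr mulr1 mulrC.
  have := ler_wpM2r (nrm_ge0 (x - y)) (ler_norm K); have := nrm_ge0 (x - y); lra.
Qed.

End EventuallySmall.

(** * Mixing, and why a nonzero vector of the intersection makes the filter degenerate *)

Section Backward.
Variables (R : realType) (N : nat) (W : wavelet_rep R N).
Hypothesis normalW : normal_rep W.
Hypothesis N2 : (2 <= N)%N.
Implicit Types (x y v : wspace W) (f g h : circle R -> R[i]).
Local Notation pi := (wpi W).
Local Notation I := (@cintegral R).
Local Notation mu := (haar R).
Local Notation U := (wU W).
Local Notation V' := (unitary_inv (wU W)).
Variable phi : wspace W.
Hypothesis Hphi : uncorrelated phi.
Local Notation V0 := (closure (lin_span (T_orbit phi))).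

(** An indicator acts as a projection. Placed on both sides, it gives Cauchy-Schwarz two factors
    that shrink with A, as [bounded_symbol] demands. *)
Lemma pi_cind2 A x y : measurable A ->
  inner (pi (cind A) x) y = inner (pi (cind A) x) (pi (cind A) y).
Proof.
move=> mA; have LA := BM_Linf (BM_cind mA).
rewrite pi_innerC // -wpi_mul //; last exact: Linf_conj.
by congr (inner _ y); apply: pi_ext => z; rewrite cind_conj cindM.
Qed.

Let Npow_gt0 m : (0 < N ^ m)%N.
Proof. by rewrite expn_gt0 (leq_trans _ N2). Qed.

(** The threshold [m0] does not depend on [F], since [F] will itself vary with m. For a = T^k phi
    and b = T^l phi the difference is exactly 0 once N^m > |k - l|; [closed_eventually] then extends
    the estimate in each variable, with a conjugate to make the second one linear. *)
Lemma mixing a b C : V0 a -> V0 b -> 0 <= C -> forall e : R, 0 < e ->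
  exists m0, forall m, (m0 <= m)%N -> forall F, BM F -> (forall z, nrm (F z) <= C) ->
  nrm (inner (pi (fun z => F (circle_pow (N ^ m) z)) a) b - inner a b * I F) <= e.
Proof.
move=> Va Vb C0.
pose J := {F : circle R -> R[i] | BM F /\ forall z, nrm (F z) <= C}.
pose D x y m (j : J) := inner (pi (fun z => (sval j) (circle_pow (N ^ m) z)) x) y - inner x y * I (sval j).
pose small (Q : nat -> J -> R[i]) := forall e : R, 0 < e ->
  exists m0, forall m, (m0 <= m)%N -> forall j, nrm (Q m j) <= e.
suff S : small (D a b).
  move=> e /S[m0 Hm]; exists m0 => m mm F bF FC.
  exact: (Hm m mm (exist _ F (conj bF FC))).
have bFm m (j : J) : BM (fun z => (sval j) (circle_pow (N ^ m) z)).
  by case: j => F [bF FC] /=; exact: (BM_comp (measurable_circle_pow _)).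
have bd x y m j : nrm (D x y m j) <= 3 * C * (nrm x * nrm y).
  rewrite /D; apply: le_trans (nrmB _ _) _; rewrite nrmM.
  have [mF _] := bFm m j; case: j mF => F [bF FC] /= mF.
  have h1 := cauchy_schwarz (pi (fun z => F (circle_pow (N ^ m) z)) x) y.
  have h2 : nrm (pi (fun z => F (circle_pow (N ^ m) z)) x) <= C * nrm x.
    by apply: nrm_pi_le => // z; exact: FC.
  have h3 := ler_wpM2r (nrm_ge0 y) h2.
  have h4 : nrm (I F) <= 2 * C by case: bF => ? _; exact: nrm_cintegral.
  have h5 := ler_pM (nrm_ge0 _) (nrm_ge0 _) (cauchy_schwarz x y) h4.
  lra.
have cl1 y : closed_subspace [set x | small (D x y)].
  apply: (@closed_eventually R W J (fun m j x => D x y m j) (3 * C * nrm y)).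
    move=> m j c u v; rewrite /D; have [lin _] := lbop_pi W (BM_Linf (bFm m j)).
    by rewrite lin !innerDl !innerZl; ring.
  by move=> m j x; apply: le_trans (bd x y m j) _; rewrite [nrm x * _]mulrC mulrA.
have cl2 x : closed_subspace [set y | small (fun m j => Num.conj (D x y m j))].
  apply: (@closed_eventually R W J (fun m j y => Num.conj (D x y m j)) (3 * C * nrm x)).
    move=> m j c u v; rewrite /D !innerDr !innerZr !rmorphB !rmorphM !rmorphD !rmorphM /= conjCK; ring.
  by move=> m j y; rewrite nrm_conj; apply: le_trans (bd x y m j) _; rewrite mulrA.
have base k l : small (D (T_orbit phi k) (T_orbit phi l)).
  move=> e e0; exists `|k - l|%N => m hm j; rewrite (_ : D _ _ m j = 0) ?nrm0 ?ltW //.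
  have bk := BM_Linf (BM_zpow R k); have bl := BM_Linf (BM_zpow R l).
  have LF := BM_Linf (bFm m j).
  have E (z : circle R) : zpow k z * Num.conj (zpow l z) = zpow (k - l) z by rewrite -zpowN -zpowD.
  rewrite /D !T_orbitE // -wpi_mul // !uncorrelated_inner //; last exact: LinfM.
  under eq_cintegral do rewrite -mulrA E.
  under [X in _ - X * _]eq_cintegral do rewrite E.
  rewrite cintegral_pow_zpow ?cintegral_zpow ?subrr //; last by case: j {LF} => F [].
  by apply: leq_ltn_trans hm _; exact: ltn_expl.
have step l : small (D a (T_orbit phi l)).
  exact: (closed_span_min (cl1 (T_orbit phi l)) (fun k => base k l) Va).
have step' l : small (fun m j => Num.conj (D a (T_orbit phi l) m j)).
  move=> e e0; have [m0 Hm] := step l e e0.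
  by exists m0 => m mm j; rewrite nrm_conj; exact: Hm.
have : small (fun m j => Num.conj (D a b m j)) := closed_span_min (cl2 a) step' Vb.
by move=> S e /S[m0 Hm]; exists m0 => m mm j; rewrite -nrm_conj; exact: Hm.
Qed.

Lemma iterV_inner m x y : inner (iter m V' x) y = inner x (iter m U y).
Proof. by rewrite -(iter_inner U m) iter_invK. Qed.

(* U^-m pi(f) U^m commutes with pi, so its compression to V0 = L^2(T) is
   multiplication by a bounded F, the conditional expectation of f |m0^(m)|^2. *)
Lemma compression m f C : cmeasurable f -> (forall z, nrm (f z) <= C) ->
  exists F, [/\ BM F, forall z, nrm (F z) <= 2 * C,
    inner (pi f (iter m U phi)) (iter m U phi) = I F &
    forall x y, V0 (iter m V' x) -> V0 (iter m V' y) ->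
      inner (pi f x) y = inner (pi (fun z => F (circle_pow (N ^ m) z)) x) y].
Proof.
move=> mf fC; have bf : BM f by split => //; exists C.
have Lf := BM_Linf bf.
pose X x := iter m V' (pi f (iter m U x)).
have lX : lbop X.
  apply: (lbop_comp (lbop_iter m (lbop_unitary_inv U))).
  apply: (lbop_comp (lbop_pi W Lf)); exact: (lbop_iter m (lbop_unitary U)).
have X_le x : nrm (X x) <= C * nrm x.
  by rewrite /X iter_inv_nrm; apply: le_trans (nrm_pi_le _ mf fC) _; rewrite iter_nrm.
have piX h x : Linf h -> pi h (X x) = X (pi h x).
  move=> Lh; have Lhm : Linf (fun z => h (circle_pow (N ^ m) z)) by exact: Linf_pow.
  by rewrite /X pi_iterV // pi_comm // -iterU_pi.
have C0 : 0 <= C by apply: le_trans (fC (@circle_one R)); exact: nrm_ge0.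
have [|F [bF FC hF]] := @bounded_symbol R N W normalW (X phi) phi C.
  move=> A mA; have LA := BM_Linf (BM_cind mA).
  rewrite pi_cind2 // piX //; apply: le_trans (cauchy_schwarz _ _) _.
  rewrite -(nrm_uncorrelated_cind Hphi mA) expr2 mulrA.
  by rewrite ler_wpM2r ?nrm_ge0.
have LF := BM_Linf bF.
exists F; split => //.
  rewrite -iterV_inner -/(X phi) -[X phi]wpi_one hF; last exact: Linf_cst.
  by apply: eq_cintegral => z; rewrite mul1r.
move=> x y Vx Vy.
(* On the orbit of phi, [X] commutes with pi(z^k) and so acts through its value at phi, whose symbol
   is F. *)
have E a b : V0 a -> V0 b -> inner (X a) b = inner (pi F a) b.
  apply: (span_ext2 lX (lbop_pi W LF)) => k l; rewrite !T_orbitE //.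
  have Lk := BM_Linf (BM_zpow R k); have Ll := BM_Linf (BM_zpow R l).
  rewrite -piX // pi_innerC // -wpi_mul //; last exact: Linf_conj.
  rewrite hF; last by apply: LinfM => //; exact: Linf_conj.
  rewrite -wpi_mul // uncorrelated_inner //; last exact: LinfM.
  by apply: eq_cintegral => z; ring.
(* Both vectors are written as U^m of vectors of V0, where [X] is multiplication by F; moving U^m
   back across turns F into F(z^(N^m)). *)
rewrite -(iter_invK U m y) -iterV_inner -[x in LHS](iter_invK U m x) -/(X _) E //.
rewrite -[in RHS](iter_invK U m x) -iterU_pi //.
by rewrite -[in RHS](iter_invK U m y) iter_inner iter_invK.
Qed.

(** Membership in the K of the overview: U^-m x lies in V0 exactly when x lies in U^m V0, that is in
    V_(-m). *)
Definition tail x := forall m, V0 (iter m V' x).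

Lemma tail_lin (c : R[i]) x y : tail x -> tail y -> tail (c *: x + y).
Proof.
move=> tx ty m; have [lin _] := lbop_iter m (lbop_unitary_inv U).
by rewrite lin; have [_ _] := closed_span (T_orbit phi); apply.
Qed.

Lemma tailZ (c : R[i]) x : tail x -> tail (c *: x).
Proof.
move=> tx; have : tail (0 : wspace W).
  move=> m; rewrite (lbop0 (lbop_iter m (lbop_unitary_inv U))).
  by have [] := closed_span (T_orbit phi).
by move=> t0; rewrite -[_ *: _]addr0; exact: tail_lin.
Qed.

(** [compression] replaces [f] by some F(z^(N^m)), which [mixing] decouples from a and b; the
    integral of F is the quantity attached to U^m phi. The bound 2 C passed to [mixing] is the one
    supplied by [compression]. *)
Lemma tail_asymptotic f a b : BM f -> tail a -> tail b -> forall e : R, 0 < e ->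
  exists m0, forall m, (m0 <= m)%N ->
  nrm (inner (pi f a) b - inner a b * inner (pi f (iter m U phi)) (iter m U phi)) <= e.
Proof.
move=> [mf [C fC]] ta tb e e0.
have C0 : 0 <= 2 * C.
  by rewrite mulr_ge0 //; apply: le_trans (fC (@circle_one R)); exact: nrm_ge0.
have [m0 Hm] := mixing (ta 0%N) (tb 0%N) C0 e0.
exists m0 => m mm; have [F [bF FC EF ->]] := compression m mf fC; [|exact: ta|exact: tb].
by rewrite EF; exact: Hm.
Qed.

Lemma tail_orthogonal f a b : BM f -> tail a -> tail b -> inner a b = 0 ->
  inner (pi f a) b = 0.
Proof.
move=> bf ta tb ab; apply/eqP; rewrite -nrm_eq0; apply/eqP/le_anti.
rewrite nrm_ge0 andbT; apply/ler_addgt0Pr => e e0; rewrite add0r.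
have [m /(_ _ (leqnn m))] := tail_asymptotic bf ta tb e0.
by rewrite ab mul0r subr0.
Qed.

(** Both sides are compared with the same number, that of U^m phi for one m large enough for a and
    b. *)
Lemma tail_same_modulus f a b : BM f -> tail a -> tail b -> nrm a = 1 -> nrm b = 1 ->
  inner (pi f a) a = inner (pi f b) b.
Proof.
move=> bf ta tb a1 b1; apply/eqP; rewrite -subr_eq0 -nrm_eq0; apply/eqP/le_anti.
rewrite nrm_ge0 andbT; apply/ler_addgt0Pr => e e0; rewrite add0r.
have e2 : 0 < e / 2 by lra.
have [m1 H1] := tail_asymptotic bf ta ta e2; have [m2 H2] := tail_asymptotic bf tb tb e2.
have := H1 _ (leq_maxl m1 m2); have := H2 _ (leq_maxr m1 m2).
rewrite !innerxx a1 b1 expr1n !mul1r.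
set A := inner (pi f (iter _ _ _)) _ => h2 h1.
have -> : inner (pi f a) a - inner (pi f b) b = (inner (pi f a) a - A) - (inner (pi f b) b - A) by ring.
apply: le_trans (nrmB _ _) _; lra.
Qed.

Lemma BM_normalizer (g1 g2 : circle R -> R[i]) : cmeasurable g1 -> cmeasurable g2 ->
  exists r : circle R -> R, [/\ BM (fun z => (r z)%:C), forall z, 0 < r z,
    BM (fun z => (r z)%:C * g1 z) & BM (fun z => (r z)%:C * g2 z)].
Proof.
move=> m1 m2; pose d z := 1 + (nrm (g1 z) + nrm (g2 z)).
have n1 z := nrm_ge0 (g1 z); have n2 z := nrm_ge0 (g2 z).
have d1 z : 1 <= d z by rewrite lerDl addr_ge0.
have d0 z : 0 < d z by apply: lt_le_trans (d1 z).
have mr : measurable_fun setT (fun z => (d z)^-1).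
  have md : measurable_fun setT d.
    apply: measurable_funD => //; apply: measurable_funD; exact: measurable_fun_nrm.
  (* Inserting max(1, t) makes the inverse continuous on the whole line; it changes nothing since d
     >= 1. *)
  have cinv : continuous (fun t : R => (Num.max 1 t)^-1).
    move=> t; apply: cvgV; first by rewrite gt_eqF // lt_max ltr01.
    by apply: continuous_max; [exact: cvg_cst|exact: cvg_id].
  have := measurableT_comp (continuous_measurable_fun cinv) md.
  congr measurable_fun; apply/funext => z /=; congr (_^-1).
  by apply/max_idPr.
have mrC := cmeasurable_real mr.
have le1 (a : R) z : 0 <= a -> a <= d z -> a / d z <= 1.
  by move=> a0 ad; rewrite ler_pdivrMr // mul1r.
exists (fun z => (d z)^-1); split.
- apply: (@BM_real _ _ 1) => // z; rewrite gtr0_norm ?invr_gt0 //.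
  by rewrite -[X in X <= _]mul1r le1.
- by move=> z; rewrite invr_gt0.
- split; first exact: cmeasurableM.
  exists 1 => z; rewrite nrmM nrmC gtr0_norm ?invr_gt0 // mulrC le1 // /d.
  by have := n1 z; have := n2 z; lra.
- split; first exact: cmeasurableM.
  exists 1 => z; rewrite nrmM nrmC gtr0_norm ?invr_gt0 // mulrC le1 // /d.
  by have := n1 z; have := n2 z; lra.
Qed.

(* Two such vectors would be functions g1, g2 with |g1| = |g2| and g1 g2^* = 0.
   As g1, g2 are only integrable, both are first multiplied by a positive r. *)
Lemma tail_no_orthonormal_pair a b : tail a -> tail b -> nrm a = 1 -> nrm b = 1 ->
  inner a b = 0 -> False.
Proof.
move=> ta tb a1 b1 ab.
have [g1 l1 h1] := pi_symbol normalW a phi; have [g2 l2 h2] := pi_symbol normalW b phi.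
have [r [br r0 be1 be2]] := BM_normalizer (Lone_cmeasurable l1) (Lone_cmeasurable l2).
have Lr := BM_Linf br; have Le1 := BM_Linf be1; have Le2 := BM_Linf be2.
set rr := (fun z => (r z)%:C) in Lr br.
set e1 := (fun z => _) in be1 Le1; set e2 := (fun z => _) in be2 Le2.
have E x g e : V0 x -> Linf e -> (forall f, Linf f -> inner (pi f x) phi = I (fun z => f z * g z)) ->
    (forall z, e z = rr z * g z) -> pi rr x = pi e phi.
  move=> Vx Le hx ee; apply: (symbol_eq normalW N2 Hphi) => //; first exact: V0_pi.
  move=> f bf; have Lf := BM_Linf bf; rewrite -wpi_mul // hx; last exact: LinfM.
  by apply: eq_cintegral => z; rewrite ee mulrA.
have Ea : pi rr a = pi e1 phi by apply: (E _ g1) => //; exact: (ta 0%N).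
have Eb : pi rr b = pi e2 phi by apply: (E _ g2) => //; exact: (tb 0%N).
have conj_rr z : Num.conj (rr z) = rr z by exact: conjc_real.
have red f x y : BM f -> inner (pi f (pi rr x)) (pi rr y) = inner (pi (fun z => rr z * (f z * rr z)) x) y.
  move=> bf; have Lf := BM_Linf bf; have Lfr : Linf (fun z => f z * rr z) by exact: LinfM.
  have Lcf : Linf (fun z => Num.conj (rr z) * f z) by apply: LinfM => //; exact: Linf_conj.
  rewrite pi_innerC // -!wpi_mul //; last exact: Linf_conj.
  by congr (inner _ y); apply: pi_ext => z; rewrite conj_rr mulrA.
have bfr f : BM f -> BM (fun z => rr z * (f z * rr z)).
  by move=> bf; apply: BMM => //; exact: BMM.
have int f e e' : BM f -> Linf e -> Linf e' ->
    inner (pi f (pi e phi)) (pi e' phi) = I (fun z => f z * (e z * Num.conj (e' z))).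
  move=> bf Le Le'; have Lf := BM_Linf bf.
  rewrite -wpi_mul // uncorrelated_inner //; last exact: LinfM.
  by apply: eq_cintegral => z; rewrite mulrA.
have orth f : BM f -> I (fun z => f z * (e1 z * Num.conj (e2 z))) = 0.
  move=> bf; rewrite -int // -Ea -Eb red //.
  by apply: tail_orthogonal => //; exact: bfr.
have same f : BM f -> I (fun z => f z * (e1 z * Num.conj (e1 z))) = I (fun z => f z * (e2 z * Num.conj (e2 z))).
  move=> bf; rewrite -!int // -Ea -Eb !red //.
  by apply: tail_same_modulus => //; exact: bfr.
(* Testing [same] with |e1|^2 turns |e1|^4 into |e1|^2 |e2|^2, which is e1 times the conjugate of
   e2, multiplied by a bounded function; [orth] makes its integral 0. *)
have z0 : I (fun z => (nrm (e1 z) ^+ 2 * nrm (e1 z) ^+ 2)%:C) = 0.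
  transitivity (I (fun z => (e1 z * Num.conj (e1 z)) * (e1 z * Num.conj (e1 z)))).
    by apply: eq_cintegral => z; rewrite mulcJ rmorphM.
  rewrite same; last by apply: BMM => //; exact: BM_conj.
  rewrite -(orth (fun z => Num.conj (e1 z) * e2 z)).
    by apply: eq_cintegral => z; ring.
  by apply: BMM => //; exact: BM_conj.
have {z0} e10 : {ae mu, forall z, nrm (e1 z) ^+ 2 * nrm (e1 z) ^+ 2 = 0}.
  apply: cintegral_eq0 z0 => [|z]; last by rewrite mulr_ge0 ?sqr_ge0.
  have := BMM (BMM be1 (BM_conj be1)) (BMM be1 (BM_conj be1)); congr BM.
  by apply/funext => z; rewrite mulcJ [RHS]rmorphM.
have g10 : {ae mu, forall z, g1 z = 0}.
  apply: filterS e10 => z /eqP; rewrite mulf_eq0 orbb sqrf_eq0 nrm_eq0 mulf_eq0.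
  case/orP => /eqP // /complexI rz; by have := r0 z; rewrite rz ltxx.
have := symbol_zero normalW N2 Hphi (ta 0%N) l1 h1 g10 => /= a0.
by move: a1; rewrite a0 nrm0 => /esym/eqP; rewrite oner_eq0.
Qed.

Variable m0 : circle R -> R[i].
Hypothesis Lm0 : Linf m0.
Hypothesis scaling : U phi = pi m0 phi.

Lemma V0_U x : V0 x -> V0 (U x).
Proof.
move=> Vx; have C := closed_preim (lbop_unitary U) (closed_span (T_orbit phi)).
apply: (closed_span_min C _ Vx) => k /=; rewrite T_orbitE //.
have Lk := BM_Linf (BM_zpow R k).
rewrite U_pi // scaling.
have Lkp : Linf (fun z : circle R => zpow k (circle_pow N z)) by exact: (Linf_pow (scale_gt0 N2) Lk).
apply: (V0_pi normalW N2 Lkp); apply: (V0_pi normalW N2 Lm0); exact: V0_self.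
Qed.

Lemma tail_U x : tail x -> tail (U x).
Proof.
move=> tx [|m]; first exact/V0_U/(tx 0%N).
by rewrite iterSr unitaryK.
Qed.

(** The part of U a orthogonal to a stays in the intersection; normalized, it would form a forbidden
    pair with a. *)
Lemma tail_eigenvector a : tail a -> nrm a = 1 ->
  exists lambda : R[i], nrm lambda = 1 /\ U a = lambda *: a.
Proof.
move=> ta a1; pose c := inner (U a) a; pose b := (- c) *: a + U a.
have tb : tail b by apply: tail_lin => //; exact: tail_U.
have ba : inner b a = 0.
  by rewrite innerDl innerZl innerxx a1 expr1n mulr1 addNr.
have b0 : b = 0.
  apply/eqP; case: eqP => // /eqP b0.
  have nb : 0 < nrm b by rewrite lt_def nrm_eq0 b0 nrm_ge0.
  exfalso; apply: (@tail_no_orthonormal_pair ((nrm b)^-1%:C *: b) a) => //.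
  - exact: tailZ.
  - by rewrite nrmZ nrmC gtr0_norm ?invr_gt0 // mulVf ?gt_eqF.
  - by rewrite innerZl ba mulr0.
have Ua : U a = c *: a.
  by apply/eqP; rewrite -subr_eq0 addrC -scaleNr -/b b0.
exists c; split => //.
by have := unitary_nrm U a; rewrite Ua nrmZ a1 mulr1.
Qed.

(** The number <pi(F(z^(N^m))) a, a> is the same for all m, as the unimodular eigenvalues cancel,
    while mixing brings it arbitrarily close to the integral of F. *)
Lemma eigenvector_uncorrelated a lambda : tail a -> nrm a = 1 -> nrm lambda = 1 ->
  U a = lambda *: a -> uncorrelated a.
Proof.
move=> ta a1 l1 Ua; apply: uncorrelatedP => F bF; have LF := BM_Linf bF.
have iterUa m : exists c : R[i], nrm c = 1 /\ iter m U a = c *: a.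
  elim: m => [|m [c [c1 Hc]]]; first by exists 1; rewrite scale1r nrm1.
  by exists (c * lambda); rewrite nrmM c1 l1 mulr1 iterS Hc linearZ /= Ua scalerA.
have inv m : inner (pi (fun z => F (circle_pow (N ^ m) z)) a) a = inner (pi F a) a.
  have [c [c1 Hc]] := iterUa m.
  have LFm : Linf (fun z => F (circle_pow (N ^ m) z)) by exact: Linf_pow.
  rewrite -[RHS](iter_inner U m) iterU_pi // Hc (lbopZ c a (lbop_pi W LFm)) innerZl innerZr mulrA mulcJ c1 expr1n.
  by rewrite mul1r.
apply/eqP; rewrite -subr_eq0 -nrm_eq0; apply/eqP/le_anti.
rewrite nrm_ge0 andbT; apply/ler_addgt0Pr => e e0; rewrite add0r.
have [_ [C FC]] := bF.
have C0 : 0 <= C by apply: le_trans (FC (@circle_one R)); exact: nrm_ge0.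
have [m /(_ _ (leqnn m) F bF FC)] := mixing (ta 0%N) (ta 0%N) C0 e0.
by rewrite inv innerxx a1 expr1n mul1r.
Qed.

(** [degenerate] asks for a map with values in the circle everywhere, so the value 1 is put on the
    null set where |g| differs from 1. *)
Lemma unimodular_circle (g : circle R -> R[i]) : cmeasurable g ->
  {ae mu, forall z, nrm (g z) = 1} ->
  exists2 xi : circle R -> circle R, measurable_fun setT xi &
    {ae mu, forall z, g z = (xi z : R[i])}.
Proof.
move=> mg g1; pose A := [set z | nrm (g z) = 1].
have mA : measurable A.
  by have := measurable_fun_nrm mg measurableT (measurable_set1 1); rewrite setTI.
have unit z : `|if z \in A then g z else 1| == 1.
  case: ifPn => [|_]; last by rewrite normr1.
  by rewrite inE nrmE => ->.
exists (fun z => CirclePoint (unit z) : circle R).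
  have [mr mi] := cmeasurable_trunc 1 mg mA.
  have mc : measurable_fun setT (@circle_coord R \o (fun z => CirclePoint (unit z) : circle R)).
    by apply/measurable_fun_pairP; split.
  move=> _ _ [B mB <-].
  by rewrite (setTI (_ @^-1` B)) -comp_preimage; exact: mc.
by apply: filterS g1 => z gz /=; rewrite mem_set.
Qed.

Lemma tail_degenerate a : tail a -> a != 0 -> degenerate N m0.
Proof.
move=> ta' a'0; have na : 0 < nrm a by rewrite lt_def nrm_eq0 a'0 nrm_ge0.
pose b := (nrm a)^-1%:C *: a; have tb : tail b by exact: tailZ.
have b1 : nrm b = 1 by rewrite nrmZ nrmC gtr0_norm ?invr_gt0 // mulVf ?gt_eqF.
have [lambda [l1 Ub]] := tail_eigenvector tb b1.
have Hb := eigenvector_uncorrelated tb b1 l1 Ub.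
(* Both b and phi are uncorrelated, so pi(1_A) gives them the same norm, the square root of mu(A);
   Cauchy-Schwarz then bounds the symbol of b with constant 1. *)
have [|g [bg _ hg]] := @bounded_symbol R N W normalW b phi 1.
  move=> A mA; rewrite pi_cind2 // mul1r; apply: le_trans (cauchy_schwarz _ _) _.
  rewrite (_ : nrm (pi (cind A) b) = nrm (pi (cind A) phi)).
    by rewrite -expr2 nrm_uncorrelated_cind.
  by apply/eqP; rewrite -(@eqrXn2 _ 2) ?nrm_ge0 // !nrm_uncorrelated_cind.
have Lg := BM_Linf bg; have [mg _] := bg.
have Eb : b = pi g phi.
  apply: (symbol_eq normalW N2 Hphi) => //; first exact: (tb 0%N).
  by move=> f bf; rewrite hg //; exact: BM_Linf.
have g1 : {ae mu, forall z, nrm (g z) = 1}.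
  (* The number <pi(q) b, b> equals the integral of q, as b is uncorrelated, and also that of q
     |g|^2, as b = pi(g) phi. The difference is the integral of q^2. *)
  pose q z := nrm (g z) ^+ 2 - 1.
  have bq : BM (fun z => (q z)%:C).
    have := BMB (BMM bg (BM_conj bg)) (BM_cst 1); congr BM.
    by apply/funext => z; rewrite mulcJ -rmorphB.
  have Lq := BM_Linf bq.
  have z0 : I (fun z => (q z * q z)%:C) = 0.
    have e1 := Hb _ Lq.
    rewrite {1 2}Eb -wpi_mul // uncorrelated_inner // in e1; last exact: LinfM.
    transitivity (I (fun z => (q z)%:C * g z * Num.conj (g z) - (q z)%:C)).
      apply: eq_cintegral => z; rewrite -mulrA mulcJ -rmorphM -rmorphB.
      by congr (_%:C); rewrite /q; ring.
    rewrite cintegralB ?e1 ?subrr //; apply: BM_Lone => //.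
    by apply: BMM; [exact: BMM|exact: BM_conj].
  have : {ae mu, forall z, q z * q z = 0}.
    apply: cintegral_eq0 z0 => [|z]; last by rewrite -expr2 sqr_ge0.
    by have := BMM bq bq; congr BM; apply/funext => z; rewrite rmorphM.
  apply: filterS => z /eqP; rewrite mulf_eq0 orbb subr_eq0 => /eqP h.
  by apply/eqP; rewrite -(@eqrXn2 _ 2) ?nrm_ge0 // h expr1n.
have [xi mxi gxi] := unimodular_circle mg g1.
have gxi' := ae_pow (scale_gt0 N2) gxi.
have Lgs : Linf (fun z => g (circle_pow N z)) by apply: Linf_pow => //; exact: (scale_gt0 N2).
have Lm : Linf (fun z => g (circle_pow N z) * m0 z) by exact: LinfM.
have Llg : Linf (fun z => lambda * g z) by apply: LinfM => //; exact: Linf_cst.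
(* U b is computed twice, through the scaling equation and through the eigenvalue; equal vectors
   pi(f) phi have a.e. equal f. *)
have eig : {ae mu, forall z, g (circle_pow N z) * m0 z - lambda * g z = 0}.
  apply: (uncorrelated_ae0 Hphi).
    have := LinfD Lm (LinfM (Linf_cst (-1)) Llg); congr Linf.
    by apply/funext => z; rewrite mulN1r.
  rewrite piB // piZ // wpi_mul // -scaling -U_pi // -Eb Ub.
  by rewrite subrr.
have lC : `|lambda| == 1 by rewrite nrmE l1.
have nxi (w : circle R) : (w : R[i]) != 0 by exact: circle_neq0.
have main : {ae mu, forall z, m0 z * (xi (circle_pow N z) : R[i]) = lambda * (xi z : R[i])}.
  apply: filterS3 eig gxi gxi' => z h e1 e2; apply/eqP.
  by rewrite -subr_eq0 -e1 -e2 mulrC h.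
split; last by exists xi; split => //; exists (CirclePoint lC : circle R).
apply: filterS main => z h.
have : nrm (m0 z * (xi (circle_pow N z) : R[i])) = nrm (lambda * (xi z : R[i])) by rewrite h.
by rewrite !nrmM !nrm_circle l1 !mulr1 nrmE => ->.
Qed.

End Backward.
(** * Boundedness of the filter *)

Section Rotations.
Variables (R : realType) (N : nat).
Hypothesis N2 : (2 <= N)%N.
Local Notation mu := (haar R).
Local Notation I := (@cintegral R).

Lemma rotation_subproof (c z : circle R) : `|(c : R[i]) * (z : R[i])| == 1.
Proof. by rewrite normrM (eqP (circle_valP c)) (eqP (circle_valP z)) mulr1. Qed.

Definition rotation (c z : circle R) : circle R := CirclePoint (rotation_subproof c z).

Lemma measurable_rotation c : measurable_fun setT (rotation c).
Proof.
have [mr mi] := cmeasurableM (cmeasurable_cst (c : R[i])) (@cmeasurable_id R).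
have mc : measurable_fun setT (@circle_coord R \o rotation c).
  by apply/measurable_fun_pairP; split.
move=> _ _ [B mB <-].
by rewrite (setTI (_ @^-1` B)) -comp_preimage; exact: mc.
Qed.

Definition zetaN : circle R := cis (N%:R^-1).

Lemma zetaN_pow (k : nat) : (zetaN : R[i]) ^+ k = 1 -> (k < N)%N -> k = 0%N.
Proof.
have NR : 0 < N%:R :> R by rewrite ltr0n; exact: leq_trans N2.
rewrite cis_pow => -[c1 _] kN; apply/eqP; case: eqP => // /eqP k0; exfalso.
have p0 := pi_gt0 R.
pose t : R := k%:R / N%:R.
have t0 : 0 < t by rewrite divr_gt0 // ltr0n lt0n.
have t1 : t < 1 by rewrite ltr_pdivrMr // mul1r ltr_nat.
have E : k%:R * (2 * pi / N%:R) = t * (2 * pi) by rewrite /t; ring.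
rewrite E in c1; move: c1.
(* Cosine is injective only on [0, pi]; for t beyond 1/2 the angle is reflected to 1 - t. *)
have [th|th] := leP t 2^-1 => c1.
  have : t * (2 * pi) = 0.
    apply: (@cos_inj R); rewrite ?in_itv /= ?lexx ?pi_ge0 ?cos0 //.
    by apply/andP; split; [rewrite mulr_ge0 ?mulr_ge0 ?pi_ge0 // ltW|nra].
  by apply/eqP; rewrite gt_eqF // mulr_gt0 // mulr_gt0.
have c2 : cos ((1 - t) * (2 * pi)) = 1 :> R.
  rewrite (_ : (1 - t) * (2 * pi) = - (t * (2 * pi)) + pi *+ 2); last by rewrite mulr2n; ring.
  by rewrite cosD2pi cosN.
have : (1 - t) * (2 * pi) = 0.
  apply: (@cos_inj R); rewrite ?in_itv /= ?lexx ?pi_ge0 ?cos0 //.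
  by apply/andP; split; [rewrite mulr_ge0 ?mulr_ge0 ?pi_ge0 // subr_ge0 ltW|nra].
by apply/eqP; rewrite gt_eqF // mulr_gt0 ?subr_gt0 // mulr_gt0.
Qed.

Lemma zetaN_N : (zetaN : R[i]) ^+ N = 1.
Proof.
have NR : N%:R != 0 :> R by rewrite pnatr_eq0 -lt0n; exact: leq_trans N2.
rewrite cis_pow (_ : N%:R * (2 * pi / N%:R) = 2 * pi); last by field.
by have [] := cos_sin_period R 1; rewrite mul1r => -> ->.
Qed.

Lemma zpow_zetaN (k : int) : zpow k zetaN = 1 -> exists q : int, k = q * N%:Z.
Proof.
move=> k1; exists (k %/ N)%Z; rewrite [LHS](divz_eq k N).
have N0 : N%:Z != 0 by rewrite -lt0n; exact: leq_trans N2.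
have r0 := modz_ge0 k N0; have rN := ltz_mod k N0.
suff -> : (k %% N)%Z = 0 by rewrite addr0.
move: k1; rewrite {1}(divz_eq k N) zpowD -zpow_pow.
rewrite (_ : circle_pow N zetaN = @circle_one R); last by apply: val_inj; exact: zetaN_N.
rewrite /zpow exp1rz mul1r.
case: (k %% N)%Z r0 rN => // r _; rewrite ltz_nat => rN r1.
by rewrite (zetaN_pow _ rN).
Qed.

(** A geometric sum of ratio w = zeta^k with w^N = 1: it vanishes unless w = 1, and w = 1 forces N
    to divide k. *)
Lemma rotation_sum (k : int) :
  (\sum_(j < N) zpow k (circle_pow j zetaN) = 0 :> R[i]) \/
  (exists2 q : int, k = q * N%:Z & forall j, zpow k (circle_pow j zetaN) = 1 :> R[i]).
Proof.
pose w : R[i] := zpow k zetaN.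
have E j : zpow k (circle_pow j zetaN) = w ^+ j.
  by rewrite zpow_pow /w [RHS]exprnP /zpow exprz_exp.
have [w1|w1] := eqVneq w 1; [right|left].
  by have [q kq] := zpow_zetaN w1; exists q => // j; rewrite E w1 expr1n.
under eq_bigr do rewrite E.
have := subrX1 w N; rewrite -(E N) (_ : zpow k (circle_pow N zetaN) = 1).
  by rewrite subrr => /esym/eqP; rewrite mulf_eq0 subr_eq0 (negbTE w1) => /eqP.
rewrite /zpow (_ : circle_pow N zetaN = @circle_one R) ?exp1rz //.
by apply: val_inj; exact: zetaN_N.
Qed.

Lemma tends_sum (n : nat) (x_ : 'I_n -> nat -> R[i]) (x : 'I_n -> R[i]) :
  (forall j, tends (x_ j) (x j)) -> tends (fun m => \sum_(j < n) x_ j m) (\sum_(j < n) x j).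
Proof.
move=> t; elim: (index_enum _) => [|j s IH].
  by rewrite big_nil; under eq_fun do rewrite big_nil; exact: tends_cst.
by rewrite big_cons; under eq_fun do rewrite big_cons; exact: tendsD.
Qed.

Variables (W : wavelet_rep R N).
Hypothesis normalW : normal_rep W.
Local Notation pi' := (wpi W).
Local Notation U := (wU W).
Variable phi : wspace W.
Hypothesis Hphi : uncorrelated phi.

Let rot (j : nat) := rotation (circle_pow j zetaN).

(* On U phi only the N-periodic Fourier modes matter, and those come from phi
   through U. This bounds |m0|^2 by N without choosing N-th roots on the circle. *)
Lemma rotation_average f : BM f ->
  \sum_(j < N) inner (pi' (fun z => f (rot j z)) (U phi)) (U phi) = N%:R * I f.
Proof.
have bfr j g : BM g -> BM (fun z => g (rot j z)).
  by move=> bg; apply: (BM_comp _ bg); exact: measurable_rotation.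
apply: (@BM_ind _ (fun f => \sum_(j < N) inner (pi' (fun z => f (rot j z)) (U phi)) (U phi) = N%:R * I f)).
- move=> a f1 f2 b1 b2 e1 e2; rewrite cintegral_lin; [|exact: BM_Lone..].
  rewrite mulrDr mulrCA -e1 -e2 mulr_sumr -big_split /=; apply: eq_bigr => j _.
  by rewrite wpi_linear; [rewrite innerDl innerZl|exact/BM_Linf/bfr..].
- move=> f_ f1 bf ef bl.
  apply: (@tends_unique _ _ (fun n => \sum_(j < N) inner (pi' (fun z => f_ n (rot j z)) (U phi)) (U phi))).
    apply: (@tends_sum N (fun j n => inner (pi' (fun z => f_ n (rot j z)) (U phi)) (U phi))) => j.
    apply: tends_innerl; apply: (pi_blim normalW); first by move=> n; exact: bfr.
    by case: bl => -[M fM] ff; split => [|z]; [exists M => n z; exact: fM|exact: ff].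
  under [X in tends X _]eq_fun do rewrite ef.
  apply: tends_mull; have := cintegral_blim bf bl (Lone_cst 1).
  under eq_fun do under eq_cintegral do rewrite mulr1.
  by under eq_cintegral do rewrite mulr1.
- move=> k; have Lk := BM_Linf (BM_zpow R k).
  have E j : pi' (fun z => zpow k (rot j z)) (U phi) = zpow k (circle_pow j zetaN) *: pi' (zpow k) (U phi).
    by rewrite -piZ //; apply: pi_ext => z; rewrite /zpow expfzMl.
  under eq_bigr do rewrite E innerZl.
  rewrite -mulr_suml; have [s0|[q kq h]] := rotation_sum k.
    rewrite s0 mul0r cintegral_zpow; case: eqP => k0; last by rewrite mulr0.
    have N0 : N%:R != 0 :> R[i] by rewrite pnatr_eq0 -lt0n; exact: leq_trans N2.
    move: s0; rewrite k0; under eq_bigr do rewrite zpow0.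
    by rewrite sumr_const card_ord => /eqP; rewrite (negbTE N0).
  under eq_bigr do rewrite h.
  rewrite sumr_const card_ord; congr (_ * _).
  have Lq := BM_Linf (BM_zpow R q).
  (* For k = q N the intertwining relation brings the mode back to z^q acting on phi; z^k and z^q
     have the same integral. *)
  rewrite (_ : pi' (zpow k) (U phi) = U (pi' (zpow q) phi)).
    rewrite unitary_inner Hphi // kq !cintegral_zpow mulf_eq0.
    have -> : (N%:Z == 0) = false by apply/negbTE; rewrite -lt0n; exact: leq_trans N2.
    by rewrite orbF.
  by rewrite U_pi //; apply: pi_ext => z; rewrite zpow_pow kq.
Qed.

(** For an indicator all terms of the rotation average are nonnegative, so the term of the trivial
    rotation is at most the total. *)
Lemma nrm_cind_scaled A : measurable A ->
  nrm (pi' (cind A) (U phi)) ^+ 2 <= N%:R * fine (mu A).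
Proof.
move=> mA; have := rotation_average (BM_cind mA).
have mB j : measurable (rot j @^-1` A).
  by rewrite -[_ @^-1` _]setTI; exact: measurable_rotation.
have E j : inner (pi' (fun z => cind A (rot j z)) (U phi)) (U phi) =
    (nrm (pi' (cind (rot j @^-1` A)) (U phi)) ^+ 2)%:C.
  by rewrite -pi_cind_inner.
under eq_bigr do rewrite E.
rewrite cintegral_cind // -rmorph_sum -(rmorph_nat (real_complex R)) -rmorphM => /complexI <-.
have N0 : (0 < N)%N by exact: leq_trans N2.
rewrite (bigD1 (Ordinal N0)) //= -[X in X <= _]addr0; apply: lerD.
  rewrite le_eqVlt; apply/orP; left; apply/eqP; congr (nrm (pi' (cind _) _) ^+ 2).
  apply/seteqP; split => z /=; rewrite (_ : rot 0 z = z) //;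
    by apply: val_inj; rewrite /= expr0 mul1r.
by apply: sumr_ge0 => j _; exact: sqr_ge0.
Qed.

End Rotations.
(** * Equivalence *)

Section Forward.
Variables (R : realType) (N : nat) (W : wavelet_rep R N).
Hypothesis normalW : normal_rep W.
Hypothesis N2 : (2 <= N)%N.
Implicit Types (x y v : wspace W) (f g h : circle R -> R[i]).
Local Notation pi := (wpi W).
Local Notation I := (@cintegral R).
Local Notation mu := (haar R).
Local Notation U := (wU W).
Variables (phi : wspace W) (V : int -> set (wspace W)).
Hypothesis mraV : MRA V.
Hypothesis Vphi : V 0 phi.
Hypothesis basis : orthonormal_basis (T_orbit phi) (V 0).

Lemma scaling_uncorrelated : uncorrelated phi.
Proof.
have [ortho _] := basis.
apply: uncorrelatedP; apply: BM_ind.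
- move=> a f1 f2 b1 b2 e1 e2; rewrite wpi_linear; [|exact: BM_Linf..].
  by rewrite innerDl innerZl e1 e2 -cintegral_lin; [|exact: BM_Lone..].
- move=> f_ f1 bf ef bl; apply: (tends_unique (tends_innerl phi (pi_blim normalW phi bf bl))).
  under eq_fun do rewrite ef.
  have := cintegral_blim bf bl (Lone_cst 1).
  under eq_fun do under eq_cintegral do rewrite mulr1.
  by under eq_cintegral do rewrite mulr1.
- move=> k; rewrite cintegral_zpow -ortho !T_orbitE //; congr (inner _ _).
  by rewrite -[LHS]wpi_one; apply: pi_ext => z; rewrite zpow0.
Qed.

Lemma mra_mono (m n : int) : m <= n -> V m `<=` V n.
Proof.
have [[_ step] _ _ _ _] := mraV.
move=> mn; have -> : n = m + `|n - m|%N by lia.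
elim: `|n - m|%N => [|k IH]; first by rewrite addr0.
by apply: (subset_trans IH); rewrite -addn1 PoszD addrA; exact: step.
Qed.

Lemma scaling_filter : exists2 m0, Linf m0 & U phi = pi m0 phi.
Proof.
have Hphi := scaling_uncorrelated.
have [_ cl] := basis; have [_ _ _ UV _] := mraV.
have VU : V 0 (U phi).
  have : (U @` V 0) (U phi) by exists phi.
  by rewrite UV; apply: mra_mono.
(* The estimates give sqrt(N) mu(A); it is rounded up to N mu(A) to avoid the square root. *)
have [|F [bF _ hF]] := @bounded_symbol R N W normalW (U phi) phi N%:R.
  move=> A mA; rewrite pi_cind2 //; apply: le_trans (cauchy_schwarz _ _) _.
  have h1 := nrm_cind_scaled N2 normalW Hphi mA.
  have h2 := nrm_uncorrelated_cind Hphi mA.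
  have N1 : 1 <= N%:R :> R by rewrite ler1n; exact: leq_trans N2.
  have m0' : 0 <= fine (mu A) by rewrite -h2 sqr_ge0.
  rewrite -(@ler_pXn2r _ 2) ?nnegrE ?mulr_ge0 ?nrm_ge0 // exprMn h2.
  apply: (@le_trans _ _ (N%:R * fine (mu A) * fine (mu A))); first by rewrite ler_wpM2r.
  rewrite -mulrA -expr2 exprMn ler_wpM2r ?sqr_ge0 // expr2.
  by rewrite -[X in X <= _]mul1r ler_wpM2r // (le_trans _ N1).
exists F; first exact: BM_Linf.
apply: (symbol_eq normalW N2 Hphi); [by rewrite cl|exact: BM_Linf|].
by move=> f bf; apply: hF; exact: BM_Linf.
Qed.

Lemma scaling_nondegenerate m0 : Linf m0 -> U phi = pi m0 phi -> ~ degenerate N m0.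
Proof.
move=> Lm0 Um0 [_ [xi [mxi [lambda H]]]].
have Hphi := scaling_uncorrelated.
have [_ cl] := basis; have [[cV _] _ cap UV _] := mraV.
pose Xi z : R[i] := (xi z : R[i]).
have LXi : Linf Xi.
  apply: Linf_unimodular; last by move=> z; exact/eqP/circle_valP.
  exact: (cmeasurable_comp mxi (@cmeasurable_id R)).
pose psi := pi Xi phi.
have Upsi : U psi = (lambda : R[i]) *: psi.
  have LXs := Linf_pow (scale_gt0 N2) LXi.
  rewrite /psi U_pi // Um0 -wpi_mul // -piZ //.
  apply: wpi_ae; [exact: LinfM|by apply: LinfM => //; exact: Linf_cst|].
  by apply: filterS H => z h; rewrite mulrC.
have V0psi : V 0 psi.
  by rewrite -cl; apply: V0_pi => //; exact: V0_self.
(* U maps V_(-n) onto V_(-n-1), and U psi is a nonzero multiple of psi, so psi descends one level at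
   a time. *)
have Vneg (n : nat) : V (- n%:Z) psi.
  elim: n => [|n IH]; first by rewrite oppr0.
  have : (U @` V (- n%:Z)) (U psi) by exists psi.
  rewrite UV (_ : - n%:Z - 1 = - n.+1%:Z); last by lia.
  rewrite Upsi; have [_ V00 lin] := cV (- n.+1%:Z) => h.
  have := lin (lambda : R[i])^-1 _ 0 h V00.
  by rewrite addr0 scalerA mulVf ?circle_neq0 // scale1r.
have : (\bigcap_n V n) psi.
  move=> n _; have [n0|n0] := leP 0 n; first exact: (mra_mono n0).
  by have := Vneg `|n|%N; rewrite (_ : - `|n|%N%:Z = n); last by lia.
rewrite cap => /= psi0.
have : inner psi psi = 1.
  rewrite uncorrelated_inner // -cintegral1; apply: eq_cintegral => z.
  by rewrite mulcJ nrm_circle expr1n.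
by rewrite psi0 inner0l => /esym/eqP; rewrite oner_eq0.
Qed.

(** The fixed vectors of p form a closed subspace. It contains V0 because p commutes with T, and
    each V_n with n >= 0 by induction, since U maps V_(n+1) onto V_n and is injective; density
    finishes. *)
Lemma scaling_cyclic (p : {linear wspace W -> wspace W}) :
  bounded_operator p -> in_commutant p -> p phi = phi -> (p : wspace W -> wspace W) = idfun.
Proof.
move=> bp [_ pU ppi] pphi; have lp := lbop_bounded bp.
have cE := closed_eq lp (lbop_id (wspace W)).
have [_ cl] := basis; have [[_ _] dense _ UV _] := mraV.
have p0 x : V 0 x -> p x = x.
  rewrite -cl => Vx; apply: (closed_span_min cE _ Vx) => k /=.
  by rewrite T_orbitE // ppi ?pphi //; exact/BM_Linf/BM_zpow.
have pn (n : nat) x : V n%:Z x -> p x = x.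
  elim: n x => [|n IH] x Vx; first exact: p0.
  have : (U @` V n.+1%:Z) (U x) by exists x.
  rewrite UV (_ : n.+1%:Z - 1 = n%:Z); last by lia.
  by move/IH; rewrite pU => /(can_inj (unitaryK U)).
have /closed_subspaceP[_ _ clE] := cE.
apply/funext => x; apply: clE.
have : closure (\bigcup_n V n) x by rewrite dense.
move/closureP => nx e /nx[y [n _ Vy] xy]; exists y => //=.
by apply: (pn `|n|%N); apply: (mra_mono _ Vy); lia.
Qed.

End Forward.

(** * The multiresolution analysis built from the three conditions *)

Section Construction.
Variables (R : realType) (N : nat) (W : wavelet_rep R N).
Hypothesis normalW : normal_rep W.
Hypothesis N2 : (2 <= N)%N.
Local Notation pi := (wpi W).
Local Notation U := (wU W).
Local Notation V' := (unitary_inv (wU W)).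
Variable phi : wspace W.
Hypothesis Hphi : uncorrelated phi.
Variable m0 : circle R -> R[i].
Hypothesis Lm0 : Linf m0.
Hypothesis ndeg : ~ degenerate N m0.
Hypothesis scaling : U phi = pi m0 phi.
Hypothesis cyclic : ~ exists p : {linear wspace W -> wspace W},
  [/\ orthogonal_projection p, in_commutant p,
      (p : wspace W -> wspace W) <> idfun & p phi = phi].
Local Notation V0 := (closure (lin_span (T_orbit phi))).

(** This is U^-n V0, written as a preimage so that closedness follows from the continuity of U^n. *)
Definition mra_space (n : int) : set (wspace W) := [set x | V0 (unitary_exp U n x)].
Local Notation V := mra_space.

Lemma mra_space_closed n : closed_subspace (V n).
Proof. by apply: closed_preim; [exact: lbop_unitary_exp|exact: closed_span]. Qed.

Lemma mra_spaceS n : V n `<=` V (n + 1).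
Proof.
by move=> x; rewrite /V /= unitary_expS; exact: (V0_U normalW N2 Lm0 scaling).
Qed.

Lemma mra_space_mono (m n : int) : m <= n -> V m `<=` V n.
Proof.
move=> mn; have -> : n = m + `|n - m|%N by lia.
elim: `|n - m|%N => [|k IH]; first by rewrite addr0.
by apply: (subset_trans IH); rewrite -addn1 PoszD addrA; exact: mra_spaceS.
Qed.

Lemma mra_spaceU n : U @` V n = V (n - 1).
Proof.
apply/seteqP; split => [_ [x Vx <-]|y Vy].
  by rewrite /V /= -unitary_expSr subrK.
exists (V' y); last by rewrite unitary_invK.
by rewrite /V /= -[n](subrK 1) unitary_expSr unitary_invK.
Qed.

Lemma mra_space_cap : \bigcap_n V n = [set 0].
Proof.
apply/seteqP; split => [x hx|_ ->]; last first.
  by move=> n _; have [_ ? _] := mra_space_closed n.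
apply: contrapT => /eqP x0; apply: ndeg.
have tx : tail phi x.
  by case=> [|m]; [exact: (hx 0)|exact: (hx (Negz m))].
exact: (tail_degenerate normalW N2 Hphi Lm0 scaling tx x0).
Qed.

Lemma closure_stable (A : wspace W -> wspace W) (S : set (wspace W)) : lbop A ->
  (forall x, S x -> S (A x)) -> forall x, closure S x -> closure S (A x).
Proof.
move=> lA SA x /closureP/near_tends[x_ Sx t]; apply/closureP.
by apply: (@tends_near _ _ S (fun n => A (x_ n))); [move=> n; exact: SA|exact: lbop_tends].
Qed.

Lemma mra_space_dense : closure (\bigcup_n V n) = setT.
Proof.
set S := \bigcup_n V n.
have cS : closed_subspace (closure S).
  apply: closure_subspace; first by exists 0 => //; have [_ ? _] := mra_space_closed 0.
  move=> a x y [n _ Vx] [m _ Vy]; exists (Num.max n m) => //.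
  have [_ _ lin] := mra_space_closed (Num.max n m).
  by apply: lin; [apply: (mra_space_mono _ Vx)|apply: (mra_space_mono _ Vy)]; rewrite le_max lexx ?orbT.
have SU : forall x, S x -> S (U x).
  move=> x [n _ Vx]; exists n => //; rewrite /V /= -unitary_expSr.
  exact: mra_spaceS.
have SV : forall x, S x -> S (V' x).
  by move=> x [n _ Vx]; exists (n + 1) => //; rewrite /V /= unitary_expSr unitary_invK.
have Spi f : Linf f -> forall x, S x -> S (pi f x).
  (* The index is raised to |n|, because U^n pi(f) = pi(f(z^(N^n))) U^n makes sense for natural
     n. *)
  move=> Lf x [n _ Vx]; exists `|n|%N%:Z => //.
  have : V `|n|%N%:Z x by apply: (mra_space_mono _ Vx); lia.
  rewrite /V /= iterU_pi // => h; apply: V0_pi => //.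
  by apply: Linf_pow => //; rewrite expn_gt0 (leq_trans _ N2).
pose p : {linear wspace W -> wspace W} := proj cS.
have pphi : p phi = phi.
  apply: proj_id; apply/closureP/near_set_mem; exists 0 => //.
  exact: V0_self.
have comm : in_commutant p.
  split; first by have [] := proj_orthogonal cS.
  - move=> v; apply: (@proj_commute _ _ _ cS U V').
    + exact: lbop_unitary.
    + by move=> x y; rewrite -(unitary_inner U x) unitary_invK.
    + exact: (closure_stable (lbop_unitary U) SU).
    + exact: (closure_stable (lbop_unitary_inv U) SV).
  - move=> f Lf v; have Lc := Linf_conj Lf.
    apply: (@proj_commute _ _ _ cS (pi f) (pi (fun z => Num.conj (f z)))).
    + exact: lbop_pi.
    + by move=> x y; rewrite wpi_star.
    + exact: (closure_stable (lbop_pi W Lf) (Spi _ Lf)).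
    + exact: (closure_stable (lbop_pi W Lc) (Spi _ Lc)).
apply/seteqP; split => // x _.
have pid : (p : wspace W -> wspace W) = idfun.
  apply: contrapT => np; apply: cyclic; exists p; split => //.
  exact: proj_orthogonal.
have <- : p x = x by rewrite pid.
exact: proj_mem.
Qed.

Lemma construction : orthogonal_scaling_vector phi.
Proof.
have V0E : V 0 = V0 by [].
have Vphi : V 0 phi by rewrite V0E; exact: V0_self.
have basis : orthonormal_basis (T_orbit phi) (V 0).
  split => // i j; rewrite !T_orbitE // uncorrelated_inner //; [|exact/BM_Linf/BM_zpow..].
  rewrite -subr_eq0 -cintegral_zpow; apply: eq_cintegral => z.
  by rewrite -zpowN -zpowD.
exists V; split => //; split.
- by split; [exact: mra_space_closed|exact: mra_spaceS].
- exact: mra_space_dense.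
- exact: mra_space_cap.
- exact: mra_spaceU.
- by exists phi.
Qed.

End Construction.

Theorem theorem3p4 (R : realType) (N : nat) (hN : (2 <= N)%N)
    (W : wavelet_rep R N) (normalW : normal_rep W) (phi : wspace W) :
  orthogonal_scaling_vector phi <->
  [/\ (exists2 h : circle R -> R[i],
         correlation_function phi h & {ae haar R, forall z, h z = 1}),
      (exists2 m0 : circle R -> R[i],
         Linf m0 /\ ~ degenerate N m0 & wU W phi = wpi W m0 phi) &
      ~ exists p : {linear wspace W -> wspace W},
          [/\ orthogonal_projection p, in_commutant p,
              (p : wspace W -> wspace W) <> idfun & p phi = phi]].
Proof.
split=> [[V [mraV Vphi basis]]|[[h [lh ch] h1] [m0 [Lm0 ndeg] scaling] cyclic]].
  have Hphi := scaling_uncorrelated normalW hN basis; split.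
  - exists (fun=> 1); last exact: nearW.
    split; first exact: Lone_cst.
    by move=> f Lf; rewrite Hphi //; apply: eq_cintegral => z; rewrite mulr1.
  - have [m0 Lm0 Um0] := scaling_filter normalW hN mraV Vphi basis.
    exists m0 => //; split => //.
    exact: (scaling_nondegenerate normalW hN mraV basis Lm0 Um0).
  - case=> p [[bp _ _] cp np pphi]; apply: np.
    exact: (scaling_cyclic hN mraV basis bp cp pphi).
(* What remains is that phi is uncorrelated, obtained by replacing the correlation function by 1
   under the integral. *)
apply: (construction normalW hN _ Lm0 ndeg scaling cyclic).
move=> f Lf; rewrite ch //; have [mf _] := Lf.
apply: ae_cintegral => //; first by apply: cmeasurableM => //; exact: Lone_cmeasurable.
by apply: filterS h1 => z ->; rewrite mulr1.
Qed.
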